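(* Let $F:\mathcal{S}_n\to\mathbb{R}$ be uniformly elliptic, continuous and quasiconcave. Let $u\in C(B_1)$ be a viscosity solution of $F(D^2u)=0$ in $B_1\subset\mathbb{R}^n$. Then \[ [u]_{C^{1,1}(B_{1/2})}\leq C\big(\sup_{B_1}|u|+|F(0)|\big), \] with $C$ depending only on $n,\lambda,\Lambda$.
   Context: $\mathcal{S}_n$ is the space of real symmetric $n\times n$ matrices. $F$ is uniformly elliptic with constants $0<\lambda\le\Lambda$ if $\lambda\|N\|\leq F(M+N)-F(M)\leq\Lambda\|N\|$ for all $M,N\in\mathcal{S}_n$ with $N\geq0$, where $\|N\|=\sup_{|x|=1}|Nx|$. $F$ is quasiconcave if $F(\theta M_1+(1-\theta)M_2)\geq\min\{F(M_1),F(M_2)\}$ for all $M_1,M_2\in\mathcal{S}_n$, $\theta\in[0,1]$. $[u]_{C^{1,1}(B_{1/2})}$ denotes the Lipschitz seminorm of $Du$ on $B_{1/2}$. A continuous $u$ is a viscosity subsolution (supersolution) of $F(D^2u)=0$ in $\Omega$ if whenever $\varphi\in C^2(\Omega)$ and $u-\varphi$ has a local maximum (minimum) at $x_0\in\Omega$, then $F(D^2\varphi(x_0))\geq0$ (resp. $\leq 0$); a viscosity solution is both. *)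

(* Defs.v *)
From HB Require Import structures.
From mathcomp Require Import all_boot all_order all_algebra.
From mathcomp Require Import all_classical all_reals all_analysis.
Set Implicit Arguments. Unset Strict Implicit. Unset Printing Implicit Defensive.
Import Order.TTheory GRing.Theory Num.Theory.
Import numFieldNormedType.Exports.
Local Open Scope classical_set_scope.
Local Open Scope ring_scope.

Definition enorm {R : realType} {n : nat} (x : 'rV[R]_n) : R :=
  Num.sqrt (\sum_(i < n) x ord0 i ^+ 2).

Definition eball {R : realType} {n : nat} (c : 'rV[R]_n) (r : R) : set 'rV[R]_n :=
  [set x | enorm (x - c) < r].

Definition ebasis {R : realType} {n : nat} (i : 'I_n) : 'rV[R]_n :=
  delta_mx ord0 i.

Definition symmx {R : realType} {n : nat} : set 'M[R]_n := [set M | M^T = M].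

Definition psd {R : realType} {n : nat} (N : 'M[R]_n) : Prop :=
  forall x : 'rV[R]_n, 0 <= (x *m N *m x^T) ord0 ord0.

(* Operator norm ||N|| = sup_{|x|=1} |N x| (Euclidean norms). For the
   spectral norm ||N|| = ||N^T||, so acting on row vectors is the same. *)
Definition opnorm {R : realType} {n : nat} (N : 'M[R]_n) : R :=
  sup [set enorm (x *m N) | x in [set x : 'rV[R]_n | enorm x = 1]].

Definition uniformly_elliptic {R : realType} {n : nat}
    (lam Lam : R) (F : 'M[R]_n -> R) : Prop :=
  forall M N : 'M[R]_n, symmx M -> symmx N -> psd N ->
    lam * opnorm N <= F (M + N) - F M /\ F (M + N) - F M <= Lam * opnorm N.

Definition quasiconcave {R : realType} {n : nat} (F : 'M[R]_n -> R) : Prop :=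
  forall (M1 M2 : 'M[R]_n) (t : R), symmx M1 -> symmx M2 -> 0 <= t <= 1 ->
    Num.min (F M1) (F M2) <= F (t *: M1 + (1 - t) *: M2).

Definition partial {R : realType} {n : nat} (i : 'I_n)
    (f : 'rV[R]_n -> R) (x : 'rV[R]_n) : R :=
  'D_(ebasis i) f x.

Definition C2_on {R : realType} {n : nat} (Omega : set 'rV[R]_n)
    (f : 'rV[R]_n -> R) : Prop :=
  {within Omega, continuous f} /\
  (forall i : 'I_n,
     (forall x, Omega x -> derivable f x (ebasis i)) /\
     {within Omega, continuous (partial i f)}) /\
  (forall i j : 'I_n,
     (forall x, Omega x -> derivable (partial i f) x (ebasis j)) /\
     {within Omega, continuous (partial j (partial i f))}).

Definition hessian {R : realType} {n : nat} (f : 'rV[R]_n -> R)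
    (x : 'rV[R]_n) : 'M[R]_n :=
  \matrix_(i < n, j < n) partial j (partial i f) x.

Definition gradient {R : realType} {n : nat} (f : 'rV[R]_n -> R)
    (x : 'rV[R]_n) : 'rV[R]_n :=
  \row_(i < n) partial i f x.

Definition viscosity_subsolution {R : realType} {n : nat}
    (F : 'M[R]_n -> R) (Omega : set 'rV[R]_n) (u : 'rV[R]_n -> R) : Prop :=
  {within Omega, continuous u} /\
  forall (phi : 'rV[R]_n -> R) (x0 : 'rV[R]_n),
    C2_on Omega phi -> Omega x0 ->
    (\forall x \near x0, u x - phi x <= u x0 - phi x0) ->
    0 <= F (hessian phi x0).

Definition viscosity_supersolution {R : realType} {n : nat}
    (F : 'M[R]_n -> R) (Omega : set 'rV[R]_n) (u : 'rV[R]_n -> R) : Prop :=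
  {within Omega, continuous u} /\
  forall (phi : 'rV[R]_n -> R) (x0 : 'rV[R]_n),
    C2_on Omega phi -> Omega x0 ->
    (\forall x \near x0, u x0 - phi x0 <= u x - phi x) ->
    F (hessian phi x0) <= 0.

Definition viscosity_solution {R : realType} {n : nat}
    (F : 'M[R]_n -> R) (Omega : set 'rV[R]_n) (u : 'rV[R]_n -> R) : Prop :=
  viscosity_subsolution F Omega u /\ viscosity_supersolution F Omega u.

(* Main.v *)
(* Quasiconcavity makes {F >= 0} convex, so local averages of the subsolution u should again
   satisfy F(D^2 U) >= 0. If this fails at a point, separate D^2 U from {F >= 0} by a linear
   functional M |-> A : M; then u is a viscosity subsolution of A : D^2 u >= c, and such a u is a
   uniform limit of smooth almost-subsolutions, obtained by solving a resolvent equation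
   explicitly on trigonometric polynomials, for which averaging is harmless. Hence u is a uniform
   limit of twice differentiable U with F(D^2 U) >= 0 whose differences are averages of those
   of u.

   For a unit vector e, the estimates come from maximizing over (z, r) a second difference
     U(z + r e) + U(z - r e) - 2 u(z) + B (U(z + r e) - U(z - r e))^2 - N m(z) (r + tau)^2,
   with a barrier m blowing up at the boundary of a ball. At a positive maximum u is touched from
   below by an average of two functions with F(D^2 .) >= 0 plus a square, whose Hessian contains
   the positive term 2 B p (x) p with p = DU(z + r e) - DU(z - r e); optimality in r bounds |p| from
   below, and ellipticity contradicts the supersolution property of u. This yields D^2 u <= M; it
   uses a Lipschitz bound, proved in the same way with a first difference. Ellipticity then bounds
   D^2 U from below as well, and Taylor's formula passes to the limit. *)
Require Import Defs.
From HB Require Import structures.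
From mathcomp Require Import all_boot all_order all_algebra.
From mathcomp Require Import all_classical all_reals all_analysis.
From mathcomp Require Import ring lra.
Set Implicit Arguments. Unset Strict Implicit. Unset Printing Implicit Defensive.
Import Order.TTheory GRing.Theory Num.Theory.
Import numFieldNormedType.Exports.
Local Open Scope classical_set_scope.
Local Open Scope ring_scope.

(** At a maximum of a difference of two merely continuous functions there is no second-order
    information to feed into [F]. The maximum arguments are therefore asymmetric: [u] enters them
    only as a viscosity supersolution, and what it is compared with has a pointwise second-order
    expansion, so a quadratic test function for [u] can be written down. Since [U] is only uniformly
    close to [u], the penalty carries [r + tau] in place of [r]: at [r = 0] it still pays for
    [U - u], and [tau] tends to 0 afterwards. Quasiconcavity controls [F] only on convex
    combinations. Expanding the square about the maximum gives its two functions unequal weights,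
    and [B] is tied to the size of their difference so that the weights stay nonnegative. The
    barrier has exponent -2, so its Hessian is of order [m ^+ 2]; the gain [B * N ^+ 2 * m ^+ 2]
    then beats the error [N * m ^+ 2] at every distance from the boundary, once [N] exceeds a
    multiple of [Lam / (lam * B)]. Gain and error are measured along one unit vector or by multiples
    of the identity, so no dimension enters the constants. *)

(** * Euclidean algebra of vectors, quadratic forms and matrices *)

Section Vectors.
Context {R : realType} {n : nat}.
Implicit Types (x y z d : 'rV[R]_n) (X Y : 'M[R]_n) (a c : R).

Definition dot x y : R := \sum_(i < n) x ord0 i * y ord0 i.

Definition qf X x : R := (x *m X *m x^T) ord0 ord0.

Definition mdot X Y : R := \sum_(i < n) \sum_(j < n) X i j * Y i j.

(** A crude bound for the operator norm. It serves only in qualitative limits, so its dependence on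
    the dimension never reaches the final constant. *)
Definition sumnorm X : R := \sum_(i < n) \sum_(j < n) `|X i j|.

Lemma dotC x y : dot x y = dot y x.
Proof. by apply: eq_bigr => i _; rewrite mulrC. Qed.

Lemma dotDr x y z : dot x (y + z) = dot x y + dot x z.
Proof. by rewrite -big_split; apply: eq_bigr => i _; rewrite mxE mulrDr. Qed.

Lemma dotDl x y z : dot (y + z) x = dot y x + dot z x.
Proof. by rewrite !(dotC _ x) dotDr. Qed.

Lemma dotZr a x y : dot x (a *: y) = a * dot x y.
Proof. by rewrite mulr_sumr; apply: eq_bigr => i _; rewrite mxE; ring. Qed.

Lemma dotZl a x y : dot (a *: x) y = a * dot x y.
Proof. by rewrite dotC dotZr dotC. Qed.

Lemma dotNr x y : dot x (- y) = - dot x y.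
Proof. by rewrite -scaleN1r dotZr mulN1r. Qed.

Lemma dotNl x y : dot (- x) y = - dot x y.
Proof. by rewrite dotC dotNr dotC. Qed.

Lemma dotBr x y z : dot x (y - z) = dot x y - dot x z.
Proof. by rewrite dotDr dotNr. Qed.

Lemma dotBl x y z : dot (y - z) x = dot y x - dot z x.
Proof. by rewrite dotDl dotNl. Qed.

Lemma dot0r x : dot x 0 = 0.
Proof. by rewrite -(scale0r 0) dotZr mul0r. Qed.

Lemma dot0l x : dot 0 x = 0.
Proof. by rewrite dotC dot0r. Qed.

Lemma dotxx_ge0 x : 0 <= dot x x.
Proof. by apply: sumr_ge0 => i _; rewrite -expr2 sqr_ge0. Qed.

Lemma enormE x : enorm x = Num.sqrt (dot x x).
Proof. by []. Qed.

Lemma enorm_ge0 x : 0 <= enorm x.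
Proof. exact: sqrtr_ge0. Qed.

Lemma enorm_sqr x : enorm x ^+ 2 = dot x x.
Proof. by rewrite enormE sqr_sqrtr // dotxx_ge0. Qed.

Lemma enormZ a x : enorm (a *: x) = `|a| * enorm x.
Proof.
by rewrite !enormE dotZl dotZr mulrA -expr2 sqrtrM ?sqr_ge0// sqrtr_sqr.
Qed.

Lemma enormN x : enorm (- x) = enorm x.
Proof. by rewrite -scaleN1r enormZ normrN1 mul1r. Qed.

Lemma enorm0 : enorm (0 : 'rV[R]_n) = 0.
Proof. by rewrite enormE dot0r sqrtr0. Qed.

Lemma enorm_eq0 x : (enorm x == 0) = (x == 0).
Proof.
apply/eqP/eqP => [x0|->]; last exact: enorm0.
have xx : dot x x = 0 by rewrite -enorm_sqr x0 expr0n.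
apply/rowP => i; rewrite mxE.
have := psumr_eq0P _ xx => /(_ _ i isT) xi.
by apply/eqP; rewrite -[_ == 0]orbb -mulf_eq0; apply/eqP/xi => j _; rewrite -expr2 sqr_ge0.
Qed.

Lemma dot_le x y : dot x y <= enorm x * enorm y.
Proof.
have [/eqP|x0] := eqVneq (enorm x) 0.
  by rewrite enorm_eq0 => /eqP ->; rewrite dot0l enorm0 mul0r.
have [/eqP|y0] := eqVneq (enorm y) 0.
  by rewrite enorm_eq0 => /eqP ->; rewrite dot0r enorm0 mulr0.
have xp : 0 < enorm x by rewrite lt_neqAle eq_sym x0 enorm_ge0.
have yp : 0 < enorm y by rewrite lt_neqAle eq_sym y0 enorm_ge0.
have := dotxx_ge0 ((enorm y) *: x - (enorm x) *: y).
rewrite dotBl !dotBr !dotZl !dotZr -(enorm_sqr y) -(enorm_sqr x) (dotC y x) => h.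
have : 0 <= (enorm x * enorm y) * (enorm x * enorm y - dot x y) by nra.
by rewrite pmulr_rge0 ?mulr_gt0// subr_ge0.
Qed.

Lemma norm_dot_le x y : `|dot x y| <= enorm x * enorm y.
Proof.
by rewrite ler_norml dot_le andbT lerNl -dotNl (le_trans (dot_le _ _)) ?enormN.
Qed.

Lemma enormD x y : enorm (x + y) <= enorm x + enorm y.
Proof.
rewrite -(@ler_pXn2r _ 2) ?nnegrE ?addr_ge0 ?enorm_ge0//.
rewrite enorm_sqr dotDl !dotDr -!enorm_sqr (dotC y x).
by have := dot_le x y; nra.
Qed.

Lemma enormB x y : enorm (x - y) <= enorm x + enorm y.
Proof. by rewrite (le_trans (enormD _ _)) ?enormN. Qed.

Lemma enormBC x y : enorm (x - y) = enorm (y - x).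
Proof. by rewrite -enormN opprB. Qed.

Lemma enorm_gt0 x : (0 < enorm x) = (x != 0).
Proof. by rewrite lt_neqAle enorm_ge0 andbT eq_sym enorm_eq0. Qed.

Lemma dot_ebasis x i : dot x (ebasis i) = x ord0 i.
Proof.
rewrite /dot (bigD1 i) //= big1 ?addr0 => [|j ji].
  by rewrite /ebasis mxE !eqxx mulr1.
by rewrite /ebasis mxE (negbTE ji) andbF mulr0.
Qed.

Lemma enorm_ebasis i : enorm (ebasis i : 'rV[R]_n) = 1.
Proof. by rewrite enormE dot_ebasis /ebasis mxE !eqxx sqrtr1. Qed.

Lemma coord_le_enorm x i : `|x ord0 i| <= enorm x.
Proof. by rewrite -dot_ebasis (le_trans (norm_dot_le _ _)) // enorm_ebasis mulr1. Qed.

Lemma enorm_le_sum x : enorm x <= \sum_(i < n) `|x ord0 i|.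
Proof.
have E : x = \sum_(i < n) x ord0 i *: ebasis i by exact: row_sum_delta.
rewrite {1}E; elim/big_ind2 : _ => [|u a v b ua vb|i _]; first by rewrite enorm0.
  by rewrite (le_trans (enormD _ _)) // lerD.
by rewrite enormZ enorm_ebasis mulr1.
Qed.

Lemma qfE X x : qf X x = dot (x *m X) x.
Proof. by rewrite /qf mxE; apply: eq_bigr => i _; rewrite [_^T _ _]mxE. Qed.

Lemma qfDl X Y x : qf (X + Y) x = qf X x + qf Y x.
Proof. by rewrite !qfE mulmxDr dotDl. Qed.

Lemma qfZl a X x : qf (a *: X) x = a * qf X x.
Proof. by rewrite !qfE -scalemxAr dotZl. Qed.

Lemma qfNl X x : qf (- X) x = - qf X x.
Proof. by rewrite -scaleN1r qfZl mulN1r. Qed.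

Lemma qfBl X Y x : qf (X - Y) x = qf X x - qf Y x.
Proof. by rewrite qfDl qfNl. Qed.

Lemma qf_scalar c x : qf c%:M x = c * enorm x ^+ 2.
Proof. by rewrite qfE mul_mx_scalar dotZl enorm_sqr. Qed.

Lemma mul_outer x d : x *m (d^T *m d) = dot x d *: d.
Proof.
rewrite mulmxA (_ : x *m d^T = (dot x d)%:M) ?mul_scalar_mx//.
by apply/rowP => i; rewrite !mxE !ord1 eqxx mulr1n; apply: eq_bigr => j _; rewrite mxE.
Qed.

Lemma qf_outer d x : qf (d^T *m d) x = dot x d ^+ 2.
Proof. by rewrite qfE mul_outer dotZl (dotC d) expr2. Qed.

Lemma qfZr a X x : qf X (a *: x) = a ^+ 2 * qf X x.
Proof. by rewrite !qfE -scalemxAl dotZl dotZr mulrA expr2. Qed.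

Lemma qfNr X x : qf X (- x) = qf X x.
Proof. by rewrite -scaleN1r qfZr sqrrN expr1n mul1r. Qed.

Lemma qf0r X : qf X 0 = 0.
Proof. by rewrite -(scale0r 0) qfZr expr0n mul0r. Qed.

Lemma dot_mul_sym X x y : X^T = X -> dot (x *m X) y = dot (y *m X) x.
Proof.
move=> sX; have dE u v : dot u v = (u *m v^T) ord0 ord0.
  by rewrite mxE; apply: eq_bigr => i _; rewrite [_^T _ _]mxE.
have E : y *m X *m x^T = (x *m X *m y^T)^T by rewrite !trmx_mul trmxK sX mulmxA.
by rewrite !dE E [RHS]mxE.
Qed.

Lemma qfDr X x y : X^T = X -> qf X (x + y) = qf X x + 2 * dot (x *m X) y + qf X y.
Proof.
move=> sX; rewrite !qfE mulmxDl !dotDl !dotDr (dot_mul_sym y x sX); ring.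
Qed.

Lemma sumnorm_ge0 X : 0 <= sumnorm X.
Proof. by apply: sumr_ge0 => i _; apply: sumr_ge0. Qed.

Lemma enorm_mulmx X x : enorm (x *m X) <= sumnorm X * enorm x.
Proof.
rewrite (le_trans (enorm_le_sum _)) // /sumnorm exchange_big mulr_suml; apply: ler_sum => j _.
rewrite mxE (le_trans (ler_norm_sum _ _ _)) // mulr_suml; apply: ler_sum => i _.
by rewrite normrM mulrC ler_wpM2l // coord_le_enorm.
Qed.

Lemma norm_qf_le X x : `|qf X x| <= sumnorm X * enorm x ^+ 2.
Proof.
rewrite qfE (le_trans (norm_dot_le _ _)) // expr2 mulrA ler_wpM2r ?enorm_ge0//.
exact: enorm_mulmx.
Qed.

Lemma mdotC X Y : mdot X Y = mdot Y X.
Proof. by apply: eq_bigr => i _; apply: eq_bigr => j _; rewrite mulrC. Qed.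

Lemma mdotDr X Y Z : mdot X (Y + Z) = mdot X Y + mdot X Z.
Proof.
rewrite -big_split; apply: eq_bigr => i _; rewrite -big_split.
by apply: eq_bigr => j _; rewrite mxE mulrDr.
Qed.

Lemma mdotZr a X Y : mdot X (a *: Y) = a * mdot X Y.
Proof.
rewrite mulr_sumr; apply: eq_bigr => i _; rewrite mulr_sumr.
by apply: eq_bigr => j _; rewrite mxE; ring.
Qed.

Lemma mdotNr X Y : mdot X (- Y) = - mdot X Y.
Proof. by rewrite -scaleN1r mdotZr mulN1r. Qed.

Lemma mdotBr X Y Z : mdot X (Y - Z) = mdot X Y - mdot X Z.
Proof. by rewrite mdotDr mdotNr. Qed.

Lemma mdot0r X : mdot X 0 = 0.
Proof. by rewrite -(scale0r 0) mdotZr mul0r. Qed.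

Lemma mdot_outer X d : mdot X (d^T *m d) = qf X d.
Proof.
rewrite qfE /mdot exchange_big; apply: eq_bigr => j _; rewrite mxE mulr_suml.
by apply: eq_bigr => i _; rewrite mxE big_ord1 mxE; ring.
Qed.

Lemma mdotxx_ge0 X : 0 <= mdot X X.
Proof. by apply: sumr_ge0 => i _; apply: sumr_ge0 => j _; rewrite -expr2 sqr_ge0. Qed.

Lemma mdotxx_eq0 X : mdot X X = 0 -> X = 0.
Proof.
move=> h; apply/matrixP => i j; rewrite mxE.
have /(_ i isT) hi : forall i, true -> \sum_j X i j * X i j = 0.
  by apply: psumr_eq0P h => k _; apply: sumr_ge0 => l _; rewrite -expr2 sqr_ge0.
have /(_ j isT)/eqP : forall j, true -> X i j * X i j = 0.
  by apply: psumr_eq0P hi => k _; rewrite -expr2 sqr_ge0.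
by rewrite mulf_eq0 orbb => /eqP.
Qed.

Lemma norm_mdot_le A X b : (forall i j, `|X i j| <= b) -> `|mdot A X| <= sumnorm A * b.
Proof.
move=> hX; rewrite (le_trans (ler_norm_sum _ _ _)) // mulr_suml; apply: ler_sum => i _.
rewrite (le_trans (ler_norm_sum _ _ _)) // mulr_suml; apply: ler_sum => j _.
by rewrite normrM ler_wpM2l.
Qed.

Lemma trmx_outer d : (d^T *m d)^T = d^T *m d.
Proof. by rewrite trmx_mul trmxK. Qed.

Lemma psd_outer d : psd (d^T *m d).
Proof. by move=> x; rewrite -/(qf _ _) qf_outer sqr_ge0. Qed.

Lemma psd_scalar c : 0 <= c -> psd (c%:M : 'M[R]_n).
Proof. by move=> c0 x; rewrite -/(qf _ _) qf_scalar mulr_ge0 ?sqr_ge0. Qed.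

End Vectors.

(** * The Euclidean norm and the topology of row vectors *)

Section Topology.
Context {R : realType} {n : nat}.
Implicit Types (x y z c : 'rV[R]_n) (f : 'rV[R]_n -> R) (r e d : R).

Lemma mxnorm_le_enorm x : `|x| <= enorm x.
Proof.
rewrite [leLHS]/Num.norm /= mx_normrE; apply/bigmax_leP; split; first exact: enorm_ge0.
by move=> [i j] _ /=; rewrite ord1 coord_le_enorm.
Qed.

Lemma coord_le_mxnorm x i : `|x ord0 i| <= `|x|.
Proof.
rewrite [leRHS]/Num.norm /= mx_normrE; apply/bigmax_geP; right => /=.
by exists (ord0, i).
Qed.

Lemma enorm_le_mxnorm x : enorm x <= n%:R * `|x|.
Proof.
rewrite (le_trans (enorm_le_sum _)) // (le_trans (ler_sum _ (fun i _ => coord_le_mxnorm x i))) //.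
by rewrite sumr_const card_ord mulr_natl.
Qed.

(** The topology of row vectors comes from the maximum norm. Through this bridge every
    neighbourhood, in particular in the local extrema of the viscosity definitions, becomes a
    Euclidean ball. *)
Lemma near_enorm (P : set 'rV[R]_n) x :
  (\forall y \near x, P y) <->
  exists2 d, 0 < d & forall xi, enorm xi < d -> P (x + xi).
Proof.
split.
  move=> /nbhs_ballP[d /= d0 dP]; exists d => // xi xid; apply: dP.
  rewrite mx_norm_ball /ball_ /= opprD addNKr normrN.
  exact: le_lt_trans (mxnorm_le_enorm _) xid.
(* [n.+1] instead of [n] keeps the radius positive in dimension zero as well. *)
move=> [d d0 dP]; apply/nbhs_ballP; exists (d / n.+1%:R) => /=; first by rewrite divr_gt0.
move=> y; rewrite mx_norm_ball /ball_ /= => xy; rewrite -(subrK x y) addrC; apply: dP.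
rewrite (le_lt_trans (enorm_le_mxnorm _)) // distrC.
move: xy; rewrite ltr_pdivlMr // => xy; rewrite (le_lt_trans _ xy) // mulrC ler_wpM2l //.
by rewrite ler_nat.
Qed.

Lemma continuous_atP f x :
  {for x, continuous f} <->
  forall e, 0 < e -> exists2 d, 0 < d & forall xi, enorm xi < d -> `|f (x + xi) - f x| < e.
Proof.
split.
  move=> /cvgrPdist_lt fx e e0; have /near_enorm [d d0 dP] := fx _ e0.
  by exists d => // xi /dP; rewrite distrC.
move=> h; apply/(@cvgrPdist_lt _ _ _ (nbhs x) (nbhs_filter x)) => e e0; apply/near_enorm.
by have [d d0 dP] := h _ e0; exists d => // xi /dP; rewrite distrC.
Qed.

Lemma eball_open c r : open (eball c r).
Proof.
move=> x cx; apply/near_enorm; exists (r - enorm (x - c)); first by rewrite subr_gt0.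
move=> xi xir; rewrite /eball /= addrAC (le_lt_trans (enormD _ _)) // -ltrBrDl //.
Qed.

Lemma enorm_continuous : continuous (@enorm R n).
Proof.
move=> x; apply/continuous_atP => e e0; exists e => // xi xie.
rewrite ltr_distl ltrBlDr.
rewrite (le_lt_trans (enormD _ _)) ?ltrD2l// andbT.
rewrite (@le_lt_trans _ _ (enorm (x + xi) + enorm xi)) ?ltrD2l//.
by rewrite -{1}(addrK xi x) enormB.
Qed.

Definition cball c r : set 'rV[R]_n := [set x | enorm (x - c) <= r].

Lemma cball_compact c r : compact (cball c r).
Proof.
apply: bounded_closed_compact.
  exists (enorm c + r); split; first by rewrite num_real.
  move=> M hM x /= xr; rewrite (le_trans (mxnorm_le_enorm _)) // ltW // (le_lt_trans _ hM) //.
  by rewrite -{1}(subrK c x) (le_trans (enormD _ _)) // addrC lerD2l.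
have -> : cball c r = (fun x => enorm (x - c)) @^-1` [set t | t <= r] by [].
apply: preimage_closed; last exact: closed_le.
move=> x _; apply: continuous_comp; last exact: enorm_continuous.
by apply: continuousB => //; exact: cst_continuous.
Qed.

Lemma cball_max c r f : 0 <= r -> (forall x, cball c r x -> {for x, continuous f}) ->
  exists2 x, cball c r x & forall y, cball c r y -> f y <= f x.
Proof.
move=> r0 cf.
have [||x xc xm] := @compact_EVT_max _ R f (cball c r) _ (@cball_compact c r).
- by exists c; rewrite /cball /= subrr enorm0.
- by apply: continuous_in_subspaceT => x /[!inE] /cf.
by exists x => [|y yc]; [rewrite inE in xc | apply: xm; rewrite inE].
Qed.

Lemma cball_segment_max c r (a b : R) (f : 'rV[R]_n * R -> R) : 0 <= r -> a <= b ->
  (forall w, cball c r w.1 -> a <= w.2 <= b -> {for w, continuous f}) ->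
  exists w, [/\ cball c r w.1, a <= w.2 <= b &
    forall y t, cball c r y -> a <= t <= b -> f (y, t) <= f w].
Proof.
move=> r0 ab cf.
have [||w /[!inE] -[/= z1 z2] zm] :=
  @compact_EVT_max _ R f (cball c r `*` `[a, b]) _
    (compact_setX (@cball_compact c r) (@segment_compact _ a b)).
- by exists (c, a); split => /=; [rewrite /cball /= subrr enorm0 | rewrite in_itv /= lexx].
- apply: continuous_in_subspaceT => w /[!inE] -[/= z1]; rewrite in_itv /= => z2; exact: cf.
exists w; split => //.
move=> y t yc tb; apply: zm; rewrite inE; split => //=; by rewrite in_itv.
Qed.

End Topology.

(** * Second-order expansions at a point *)

Section Jets.
Context {R : realType} {n : nat}.
Implicit Types (x y z g xi : 'rV[R]_n) (X Y S : 'M[R]_n) (f : 'rV[R]_n -> R) (a c e d t : R).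

(** A Peano expansion at a single point. Asking nothing at other points makes it stable under sums,
    multiples and translations by mere estimates of remainders, and it is all that a touching
    argument consumes. *)
Definition jet2 f x g X : Prop := forall e, 0 < e -> exists2 d, 0 < d &
  forall xi, enorm xi < d ->
    `|f (x + xi) - f x - dot g xi - 1/2 * qf X xi| <= e * enorm xi ^+ 2.

Lemma jet2D f1 f2 x g1 g2 X1 X2 : jet2 f1 x g1 X1 -> jet2 f2 x g2 X2 ->
  jet2 (fun y => f1 y + f2 y) x (g1 + g2) (X1 + X2).
Proof.
move=> h1 h2 e e0; have e20 : 0 < e / 2 by rewrite divr_gt0.
have [d1 d10 D1] := h1 _ e20; have [d2 d20 D2] := h2 _ e20.
exists (Num.min d1 d2) => [|xi]; first by rewrite lt_min d10.
rewrite lt_min => /andP[/D1 l1 /D2 l2]; rewrite dotDl qfDl.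
rewrite [e](splitr e) mulrDl (le_trans _ (lerD l1 l2)) // (le_trans _ (ler_normD _ _)) //.
by rewrite le_eqVlt; apply/orP; left; apply/eqP; congr (`|_|); ring.
Qed.

Lemma jet2Z a f x g X : jet2 f x g X -> jet2 (fun y => a * f y) x (a *: g) (a *: X).
Proof.
move=> h e e0; have p : 0 < e / (`|a| + 1) by rewrite divr_gt0 // ltr_wpDl.
have [d d0 D] := h _ p; exists d => // xi /D l; rewrite dotZl qfZl.
have -> : a * f (x + xi) - a * f x - a * dot g xi - 1 / 2 * (a * qf X xi) =
  a * (f (x + xi) - f x - dot g xi - 1 / 2 * qf X xi) by ring.
rewrite normrM (le_trans (ler_wpM2l (normr_ge0 a) l)) // mulrA ler_wpM2r ?sqr_ge0//.
rewrite mulrA ler_pdivrMr ?ltr_wpDl// mulrC ler_wpM2l ?(ltW e0)//.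
by rewrite lerDl.
Qed.

Lemma jet2N f x g X : jet2 f x g X -> jet2 (fun y => - f y) x (- g) (- X).
Proof.
move=> /(jet2Z (-1)); rewrite !scaleN1r; congr (jet2 _ _ _ _).
by apply/funext => y; rewrite mulN1r.
Qed.

Lemma jet2B f1 f2 x g1 g2 X1 X2 : jet2 f1 x g1 X1 -> jet2 f2 x g2 X2 ->
  jet2 (fun y => f1 y - f2 y) x (g1 - g2) (X1 - X2).
Proof. by move=> h1 /jet2N; exact: jet2D. Qed.

Lemma jet2_shift f x h g X : jet2 f (x + h) g X -> jet2 (fun y => f (y + h)) x g X.
Proof.
by move=> H e /H [d d0 D]; exists d => // xi /D; rewrite (addrAC x).
Qed.

Lemma jet2_cube f x g X C d : 0 < d -> (forall xi, enorm xi < d ->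
  `|f (x + xi) - f x - dot g xi - 1/2 * qf X xi| <= C * enorm xi ^+ 3) -> jet2 f x g X.
Proof.
move=> d0 h e e0; exists (Num.min d (e / (`|C| + 1))).
  by rewrite lt_min d0 divr_gt0 // ltr_wpDl.
move=> xi; rewrite lt_min => /andP[/h l1]; rewrite ltr_pdivlMr ?ltr_wpDl// => l2.
rewrite (le_trans l1) // exprS mulrA ler_wpM2r ?sqr_ge0//.
rewrite (le_trans _ (ltW l2)) // mulrC ler_wpM2l ?enorm_ge0//.
by rewrite (le_trans (ler_norm _)) // lerDl.
Qed.

Lemma jet2_continuous f x g X : jet2 f x g X -> {for x, continuous f}.
Proof.
move=> h; apply/continuous_atP => e e0.
have [d d0 D] := h _ ltr01.
set q := enorm g + sumnorm X + 2.
have q0 : 0 < q by rewrite /q ltr_wpDl // addr_ge0 ?enorm_ge0 ?sumnorm_ge0.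
exists (Num.min (Num.min d 1) (e / q)); first by rewrite !lt_min d0 ltr01 divr_gt0.
move=> xi; rewrite !lt_min => /andP[/andP[/D l1 l2]]; rewrite ltr_pdivlMr // => l3.
rewrite (le_lt_trans _ l3) //.
have := enorm_ge0 xi; have := norm_dot_le g xi; have := norm_qf_le X xi.
have := sumnorm_ge0 X; have := enorm_ge0 g.
move: l1 l2; rewrite /q !ler_norml; set a := enorm g; set b := sumnorm X.
set v := enorm xi => l1 l2 a0 b0 /andP[h1 h2] /andP[h3 h4] v0.
have v1 : v ^+ 2 <= v by rewrite expr2 ler_piMr // ltW.
have v2 : b * v ^+ 2 <= b * v by rewrite ler_wpM2l.
by move: l1 => /andP[l1 l1']; lra.
Qed.

(** The expansions along [t *: xi] and [- (t *: xi)] are added, which cancels the gradient; dividing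
    by [t ^+ 2] leaves [qf X xi] up to an arbitrarily small error. *)
Lemma jet2_max f x g X d : 0 < d -> jet2 f x g X ->
  (forall xi, enorm xi < d -> f (x + xi) <= f x) -> forall xi, qf X xi <= 0.
Proof.
move=> d0 h hm xi; apply/ler_addgt0Pr => e e0; rewrite add0r.
have p : 0 < e / (2 * (enorm xi ^+ 2 + 1)).
  by rewrite divr_gt0 // mulr_gt0 // ltr_wpDl // sqr_ge0.
have [d' d'0 D] := h _ p.
set q := enorm xi + 1; have q0 : 0 < q by rewrite /q ltr_wpDl // enorm_ge0.
pose t := Num.min d d' / (2 * q).
have t0 : 0 < t by rewrite /t divr_gt0 ?mulr_gt0 // lt_min d0.
have tl : t * enorm xi < Num.min d d'.
  rewrite (@lt_le_trans _ _ (t * (2 * q))) // ?ltr_pM2l // /q ?divfK ?gt_eqF ?mulr_gt0 //.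
  by have := enorm_ge0 xi; lra.
move: tl; rewrite lt_min => /andP[t1 t2].
have E1 : enorm (t *: xi) = t * enorm xi by rewrite enormZ gtr0_norm.
have E2 : enorm (- (t *: xi)) = t * enorm xi by rewrite enormN.
have := hm (t *: xi); rewrite E1 => /(_ t1) m1.
have := hm (- (t *: xi)); rewrite E2 => /(_ t1) m2.
have := D (t *: xi); rewrite E1 => /(_ t2); rewrite ler_norml => /andP[l1 _].
have := D (- (t *: xi)); rewrite E2 => /(_ t2); rewrite ler_norml => /andP[l2 _].
move: l1 l2; rewrite dotNr qfNr qfZr; set v := enorm xi; set w := qf X xi => l1 l2.
have H : t ^+ 2 * w <= t ^+ 2 * (e / (2 * (v ^+ 2 + 1)) * (2 * v ^+ 2)).
  by move: l1 l2; rewrite exprMn; nra.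
move: H; rewrite ler_pM2l ?exprn_gt0 // => H; rewrite (le_trans H) //.
rewrite mulrAC ler_pdivrMr ?mulr_gt0 ?ltr_wpDl ?sqr_ge0 //.
rewrite ler_pM2l // ler_pM2l // lerDl //.
Qed.

Lemma jet2_affine c g x : jet2 (fun y => c + dot g y) x g 0.
Proof.
move=> e e0; exists 1 => // xi _; rewrite dotDr qfE mulmx0 dot0l.
suff -> : c + (dot g x + dot g xi) - (c + dot g x) - dot g xi - 1 / 2 * 0 = 0.
  by rewrite normr0 mulr_ge0 ?sqr_ge0 ?(ltW e0).
by rewrite mulr0; ring.
Qed.

Lemma jet2_quad (c : 'rV[R]_n) S x : symmx S ->
  jet2 (fun y => 1/2 * qf S (y - c)) x ((x - c) *m S) S.
Proof.
move=> sS e e0; exists 1 => // xi _; rewrite (addrAC x xi) (qfDr (x - c) xi) //.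
set w := (X in `|X|); suff -> : w = 0.
  by rewrite normr0 mulr_ge0 ?sqr_ge0 ?(ltW e0).
by rewrite /w; field.
Qed.

Lemma symmx_scalar a : symmx (a%:M : 'M[R]_n).
Proof. by rewrite /symmx /= tr_scalar_mx. Qed.

Lemma jet2_sqnorm a (c : 'rV[R]_n) x :
  jet2 (fun y => a * enorm (y - c) ^+ 2) x ((2 * a) *: (x - c)) (2 * a)%:M.
Proof.
have := @jet2_quad c (2 * a)%:M x (symmx_scalar _).
rewrite mul_mx_scalar; congr (jet2 _ _ _ _); apply/funext => y.
by rewrite qf_scalar; field.
Qed.

Lemma jet2_dir f x g X (e : 'rV[R]_n) : jet2 f x g X ->
  forall q, 0 < q -> exists2 d, 0 < d & forall t, `|t| < d ->
    `|f (x + t *: e) - f x - t * dot g e| <= q * `|t|.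
Proof.
move=> h q q0; set C := enorm e ^+ 2 + `|qf X e|.
have C0 : 0 <= C by rewrite /C addr_ge0 ?sqr_ge0.
have [d d0 D] := h _ ltr01.
exists (Num.min (d / (enorm e + 1)) (q / (C + 1))).
  by rewrite lt_min !divr_gt0 // ltr_wpDl // enorm_ge0.
move=> t; rewrite lt_min !ltr_pdivlMr ?ltr_wpDl ?enorm_ge0 // => /andP[t1 t2].
have td : enorm (t *: e) < d.
  rewrite enormZ (le_lt_trans _ t1) // ler_wpM2l // lerDl //.
have := D _ td; rewrite dotZr qfZr enormZ exprMn real_normK ?num_real // => l.
have E : f (x + t *: e) - f x - t * dot g e =
  (f (x + t *: e) - f x - t * dot g e - 1/2 * (t ^+ 2 * qf X e)) + 1/2 * (t ^+ 2 * qf X e) by ring.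
rewrite E (le_trans (ler_normD _ _)) // (le_trans (lerD l (lexx _))) //.
have tt : t ^+ 2 = `|t| ^+ 2 by rewrite real_normK ?num_real.
have h1 : `|1 / 2 * (t ^+ 2 * qf X e)| <= `|t| ^+ 2 * `|qf X e|.
  rewrite (normrM (1 / 2)) (normrM (t ^+ 2)) (ger0_norm (sqr_ge0 t)) tt ler_piMl ?mulr_ge0 ?sqr_ge0 //.
  by rewrite ger0_norm //; lra.
rewrite (le_trans (lerD (lexx _) h1)) // tt.
have : `|t| * (`|t| * (C + 1)) <= `|t| * q by rewrite ler_wpM2l // ltW.
have := normr_ge0 t; have := normr_ge0 (qf X e); have := sqr_ge0 (enorm e).
rewrite /C; set s := `|t|; set w := `|qf X e|; set v := enorm e ^+ 2 => v0 w0 s0.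
by have := mulr_ge0 s0 s0; nra.
Qed.

End Jets.

(** * Consequences of uniform ellipticity *)

Section Ellipticity.
Context {R : realType} {n : nat}.
Variables (lam Lam : R) (F : 'M[R]_n -> R).
Hypotheses (lam0 : 0 < lam) (lamLam : lam <= Lam) (Fell : uniformly_elliptic lam Lam F).
Implicit Types (M N X S : 'M[R]_n) (x g : 'rV[R]_n).

Let Lam0 : 0 < Lam. Proof. exact: lt_le_trans lamLam. Qed.

Lemma qf_le_opnorm N x : enorm x = 1 -> qf N x <= opnorm N.
Proof.
move=> x1; rewrite qfE (le_trans (dot_le _ _)) // x1 mulr1.
apply: ub_le_sup; last by exists x.
by exists (sumnorm N) => _ [y /= y1 <-]; rewrite (le_trans (enorm_mulmx _ _)) // y1 mulr1.
Qed.

Lemma opnorm_ge0 N : 0 <= opnorm N.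
Proof.
have [[x x1]|h] := pselect (exists x : 'rV[R]_n, enorm x = 1).
  apply: (le_trans (enorm_ge0 (x *m N))); apply: ub_le_sup; last by exists x.
  by exists (sumnorm N) => _ [y /= y1 <-]; rewrite (le_trans (enorm_mulmx _ _)) // y1 mulr1.
(* In dimension zero there is no unit vector, and the supremum of the empty set is 0 by
   convention. *)
rewrite /opnorm (_ : [set _ | x in _] = set0) ?sup0 //.
by apply/seteqP; split => // y [x /= x1 _]; apply: h; exists x.
Qed.

Lemma opnorm_scalar_le (c : R) : 0 <= c -> opnorm (c%:M : 'M[R]_n) <= c.
Proof.
move=> c0; have [[x x1]|h] := pselect (exists x : 'rV[R]_n, enorm x = 1).
  apply: ge_sup; first by exists (enorm (x *m c%:M)); exists x.
  by move=> _ [y /= y1 <-]; rewrite mul_mx_scalar enormZ y1 mulr1 ger0_norm.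
rewrite /opnorm (_ : [set _ | x in _] = set0) ?sup0 //.
by apply/seteqP; split => // y [x /= x1 _]; apply: h; exists x.
Qed.

(** The operator norm of a nonnegative increment is at least its quadratic form in any unit
    direction; one well chosen direction is enough to detect a rank one gain. *)
Lemma ell_lower M N x : symmx M -> symmx N -> psd N -> enorm x = 1 ->
  F M + lam * qf N x <= F (M + N).
Proof.
move=> sM sN pN x1; have [h _] := Fell sM sN pN.
by rewrite -lerBrDl (le_trans _ h) // ler_pM2l // qf_le_opnorm.
Qed.

Lemma ell_mono M N : symmx M -> symmx N -> psd N -> F M <= F (M + N).
Proof.
move=> sM sN pN; have [h _] := Fell sM sN pN.
by rewrite -subr_ge0 (le_trans _ h) // mulr_ge0 ?opnorm_ge0 ?ltW.
Qed.

Lemma ell_scalar M (c : R) : symmx M -> 0 <= c -> F (M + c%:M) <= F M + Lam * c.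
Proof.
move=> sM c0; have [_ h] := Fell sM (symmx_scalar c) (psd_scalar c0).
by rewrite -lerBlDl (le_trans h) // ler_pM2l // opnorm_scalar_le.
Qed.

Lemma symmxD M N : symmx M -> symmx N -> symmx (M + N).
Proof. by rewrite /symmx /= => sM sN; rewrite linearD /= sM sN. Qed.

Lemma symmxZ a M : symmx M -> symmx (a *: M).
Proof. by rewrite /symmx /= => sM; rewrite linearZ /= sM. Qed.

Lemma symmxN M : symmx M -> symmx (- M).
Proof. by rewrite /symmx /= => sM; rewrite linearN /= sM. Qed.

Lemma symmxB M N : symmx M -> symmx N -> symmx (M - N).
Proof. by move=> sM /symmxN; exact: symmxD. Qed.

(** [N] lies below the scalar matrix [sumnorm N], so an increment without sign is dominated by a
    scalar one, to which ellipticity applies. *)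
Lemma ell_lip M N : symmx M -> symmx N -> F (M + N) <= F M + Lam * sumnorm N.
Proof.
move=> sM sN; rewrite (le_trans _ (ell_scalar sM (sumnorm_ge0 N))) //.
have -> : M + (sumnorm N)%:M = M + N + ((sumnorm N)%:M - N).
  by rewrite -addrA (addrC N) subrK.
apply: ell_mono; [exact: symmxD | by apply: symmxB => //; exact: symmx_scalar |].
move=> x; rewrite -/(qf _ _) qfBl qf_scalar subr_ge0.
by rewrite (le_trans (ler_norm _)) ?norm_qf_le.
Qed.

End Ellipticity.

(** * Viscosity inequalities tested with quadratic polynomials *)

Section ViscosityJets.
Context {R : realType} {n : nat}.
Implicit Types (x y v g c : 'rV[R]_n) (S : 'M[R]_n) (f u : 'rV[R]_n -> R).

Lemma is_derive_dir (V : normedModType R) (f : V -> R) (x v : V) (a : R) :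
  (forall q : R, 0 < q -> exists2 d : R, 0 < d & forall t, `|t| < d ->
    `|f (x + t *: v) - f x - t * a| <= q * `|t|) -> is_derive x v f a.
Proof.
move=> h.
have cv : h0^-1 *: ((f \o shift x) (h0 *: v) - f x) @[h0 --> (0:R)^'] --> a.
  apply/cvgrPdist_le => q q0; have [d d0 D] := h q q0.
  near=> t.
  have t0 : t != 0 by near: t; exact: nbhs_dnbhs_neq.
  have td : `|t| < d by near: t; exact: dnbhs0_lt.
  have := D _ td; rewrite /= /shift (addrC x) => l.
  have -> : a - t^-1 *: (f (t *: v + x) - f x) = - t^-1 * (f (t *: v + x) - f x - t * a).
    by rewrite /GRing.scale /=; field.
  rewrite normrM normrN normfV ler_pdivrMl ?normr_gt0 // [leRHS]mulrC; exact: l.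
apply: DeriveDef; first by apply/cvg_ex; exists a.
exact: cvg_lim.
Unshelve. all: by end_near.
Qed.

Lemma jet2_is_derive f x g X v : jet2 f x g X -> is_derive x v f (dot g v).
Proof. by move=> /jet2_dir h; apply: is_derive_dir; exact: h. Qed.

(** The only test functions used. An additive constant does not change where [u] minus a test
    function is extremal, so the linear part is not centred at [c]. *)
Definition quadt c g S y : R := dot g y + 1/2 * qf S (y - c).

Lemma quadt_jet2 c g S x : symmx S -> jet2 (quadt c g S) x (g + (x - c) *m S) S.
Proof.
move=> sS; have := jet2D (jet2_affine 0 g x) (jet2_quad c x sS); rewrite add0r.
by congr (jet2 _ _ _ _); apply/funext => y; rewrite add0r.
Qed.

Lemma partial_quadt c g S i : symmx S ->
  partial i (quadt c g S) = fun x => dot (g + (x - c) *m S) (ebasis i).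
Proof.
move=> sS; apply/funext => x.
by have /(_ (ebasis i)) [_ <-] := fun v => jet2_is_derive v (quadt_jet2 c g x sS).
Qed.

Lemma partial_quadt_jet2 c g S i x : symmx S ->
  jet2 (partial i (quadt c g S)) x (ebasis i *m S) 0.
Proof.
move=> sS; rewrite partial_quadt //.
have := jet2_affine (dot g (ebasis i) - dot (ebasis i *m S) c) (ebasis i *m S) x.
congr (jet2 _ _ _ _); apply/funext => y.
by rewrite dotDl (dot_mul_sym (y - c)) // dotBr; ring.
Qed.

Lemma partial2_quadt c g S i j : symmx S ->
  partial j (partial i (quadt c g S)) = fun=> S i j.
Proof.
move=> sS; apply/funext => x.
have [_] := jet2_is_derive (ebasis j) (partial_quadt_jet2 c g i x sS).
by rewrite dot_ebasis -rowE mxE.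
Qed.

Lemma quadt_C2 Omega c g S : symmx S -> C2_on Omega (quadt c g S).
Proof.
move=> sS; split; first by apply: continuous_subspaceT => x; exact: jet2_continuous (quadt_jet2 _ _ _ sS).
split=> [i|i j]; split=> [x _|].
- by have [] := jet2_is_derive (ebasis i) (quadt_jet2 c g x sS).
- by apply: continuous_subspaceT => x; exact: jet2_continuous (partial_quadt_jet2 _ _ _ _ sS).
- by have [] := jet2_is_derive (ebasis j) (partial_quadt_jet2 c g i x sS).
- rewrite partial2_quadt //; apply: continuous_subspaceT => x; exact: cst_continuous.
Qed.

Lemma hessian_quadt c g S x : symmx S -> hessian (quadt c g S) x = S.
Proof. by move=> sS; apply/matrixP => i j; rewrite mxE partial2_quadt. Qed.

Section Jets_of_solutions.
Variables (lam Lam : R) (F : 'M[R]_n -> R).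
Hypotheses (lam0 : 0 < lam) (lamLam : lam <= Lam) (Fell : uniformly_elliptic lam Lam F).

(** The quadratic polynomial lies below [u] only up to [e * enorm xi ^+ 2]. Lowering its Hessian by
    [2 * e'] turns this into a true local minimum, and by ellipticity the lowering costs at most
    [Lam * (2 * e')], which is arbitrarily small. *)
Lemma supersol_jet (Omega : set 'rV[R]_n) u x g S : viscosity_supersolution F Omega u ->
  Omega x -> symmx S ->
  (forall e, 0 < e -> exists2 d : R, 0 < d & forall xi, enorm xi < d ->
    u x + dot g xi + 1/2 * qf S xi - e * enorm xi ^+ 2 <= u (x + xi)) -> F S <= 0.
Proof.
move=> [_ hu] Ox sS h; apply/ler_addgt0Pr => e e0; rewrite add0r.
pose e' := e / (2 * Lam).
have L0 : 0 < Lam by exact: lt_le_trans lamLam.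
have e'0 : 0 < e' by rewrite /e' divr_gt0 ?mulr_gt0.
have [d d0 D] := h _ e'0.
have sS' : symmx (S - (2 * e')%:M) by apply: symmxB => //; exact: symmx_scalar.
have := hu (quadt x g (S - (2 * e')%:M)) x (quadt_C2 _ _ _ sS') Ox.
rewrite hessian_quadt // => hF.
have : F (S - (2 * e')%:M) <= 0.
  apply: hF; apply/near_enorm; exists d => // xi /D l.
  rewrite /quadt subrr qf0r (addrC x xi) addrK dotDr qfBl qf_scalar (addrC xi x).
  by move: l; lra.
have e2 : 0 <= 2 * e' by rewrite mulr_ge0 // ltW.
have := ell_scalar lam0 lamLam Fell sS' e2.
rewrite subrK => h1 h2; rewrite (le_trans h1) //.
have -> : e = Lam * (2 * e') by rewrite /e'; field; rewrite gt_eqF.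
by rewrite gerDr.
Qed.

Lemma subsol_jet (Omega : set 'rV[R]_n) u x g S : viscosity_subsolution F Omega u ->
  Omega x -> symmx S ->
  (forall e, 0 < e -> exists2 d : R, 0 < d & forall xi, enorm xi < d ->
    u (x + xi) <= u x + dot g xi + 1/2 * qf S xi + e * enorm xi ^+ 2) -> 0 <= F S.
Proof.
move=> [_ hu] Ox sS h; rewrite -oppr_le0; apply/ler_addgt0Pr => e e0; rewrite add0r.
pose e' := e / (2 * Lam).
have L0 : 0 < Lam by exact: lt_le_trans lamLam.
have e'0 : 0 < e' by rewrite /e' divr_gt0 ?mulr_gt0.
have [d d0 D] := h _ e'0.
have sS' : symmx (S + (2 * e')%:M) by apply: symmxD => //; exact: symmx_scalar.
have := hu (quadt x g (S + (2 * e')%:M)) x (quadt_C2 _ _ _ sS') Ox.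
rewrite hessian_quadt // => hF.
have : 0 <= F (S + (2 * e')%:M).
  apply: hF; apply/near_enorm; exists d => // xi /D l.
  rewrite /quadt subrr qf0r (addrC x xi) addrK dotDr qfDl qf_scalar (addrC xi x).
  by move: l; lra.
have e2 : 0 <= 2 * e' by rewrite mulr_ge0 // ltW.
have := ell_scalar lam0 lamLam Fell sS e2.
have -> : e = Lam * (2 * e') by rewrite /e'; field; rewrite gt_eqF.
by move=> h1 h2; lra.
Qed.
End Jets_of_solutions.

End ViscosityJets.

(** * Touching a supersolution by an average plus a square *)

Section Touching.
Context {R : realType} {n : nat}.
Variables (lam Lam : R) (F : 'M[R]_n -> R).
Hypotheses (lam0 : 0 < lam) (lamLam : lam <= Lam) (Fell : uniformly_elliptic lam Lam F).
Hypothesis (Fqc : quasiconcave F).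
Implicit Types (u f : 'rV[R]_n -> R) (x p xi : 'rV[R]_n) (X : 'M[R]_n).

(** To second order the square of an increment is [dot p xi ^+ 2]: it has no gradient but a
    nonnegative rank one Hessian, the source of the gain in both maximum arguments. *)
Lemma jet2_sqr_lower f x p X : jet2 f x p X -> forall q, 0 < q ->
  exists2 d : R, 0 < d & forall xi, enorm xi < d ->
    dot p xi ^+ 2 - q * enorm xi ^+ 2 <= (f (x + xi) - f x) ^+ 2.
Proof.
move=> h q q0; have [d d0 D] := h _ ltr01.
set C := 1 + sumnorm X; have C0 : 0 < C by rewrite /C ltr_wpDr ?sumnorm_ge0.
set k := 2 * C * enorm p + 1.
have k0 : 0 < k by rewrite /k ltr_wpDl // !mulr_ge0 ?enorm_ge0 // ltW.
exists (Num.min d (q / k)) => [|xi]; first by rewrite lt_min d0 divr_gt0.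
rewrite lt_min => /andP[/D]; rewrite ler_norml => /andP[l1 l2].
rewrite ltr_pdivlMr // => l3.
have := norm_dot_le p xi; have := norm_qf_le X xi; rewrite !ler_norml => /andP[a1 a2] /andP[b1 b2].
set w := f (x + xi) - f x in l1 l2 *; set y := dot p xi in l1 l2 b1 b2 *.
have v0 := enorm_ge0 xi; have p0 := enorm_ge0 p.
set v := enorm xi in l1 l2 l3 a1 a2 b1 b2 v0 *.
have w1 : w - y <= C * v ^+ 2 by rewrite /C; have := mulr_ge0 (sumnorm_ge0 X) (sqr_ge0 v); nra.
have w2 : - (C * v ^+ 2) <= w - y by rewrite /C; have := mulr_ge0 (sumnorm_ge0 X) (sqr_ge0 v); nra.
have l4 : v ^+ 2 * (v * k) <= v ^+ 2 * q by rewrite ler_wpM2l ?sqr_ge0 // ltW.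
have l5 : `|y * (w - y)| <= (enorm p * v) * (C * v ^+ 2).
  rewrite normrM ler_pM // ?ler_norml ?w2 ?w1 //; first by rewrite b1 b2.
move: l5; rewrite ler_norml => /andP[l5 _].
have l6 : 0 <= v ^+ 3 by rewrite exprn_ge0.
have E : w ^+ 2 = y ^+ 2 + 2 * (y * (w - y)) + (w - y) ^+ 2 by ring.
have E4 : v ^+ 2 * (v * k) = 2 * ((enorm p * v) * (C * v ^+ 2)) + v ^+ 3 by rewrite /k; ring.
by have := sqr_ge0 (w - y); move: l4; rewrite E E4; lra.
Qed.

(* Quasiconcavity bounds F from below at the barycentre of X1, X2, and the rank one
   term b (g1 - g2)^T (g1 - g2) is the gain played against the error e. *)
Lemma touch u x U1 U2 g1 g2 X1 X2 (c1 c2 b e d : R) p :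
  viscosity_supersolution F (eball 0 1) u -> eball 0 1 x ->
  jet2 U1 x g1 X1 -> jet2 U2 x g2 X2 -> symmx X1 -> symmx X2 -> 0 <= F X1 -> 0 <= F X2 ->
  0 <= c1 -> 0 <= c2 -> 0 < c1 + c2 -> 0 <= b -> 0 <= e -> 0 < d ->
  (forall xi, enorm xi < d ->
    c1 * (U1 (x + xi) - U1 x) + c2 * (U2 (x + xi) - U2 x) +
    b * ((U1 (x + xi) - U2 (x + xi)) - (U1 x - U2 x)) ^+ 2 - dot p xi - e * enorm xi ^+ 2
    <= (c1 + c2) * (u (x + xi) - u x)) ->
  lam * b * enorm (g1 - g2) ^+ 2 <= Lam * e.
Proof.
move=> hu Ox j1 j2 s1 s2 F1 F2 c10 c20 al0 b0 e0 d0 H.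
set al := c1 + c2 in al0 H *.
have L0 : 0 < Lam by exact: lt_le_trans lamLam.
have alN : al != 0 by rewrite gt_eqF.
set D := (g1 - g2)^T *m (g1 - g2).
have sD : symmx D by exact: trmx_outer.
pose Y := (c1 / al) *: X1 + (1 - c1 / al) *: X2.
have sY : symmx Y by apply: symmxD; exact: symmxZ.
pose N := (2 * b / al) *: D.
have sN : symmx N by exact: symmxZ.
have bal : 0 <= 2 * b / al by rewrite divr_ge0 ?mulr_ge0 // ltW.
have eal : 0 <= 2 * e / al by rewrite divr_ge0 ?mulr_ge0 // ltW.
(* The Hessian at [x] of the left side of the assumed inequality, divided by [c1 + c2]: an average
   of [X1] and [X2], the rank one gain, and the error. *)
pose S := Y + N - (2 * e / al)%:M.
have sS : symmx S by apply: symmxB; [exact: symmxD | exact: symmx_scalar].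
have FS : F S <= 0.
  apply: (supersol_jet lam0 lamLam Fell (g := al^-1 *: (c1 *: g1 + c2 *: g2 - p)) hu Ox sS).
  move=> eta eta0.
  (* The three expansions enter with weights [c1], [c2] and [b]; with this accuracy their errors add
     up to [eta * al * enorm xi ^+ 2]. *)
  have q0 : 0 < eta * al / (al + b) by rewrite divr_gt0 ?mulr_gt0 // ltr_wpDr.
  have [d1 d10 D1] := j1 _ q0; have [d2 d20 D2] := j2 _ q0.
  have [d3 d30 D3] := jet2_sqr_lower (jet2B j1 j2) q0.
  exists (Num.min (Num.min d d1) (Num.min d2 d3)) => [|xi]; first by rewrite !lt_min d0 d10 d20.
  rewrite !lt_min => /andP[/andP[/H h /D1 l1] /andP[/D2 l2 /D3 l3]].
  have {}l1 : dot g1 xi + 1/2 * qf X1 xi - eta * al / (al + b) * enorm xi ^+ 2 <= U1 (x + xi) - U1 x.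
    by move: l1; rewrite ler_norml => /andP[l1 _]; move: l1; lra.
  have {}l2 : dot g2 xi + 1/2 * qf X2 xi - eta * al / (al + b) * enorm xi ^+ 2 <= U2 (x + xi) - U2 x.
    by move: l2; rewrite ler_norml => /andP[l2 _]; move: l2; lra.
  have m1 := ler_wpM2l c10 l1; have m2 := ler_wpM2l c20 l2; have m3 := ler_wpM2l b0 l3.
  suff : al * (u x + dot (al^-1 *: (c1 *: g1 + c2 *: g2 - p)) xi + 1 / 2 * qf S xi -
     eta * enorm xi ^+ 2 - u (x + xi)) <= 0 by rewrite pmulr_rle0 // subr_le0.
  rewrite /S /N /Y /D !qfBl !qfDl !qfZl qf_scalar qf_outer (dotC xi) dotZl !dotBl dotDl !dotZl.
  move: m3; rewrite dotBl => m3.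
  set v := enorm xi ^+ 2 in m1 m2 m3 h *.
  have E : eta * al * v = (c1 + c2 + b) * (eta * al / (al + b) * v).
    by rewrite /al; field; rewrite gt_eqF // -/al ltr_wpDr.
  set Q := eta * al / (al + b) * v in m1 m2 m3 E.
  rewrite -[X in X <= 0](_ : al * (u x - u (x + xi)) + (c1 * dot g1 xi + c2 * dot g2 xi - dot p xi)
     + 1/2 * (c1 * qf X1 xi + c2 * qf X2 xi) + b * (dot g1 xi - dot g2 xi) ^+ 2 - e * v - eta * al * v = _).
    by rewrite E; move: m1 m2 m3 h; lra.
  by rewrite /al; field.
have [->|g0] := eqVneq g1 g2; first by rewrite subrr enorm0 expr0n mulr0 mulr_ge0 // ltW.
have dn : 0 < enorm (g1 - g2) by rewrite enorm_gt0 subr_eq0.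
(* In this direction the rank one matrix attains its full size [enorm (g1 - g2) ^+ 2]. *)
pose w := (enorm (g1 - g2))^-1 *: (g1 - g2).
have w1 : enorm w = 1 by rewrite enormZ ger0_norm ?invr_ge0 ?enorm_ge0 // mulVf // gt_eqF.
have c1al : 0 <= c1 / al <= 1.
  by rewrite divr_ge0 ?(ltW al0) // ler_pdivrMr // mul1r /al lerDl.
have FY : 0 <= F Y by apply: le_trans (Fqc s1 s2 c1al); rewrite le_min F1 F2.
have pN : psd N by move=> y; rewrite -/(qf _ _) qfZl mulr_ge0 // qf_outer sqr_ge0.
have := ell_lower lam0 Fell sY sN pN w1.
have -> : Y + N = S + (2 * e / al)%:M by rewrite subrK.
have := ell_scalar lam0 lamLam Fell sS eal.
have -> : qf N w = 2 * b / al * enorm (g1 - g2) ^+ 2.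
  rewrite qfZl qf_outer dotZl -enorm_sqr; congr (_ * _); rewrite expr2 mulKf ?gt_eqF //.
move=> h1 h2.
have : lam * (2 * b / al * enorm (g1 - g2) ^+ 2) <= Lam * (2 * e / al) by lra.
rewrite (_ : lam * _ = (2 / al) * (lam * b * enorm (g1 - g2) ^+ 2)); last by ring.
rewrite (_ : Lam * _ = (2 / al) * (Lam * e)); last by ring.
by rewrite ler_pM2l // divr_gt0.
Qed.

End Touching.

(** * The barrier and its second-order expansion *)

Section Barrier.
Context {R : realType} {n : nat}.
Implicit Types (z p xi : 'rV[R]_n) (r : R).

(** With [w = r ^+ 2 - enorm z ^+ 2], second derivatives of [w ^- 2] are of order [w ^- 4], the
    square of the barrier. A gain that is quadratic in the barrier therefore absorbs them uniformly
    up to the boundary. *)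
Definition barrier r z : R := ((r ^+ 2 - enorm z ^+ 2) ^+ 2)^-1.

(** An upper bound is what is wanted, because the barrier is always subtracted. With [y] the
    decrease of [w] and [t = y / w], it rests on (1 - t)^-2 <= 1 + 2 t + 4 t^2 for |t| <= 1/10. The
    constant 22 is 4 * 5, from [y ^+ 2 <= 5 * v ^+ 2], plus 2 from the quadratic part of [y]. *)
Lemma barrier_expand r z : 0 < r -> r <= 1 -> enorm z < r ->
  exists p, exists2 d : R, 0 < d & forall xi, enorm xi < d ->
    barrier r (z + xi) <= barrier r z + dot p xi + 22 * barrier r z ^+ 2 * enorm xi ^+ 2.
Proof.
move=> r0 r1 zr; set w := r ^+ 2 - enorm z ^+ 2.
have z0 := enorm_ge0 z.
have w0 : 0 < w by rewrite /w; nra.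
have w1 : w <= 1 by rewrite /w; have := sqr_ge0 (enorm z); nra.
exists ((4 / w ^+ 3) *: z); exists (w / 100) => [|xi xid]; first by rewrite divr_gt0.
have v0 := enorm_ge0 xi; set v := enorm xi in xid v0 *.
rewrite /barrier -/w.
set y := 2 * dot z xi + v ^+ 2.
have -> : r ^+ 2 - enorm (z + xi) ^+ 2 = w - y.
  by rewrite enorm_sqr dotDl !dotDr -!enorm_sqr (dotC xi z) /w /y /v; ring.
have yl : `|y| <= 21/10 * v.
  have := norm_dot_le z xi; rewrite -/v !ler_norml => /andP[h1 h2].
  have h3 : enorm z * v <= v by rewrite ler_piMl // ltW // (lt_le_trans zr).
  have h4 : v ^+ 2 <= 1/10 * v by rewrite expr2 ler_wpM2r //; lra.
  have h5 := sqr_ge0 v.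
  by rewrite /y; apply/andP; split; lra.
have y2 : y ^+ 2 <= 5 * v ^+ 2.
  rewrite -(real_normK (num_real y)); have := normr_ge0 y; nra.
move: yl; rewrite ler_norml => /andP[yl1 yl2].
set t := y / w; have ty : y = t * w by rewrite /t divfK // gt_eqF.
have t1 : t <= 1/10 by rewrite /t ler_pdivrMr //; lra.
have t2 : - (1/10) <= t by rewrite /t ler_pdivlMr //; lra.
have tt : 1 <= (1 - t) ^+ 2 * (1 + 2 * t + 4 * t ^+ 2).
  have : 0 <= t ^+ 2 * (1 - 6 * t + 4 * t ^+ 2) by rewrite mulr_ge0 ?sqr_ge0 //; have := sqr_ge0 t; lra.
  by nra.
have p0 : 0 < (1 - t) ^+ 2 by rewrite exprn_gt0 //; lra.
have H : ((w - y) ^+ 2)^-1 <= (w ^+ 2)^-1 * (1 + 2 * t + 4 * t ^+ 2).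
  have -> : (w - y) ^+ 2 = w ^+ 2 * (1 - t) ^+ 2 by rewrite ty; ring.
  rewrite invfM ler_pM2l ?invr_gt0 ?exprn_gt0 //.
  by rewrite -[leLHS]mul1r ler_pdivrMr // mulrC.
rewrite (le_trans H) // dotZl.
have E1 : (w ^+ 2)^-1 * (1 + 2 * t + 4 * t ^+ 2) =
  (w ^+ 2)^-1 + 4 / w ^+ 3 * dot z xi + 2 / w ^+ 3 * v ^+ 2 + 4 * ((w ^+ 2)^-1) ^+ 2 * y ^+ 2.
  by rewrite /t /y; field; rewrite gt_eqF.
rewrite E1 -!addrA !lerD2l.
have E2 : 2 / w ^+ 3 * v ^+ 2 = 2 * ((w ^+ 2)^-1) ^+ 2 * (w * v ^+ 2) by field; rewrite gt_eqF.
rewrite E2; set q := ((w ^+ 2)^-1) ^+ 2.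
have q0 : 0 <= q by rewrite sqr_ge0.
have h1 : q * (w * v ^+ 2) <= q * v ^+ 2 by rewrite ler_wpM2l // ler_piMl // sqr_ge0.
have h2 : q * y ^+ 2 <= q * (5 * v ^+ 2) by rewrite ler_wpM2l.
by lra.
Qed.

Lemma barrier_continuous r z : enorm z < r -> {for z, continuous (barrier r)}.
Proof.
move=> zr; have c : {for z, continuous (fun y => (r ^+ 2 - enorm y ^+ 2) ^+ 2)}.
  have c2 : {for z, continuous (fun y => r ^+ 2 - enorm y ^+ 2)}.
    apply: continuousB; first exact: cst_continuous.
    by apply: continuousM; exact: enorm_continuous.
  exact: continuousM.
rewrite /prop_for /continuous_at /barrier; apply: (cvgV _ c).
by rewrite expf_neq0 // gt_eqF // subr_gt0 ltrXn2r ?enorm_ge0 ?zr.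
Qed.

End Barrier.

(** * Separation from the convex superlevel set of F *)

Section Separation.
Context {R : realType} {n : nat}.
Variables (lam Lam : R) (F : 'M[R]_n -> R).
Hypotheses (lam0 : 0 < lam) (lamLam : lam <= Lam) (Fell : uniformly_elliptic lam Lam F).
Hypothesis (Fqc : quasiconcave F).
Implicit Types (M N S A : 'M[R]_n).

Lemma dot_mxvec M N : dot (mxvec M) (mxvec N) = mdot M N.
Proof.
rewrite /dot /mdot pair_big /=.
rewrite (reindex (uncurry (@mxvec_index n n))) /=; last exact: curry_mxvec_bij.
by apply: eq_bigr => -[i j] _ /=; rewrite !mxvecE.
Qed.

Lemma sumnorm_le M : sumnorm M <= (n * n)%:R * enorm (mxvec M).
Proof.
rewrite /sumnorm (@le_trans _ _ (\sum_(i < n) \sum_(j < n) enorm (mxvec M))) //.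
  by apply: ler_sum => i _; apply: ler_sum => j _; rewrite -mxvecE coord_le_enorm.
by rewrite !sumr_const card_ord -mulrnA mulr_natl.
Qed.

Lemma mdot_sqrD M N (t : R) :
  mdot (M + t *: N) (M + t *: N) = mdot M M + 2 * t * mdot M N + t ^+ 2 * mdot N N.
Proof.
rewrite mdotDr mdotZr !(mdotC (M + t *: N)) !mdotDr !mdotZr (mdotC N M).
by ring.
Qed.

(** Flattening matrices to rows makes the Frobenius product a [dot], so that compactness of
    Euclidean balls provides nearest points. *)
Let K : set 'rV[R]_(n * n) := [set v | symmx (vec_mx v) /\ 0 <= F (vec_mx v)].

(** [F] is Lipschitz on symmetric matrices by [ell_lip], and symmetry passes to limits entrywise. *)
Lemma superlevel_closed : closed K.
Proof.
move=> v vK.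
have ex (d : R) : 0 < d -> exists2 M, symmx M /\ 0 <= F M & enorm (mxvec M - v) < d.
  move=> d0; have /vK [w [[sw Fw] wd]] : nbhs v [set w | enorm (w - v) < d].
    by apply/near_enorm; exists d => // xi; rewrite /= addrC addKr.
  by exists (vec_mx w) => //; rewrite vec_mxK.
have L0 : 0 < Lam by exact: lt_le_trans lamLam.
have sv : symmx (vec_mx v : 'M[R]_n).
  apply/matrixP => i j; rewrite mxE; apply/eqP; rewrite -subr_eq0 -normr_le0.
  apply/ler_addgt0Pr => e e0; rewrite add0r.
  have e2 : 0 < e / 2 by rewrite divr_gt0.
  have [M [sM _] Md] := ex _ e2.
  have c k l : `|M k l - vec_mx v k l| < e / 2.
    rewrite (le_lt_trans _ Md) //.
    have := coord_le_enorm (mxvec (M - vec_mx v)) (mxvec_index k l).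
    by rewrite mxvecE linearB /= vec_mxK !mxE.
  have Mij : M i j = M j i by rewrite -[in LHS]sM mxE.
  have := c i j; have := c j i; rewrite Mij !ltr_norml => /andP[a1 a2] /andP[b1 b2].
  by rewrite ler_norml; apply/andP; split; lra.
split=> //; rewrite -oppr_le0; apply/ler_addgt0Pr => e e0; rewrite add0r.
set q := Lam * ((n * n)%:R + 1); have q0 : 0 < q by rewrite mulr_gt0 // ltr_wpDl.
have [|M [sM FM] Md] := ex (e / q); first by rewrite divr_gt0.
have sMv : symmx (M - vec_mx v) by exact: symmxB.
have := ell_lip lam0 lamLam Fell sv sMv; rewrite addrC subrK => h.
have : Lam * sumnorm (M - vec_mx v) <= e.
  rewrite (@le_trans _ _ (q * enorm (mxvec M - v))) //.
    rewrite /q -mulrA ler_pM2l // (le_trans (sumnorm_le _)) // linearB /= vec_mxK.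
    by rewrite ler_wpM2r ?enorm_ge0 // lerDl.
  by rewrite mulrC -ler_pdivlMr // ltW.
by lra.
Qed.

(* A is the vector from S to its nearest point in the convex set where F >= 0. *)
Lemma superlevel_separation S M0 : symmx S -> F S < 0 -> symmx M0 -> 0 <= F M0 ->
  exists A : 'M[R]_n, exists c : R, [/\
    (forall M, symmx M -> 0 <= F M -> c <= mdot A M), mdot A S < c &
    (forall N, symmx N -> psd N -> 0 <= mdot A N)].
Proof.
move=> sS FS sM0 FM0.
pose f (v : 'rV[R]_(n * n)) := enorm (v - mxvec S).
have cf : continuous f.
  move=> v; refine (@cvg_comp _ _ _ (fun v => v - mxvec S) enorm (nbhs v) (nbhs (v - mxvec S)) _ _ _).
    by apply: cvgB; [exact: cvg_id | exact: cvg_cst].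
  exact: enorm_continuous.
pose B := cball (mxvec S) (f (mxvec M0)).
have cB : compact (K `&` B).
  by apply: subclosed_compact (@cball_compact _ _ (mxvec S) (f (mxvec M0))) _ => //;
     apply: closedI; [exact: superlevel_closed | apply: compact_closed => //; exact: cball_compact].
have K0 : (K `&` B) (mxvec M0) by split; [rewrite /K /= mxvecK | rewrite /B /cball /=].
have [||p /[!inE] -[[sP FP] pB] pm] := @compact_EVT_min _ R f (K `&` B) _ cB.
- by exists (mxvec M0).
- by apply: continuous_subspaceT.
set P := vec_mx p in sP FP.
have near M : symmx M -> 0 <= F M -> f p <= f (mxvec M).
  move=> sM FM; have [h|/ltW h] := leP (f (mxvec M)) (f (mxvec M0)).
    by apply: pm; rewrite inE; split => //; rewrite /K /= mxvecK.
  by rewrite (le_trans _ h) //; apply: pm; rewrite inE.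
have near2 M : symmx M -> 0 <= F M -> mdot (P - S) (P - S) <= mdot (M - S) (M - S).
  move=> sM FM; rewrite -!dot_mxvec -!enorm_sqr !linearB /= vec_mxK.
  by rewrite ler_pXn2r ?nnegrE ?enorm_ge0 //; exact: near.
have key M : symmx M -> 0 <= F M -> mdot (P - S) P <= mdot (P - S) M.
  move=> sM FM; rewrite -subr_ge0 -mdotBr leNgt; apply/negP => neg.
  set D := M - P in neg; have DD := mdotxx_ge0 D.
  (* A step of this length from the nearest point [P] towards [M] would come closer to [S]: the
     first-order decrease outweighs [t ^+ 2 * mdot D D]. *)
  pose t := Num.min 1 (- mdot (P - S) D / (mdot D D + 1)).
  have t0 : 0 < t by rewrite lt_min ltr01 divr_gt0 ?oppr_gt0 // ltr_wpDl.
  have t1 : t <= 1 by rewrite ge_min lexx.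
  have t2 : t * (mdot D D + 1) <= - mdot (P - S) D.
    by rewrite -ler_pdivlMr ?ltr_wpDl // ge_min lexx orbT.
  have E : t *: M + (1 - t) *: P = P + t *: D.
    by apply/matrixP => i j; rewrite /D !mxE; ring.
  have sQ : symmx (P + t *: D) by rewrite -E; apply: symmxD; exact: symmxZ.
  have FQ : 0 <= F (P + t *: D).
    rewrite -E; apply: le_trans (Fqc sM sP _); first by rewrite le_min FM FP.
    by rewrite (ltW t0).
  have E2 : mdot (P + t *: D - S) (P + t *: D - S) =
      mdot (P - S) (P - S) + 2 * t * mdot (P - S) D + t ^+ 2 * mdot D D.
    by rewrite (addrAC P) mdot_sqrD.
  have := near2 _ sQ FQ; rewrite E2 => h.
  have : 0 <= t * (2 * mdot (P - S) D + t * mdot D D) by lra.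
  by rewrite pmulr_rge0 //; nra.
exists (P - S), (mdot (P - S) P); split; [exact: key | |].
- rewrite -subr_gt0 -mdotBr lt_neqAle mdotxx_ge0 andbT eq_sym; apply/eqP => /mdotxx_eq0 /eqP.
  by rewrite subr_eq0 => /eqP E; move: FP; rewrite E leNgt FS.
(* Monotonicity keeps [P + N] in the superlevel set. Hence [A] is nonnegative on nonnegative
   matrices, and the linear operator A : D^2 is degenerate elliptic. *)
- move=> N sN pN; have := key (P + N); rewrite mdotDr lerDl; apply; first exact: symmxD.
  by rewrite (le_trans FP) //; apply: (ell_mono lam0 Fell).
Qed.

End Separation.

(** * Derivatives on the line and one-sided maxima *)

Section LeftDerivative.
Context {R : realType}.

Lemma is_derive_left_max (phi : R -> R) (t0 L d : R) : 0 < d -> is_derive t0 (1:R) phi L ->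
  (forall t, t0 - d < t <= t0 -> phi t <= phi t0) -> 0 <= L.
Proof.
move=> d0 [dphi <-] hm; rewrite leNgt; apply/negP => L0.
have NL : 0 < - 'D_1 phi t0 by rewrite oppr_gt0.
have /(nbhs_ballP (0 : R))[e /= e0 he] : nbhs (0 : R) [set h | h != 0 ->
    `|'D_1 phi t0 - h^-1 *: (phi (h + t0) - phi t0)| < - 'D_1 phi t0].
  have /cvgrPdist_lt /(_ _ NL) := dphi; rewrite /dnbhs near_withinE => H.
  by apply: (@filterS _ (nbhs (0 : R)) (nbhs_filter _) _ _ _ H) => h hh h0; have := hh h0; rewrite /= scaler1.
pose h := - (Num.min e d / 2).
have m0 : 0 < Num.min e d by rewrite lt_min e0.
have h0 : h < 0 by rewrite /h oppr_lt0 divr_gt0.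
have he' : `|h| < e /\ `|h| < d.
  rewrite ltr0_norm // /h opprK; have : Num.min e d <= e by rewrite ge_min lexx.
  have : Num.min e d <= d by rewrite ge_min lexx orbT.
  by lra.
have := he h; rewrite /ball /= sub0r normrN => /(_ he'.1 (negbT (lt_eqF h0))).
move=> hh.
have := hm (h + t0); rewrite ltr0_norm // in he'.
have /[swap] /[apply] : t0 - d < h + t0 <= t0 by apply/andP; split; lra.
move=> le; move: hh.
have : 0 <= h^-1 *: (phi (h + t0) - phi t0).
  by rewrite /GRing.scale /= mulr_le0 ?subr_le0 // invr_le0 ltW.
by rewrite ltr_norml => q /andP[+ _]; lra.
Qed.

(** Stated for functions written pointwise, so that the derivative of a long explicit expression can
    be assembled by application. *)
Lemma is_derive_add (f g : R -> R) (x a b : R) : is_derive x (1:R) f a -> is_derive x (1:R) g b ->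
  is_derive x (1:R) (fun t => f t + g t) (a + b).
Proof. by move=> fa gb; exact: is_deriveD. Qed.

Lemma is_derive_mul (f g : R -> R) (x a b : R) : is_derive x (1:R) f a -> is_derive x (1:R) g b ->
  is_derive x (1:R) (fun t => f t * g t) (f x * b + g x * a).
Proof. by move=> fa gb; exact: is_deriveM. Qed.

Lemma is_derive_const (c x : R) : is_derive x (1:R) (fun=> c) 0.
Proof. exact: is_derive_cst. Qed.

Lemma is_derive_idR (x : R) : is_derive x (1:R) (fun t => t) 1.
Proof. exact: is_derive_id. Qed.

Lemma is_derive_eqval (f : R -> R) (x a b : R) : is_derive x (1:R) f a -> a = b -> is_derive x (1:R) f b.
Proof. by move=> h <-. Qed.

End LeftDerivative.

(** * Continuity in the point and along rays *)

Section Continuity.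
Context {R : realType} {n : nat}.
Implicit Types (f : 'rV[R]_n -> R) (w : 'rV[R]_n * R).

Lemma visc_continuous u (Omega : set 'rV[R]_n) x :
  open Omega -> {within Omega, continuous u} -> Omega x -> {for x, continuous (u : 'rV[R]_n -> R)}.
Proof. by move=> oO; rewrite continuous_open_subspace // => h Ox; apply: h; rewrite inE. Qed.

Lemma continuous_fst f w : {for w.1, continuous f} -> {for w, continuous (fun w => f w.1)}.
Proof.
move=> h; refine (@cvg_comp _ _ _ fst f (nbhs w) (nbhs w.1) (nbhs (f w.1)) _ h).
exact: cvg_fst.
Qed.

Lemma continuous_ray f w (e : 'rV[R]_n) :
  {for w.1 + w.2 *: e, continuous f} -> {for w, continuous (fun w => f (w.1 + w.2 *: e))}.
Proof.
move=> h; refine (@cvg_comp _ _ _ (fun w : 'rV[R]_n * R => w.1 + w.2 *: e) f (nbhs w) _ _ _ h).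
by apply: cvgD; [exact: cvg_fst | apply: cvgZr_tmp; exact: cvg_snd].
Qed.

End Continuity.

(** * A maximum principle on a cylinder with a barrier *)

Section BarrierMaximum.
Context {R : realType} {n : nat}.
Implicit Types (z xi : 'rV[R]_n) (rho h t : R).

Lemma barrier_ge1 rho z : 0 < rho -> rho <= 1 -> enorm z < rho -> 1 <= barrier rho z.
Proof.
move=> r0 r1 zr; have z0 := enorm_ge0 z; rewrite /barrier.
have w0 : 0 < rho ^+ 2 - enorm z ^+ 2 by nra.
have w1 : rho ^+ 2 - enorm z ^+ 2 <= 1 by have := sqr_ge0 (enorm z); nra.
by rewrite -[1]invr1 lef_pV2 ?posrE ?exprn_gt0 // exprn_ile1 // ltW.
Qed.

(** The common frame of both maximum arguments. The barrier keeps a positive maximum off the lateral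
    boundary, and the sign conditions keep it off the two ends; what remains is an interior maximum,
    excluded by the last hypothesis. *)
Lemma barrier_max (Psi : 'rV[R]_n * R -> R) rho hm C N : 0 < rho -> rho <= 1 -> 0 < hm ->
  0 < C -> 0 < N ->
  (forall w, enorm w.1 < rho -> 0 <= w.2 <= hm -> {for w, continuous Psi}) ->
  (forall z t, enorm z < rho -> 0 <= t <= hm -> Psi (z, t) <= C - N * barrier rho z) ->
  (forall z, enorm z < rho -> Psi (z, 0) <= 0) ->
  (forall z, enorm z < rho -> Psi (z, hm) <= 0) ->
  (forall z t (d : R), enorm z < rho -> 0 < t < hm -> 0 < Psi (z, t) -> 0 < d ->
    (forall xi, enorm xi < d -> Psi (z + xi, t) <= Psi (z, t)) ->
    (forall t', t - d < t' <= t -> Psi (z, t') <= Psi (z, t)) -> False) ->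
  forall z t, enorm z < rho -> 0 <= t <= hm -> Psi (z, t) <= 0.
Proof.
move=> r0 r1 hm0 C0 N0 cP bP P0 Ph Pint z t zr th; rewrite leNgt; apply/negP => pos.
have z0 := enorm_ge0 z.
have wz : 0 < rho ^+ 2 - enorm z ^+ 2 by nra.
(* The first entry keeps the given point [z] in the smaller cylinder; the second gives
   [N / w >= C + N], so that [C - N * barrier] is negative where [rho ^+ 2 - enorm z ^+ 2] equals
   [w]. *)
pose w := Num.min (rho ^+ 2 - enorm z ^+ 2) (N / (C + N)).
have w0 : 0 < w by rewrite lt_min wz divr_gt0 // addr_gt0.
have w1 : w <= rho ^+ 2 - enorm z ^+ 2 by rewrite ge_min lexx.
have w2 : w * (C + N) <= N by rewrite -ler_pdivlMr ?addr_gt0 // ge_min lexx orbT.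
have w3 : w <= 1 by nra.
have zz := sqr_ge0 (enorm z).
pose rr := Num.sqrt (rho ^+ 2 - w).
have rr2 : rr ^+ 2 = rho ^+ 2 - w by rewrite sqr_sqrtr //; lra.
have rr0 : 0 <= rr by exact: sqrtr_ge0.
have rrr : rr < rho by nra.
have zrr : enorm z <= rr by nra.
have [|[zm tm] /= [zc tc hM]] := @cball_segment_max R n 0 rr 0 hm Psi rr0 (ltW hm0).
  move=> v /=; rewrite /cball /= subr0 => v1 v2; apply: cP => //.
  exact: le_lt_trans rrr.
have {}zc : enorm zm <= rr by move: zc; rewrite /cball /= subr0.
have inb y : enorm y <= rr -> cball 0 rr y by rewrite /cball /= subr0.
have zmr : enorm zm < rho by exact: le_lt_trans rrr.
have posm : 0 < Psi (zm, tm) by rewrite (lt_le_trans pos) //; apply: hM => //; exact: inb.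
have zlt : enorm zm < rr.
  rewrite lt_neqAle zc andbT; apply/eqP => E.
  have := bP _ _ zmr tc; rewrite /barrier E rr2 subKr => h.
  have : N * w^-1 <= N * (w ^+ 2)^-1.
    rewrite ler_pM2l // lef_pV2 ?posrE ?exprn_gt0 //; nra.
  have : C <= N * w^-1 by rewrite ler_pdivlMr //; nra.
  by lra.
have t0 : 0 < tm.
  rewrite lt_neqAle eq_sym; move: (tc) => /andP[-> _]; rewrite andbT; apply/eqP => E.
  by have := P0 _ zmr; rewrite -E; lra.
have th' : tm < hm.
  rewrite lt_neqAle; move: (tc) => /andP[_ ->]; rewrite andbT; apply/eqP => E.
  by have := Ph _ zmr; rewrite -E; lra.
apply: (Pint zm tm (Num.min (rr - enorm zm) tm)) => //.
- by rewrite t0.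
- by rewrite lt_min subr_gt0 zlt.
- move=> xi; rewrite lt_min => /andP[h _]; apply: hM => //; apply: inb.
  by rewrite (le_trans (enormD _ _)) //; lra.
- move=> t' /andP[h1 h2]; apply: hM; first exact: inb.
  have : Num.min (rr - enorm zm) tm <= tm by rewrite ge_min lexx orbT.
  by move: tc => /andP[a b]; move=> h3; apply/andP; split; lra.
Qed.

End BarrierMaximum.

(** * Lipschitz estimate by a weighted first difference *)

Section LipschitzStep.
Context {R : realType} {n : nat}.
Variables (lam Lam : R) (F : 'M[R]_n -> R).
Hypotheses (lam0 : 0 < lam) (lamLam : lam <= Lam) (Fell : uniformly_elliptic lam Lam F).
Hypothesis (Fqc : quasiconcave F).
Variables (u : 'rV[R]_n -> R) (kap : R).
Hypotheses (hu : viscosity_supersolution F (eball 0 1) u).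
Hypotheses (uK : forall x, eball 0 1 x -> `|u x| <= kap) (kap0 : 0 < kap).
Variables (U : 'rV[R]_n -> R) (e : 'rV[R]_n) (tau : R).
Hypotheses (tau0 : 0 < tau) (tau1 : tau <= 1/2) (e1 : enorm e = 1).
Hypothesis Uu : forall x, enorm x <= 31/32 -> `|U x - u x| <= tau * kap / 2.
Hypothesis UK : forall x, enorm x <= 31/32 -> `|U x| <= kap.
Hypothesis Ujet : forall x, enorm x <= 31/32 -> exists g X, [/\ symmx X, jet2 U x g X & 0 <= F X].

Implicit Types (z : 'rV[R]_n) (r : R).

(** [t] is chosen for [F t%:M >= 0], which lets the paraboloid [V] be the second function in
    [touch]. The relation [B * kap = 1/8] bounds [B] times the difference of [U] and [V] by 3/16 and
    so keeps the weights [c1] and [c2] nonnegative. *)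
Variables t B N : R.
Hypotheses (tE : t * lam = `|F 0|) (tkap : t <= kap) (Bk : B * kap = 1/8).
Hypothesis NE : N * lam = 64 * 45 * kap * Lam.
Let V (z : 'rV[R]_n) : R := t / 2 * enorm (z - 0) ^+ 2.
Let m (z : 'rV[R]_n) := barrier (15/16) z.
(* At a positive maximum of Psi, optimality in r forces DU(z + r e) - DV(z) to be at least of
   size N m, and the square then gains lam B (r + tau) |DU - DV|^2 over the barrier's error. *)
Let Psi (w : 'rV[R]_n * R) := U (w.1 + w.2 *: e) - u w.1 + (w.2 + tau) * (V w.1 - u w.1)
  + B * (w.2 + tau) * (U (w.1 + w.2 *: e) - V w.1) ^+ 2 - N * m w.1 * (w.2 + tau).

Let t0 : 0 <= t. Proof. by rewrite -(pmulr_lge0 _ lam0) tE. Qed.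

Let B0 : 0 < B. Proof. by rewrite -(pmulr_lgt0 _ kap0) Bk divr_gt0. Qed.

Let Nkap : 64 * 45 * kap <= N.
Proof.
by rewrite -(ler_pM2r lam0) NE ler_wpM2l // mulr_ge0 ?(ltW kap0) // mulr_ge0.
Qed.

Let Vjet z : jet2 V z (t *: z) t%:M.
Proof. by have := jet2_sqnorm (t / 2) 0 z; rewrite subr0 mulrCA divff ?pnatr_eq0 // mulr1. Qed.

Let Vle z : enorm z < 1 -> 0 <= V z <= kap / 2.
Proof.
move=> z1; have z0 := enorm_ge0 z; rewrite /V subr0; have zz : enorm z ^+ 2 <= 1 by nra.
have h0 := sqr_ge0 (enorm z).
have h1 := mulr_ge0 t0 h0; have h2 : t * enorm z ^+ 2 <= t by rewrite ler_piMr.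
have tk := tkap.
by apply/andP; split; lra.
Qed.

Let FV : 0 <= F t%:M.
Proof.
have s0 : symmx (0 : 'M[R]_n) by rewrite /symmx /= trmx0.
have := ell_lower lam0 Fell s0 (symmx_scalar t) (psd_scalar t0) e1.
rewrite qf_scalar e1 expr1n mulr1 add0r mulrC tE => h.
by rewrite (le_trans _ h) // -lerBlDl sub0r -normrN ler_norm.
Qed.

Let in1 z : enorm z < 15/16 -> eball 0 1 z.
Proof. by rewrite /eball /= subr0 => h; lra. Qed.

Let ray z r : enorm z < 15/16 -> 0 <= r <= 1/32 -> enorm (z + r *: e) <= 31/32.
Proof.
move=> h /andP[r0 r1]; rewrite (le_trans (enormD _ _)) // enormZ e1 mulr1 ger0_norm //; lra.
Qed.

Let bounds z r : enorm z < 15/16 -> 0 <= r <= 1/32 ->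
  [/\ - kap <= U (z + r *: e) <= kap, - kap <= u z <= kap, 0 <= V z <= kap / 2,
    1 <= m z & B * (U (z + r *: e) - V z) ^+ 2 <= kap / 2].
Proof.
have k0 := kap0; move=> h hr.
have a1 : - kap <= U (z + r *: e) <= kap by rewrite -ler_norml; apply: UK; exact: ray.
have a2 : - kap <= u z <= kap by rewrite -ler_norml; apply: uK; exact: in1.
have a3 : 0 <= V z <= kap / 2 by apply: Vle; lra.
split=> //; first by apply: barrier_ge1 => //; lra.
rewrite -(ler_pM2r kap0) mulrAC Bk.
set a := U _ in a1 *; set b := V z in a3 *; move: a1 a3 => /andP[p1 p2] /andP[p3 p4].
have : 0 <= (3/2 * kap - (a - b)) * (3/2 * kap + (a - b)) by rewrite mulr_ge0 //; lra.
by have := sqr_ge0 kap; lra.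
Qed.

Lemma lipschitz_psi z r : enorm z < 15/16 -> 0 <= r <= 1/32 -> Psi (z, r) <= 0.
Proof.
have k0 := kap0.
have Nk := Nkap. have ta0 := tau0. have ta1 := tau1.
have N0 : 0 < N by lra.
apply: (@barrier_max R n Psi (15/16) (1/32) (5 * kap) (N * tau)) => //; try lra.
- by rewrite mulr_gt0.
- move=> w w1 w2.
  have [g [X [_ /jet2_continuous cU _]]] := Ujet (ray w1 w2).
  have cu : {for w.1, continuous u}.
    by case: hu => cu _; apply: visc_continuous cu _; [exact: eball_open | exact: in1].
  have cV := jet2_continuous (Vjet w.1).
  have cs : {for w, continuous (fun w : 'rV[R]_n * R => w.2 + tau)}.
    by apply: continuousD; [exact: cvg_snd | exact: cst_continuous].
  have cUV : {for w, continuous (fun w : 'rV[R]_n * R => U (w.1 + w.2 *: e) - V w.1)}.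
    by apply: continuousB; [exact: continuous_ray | exact: continuous_fst].
  have cm : {for w.1, continuous m} by exact: barrier_continuous.
  apply: continuousB; last first.
    apply: continuousM => //; apply: continuousM; first exact: cst_continuous.
    exact: continuous_fst.
  apply: continuousD.
    apply: continuousD.
      by apply: continuousB; [exact: continuous_ray | exact: continuous_fst].
    by apply: continuousM => //; apply: continuousB; exact: continuous_fst.
  apply: continuousM; last exact: continuousM.
  by apply: continuousM => //; exact: cst_continuous.
- move=> y s yr sr; have [/andP[a1 a2] /andP[a3 a4] /andP[a5 a6] a7 a8] := bounds yr sr.
  move: (sr) => /andP[s0 s1]; rewrite /Psi /=.
  set q := B * (_ - _) ^+ 2 in a8.
  have q0 : 0 <= q by rewrite /q mulr_ge0 ?sqr_ge0 ?(ltW B0).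
  rewrite (mulrAC B); rewrite -/q.
  have : N * m y * tau <= N * m y * (s + tau).
    have Nm0 : 0 <= N * m y by apply: mulr_ge0; lra.
    by rewrite ler_wpM2l //; lra.
  have h1 : q * (s + tau) <= q by rewrite ler_piMr //; lra.
  have h2 : (s + tau) * (V y - u y) <= (s + tau) * (3/2 * kap) by rewrite ler_wpM2l //; lra.
  have h3 : (s + tau) * (3/2 * kap) <= 3/2 * kap by rewrite ler_piMl //; lra.
  by rewrite -/(m y); lra.
(* At [r = 0] the penalty is still [N * m y * tau], which exceeds [U - u <= tau * kap / 2] together
   with the other terms, all of which carry the factor [tau]. *)
- move=> y yr; have hr : 0 <= (0:R) <= 1/32 by lra.
  have [/andP[a1 a2] /andP[a3 a4] /andP[a5 a6] a7 a8] := bounds yr hr.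
  have := Uu (ray yr hr); rewrite scale0r addr0 in a1 a2 a8 *; rewrite ler_norml => /andP[_ h].
  rewrite /Psi /= scale0r addr0 add0r.
  set q := B * (_ - _) ^+ 2 in a8.
  rewrite (mulrAC B) -/q.
  have h1 : q * tau <= kap / 2 * tau by rewrite ler_wpM2r // ltW.
  have h2 : tau * (V y - u y) <= tau * (3/2 * kap) by rewrite ler_wpM2l ?(ltW tau0) //; lra.
  have h3 : N * 1 * tau <= N * m y * tau by rewrite ler_wpM2r ?(ltW tau0) // ler_wpM2l // ltW.
  have h4 : 64 * 45 * kap * tau <= N * tau by rewrite ler_wpM2r // ltW.
  have h5 : 0 <= kap * tau by rewrite mulr_ge0 // ltW.
  by lra.
(* At the other end [r + tau >= 1/32], and the size of [N] makes the penalty exceed the trivial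
   bound of the difference. *)
- move=> y yr; have hr : 0 <= (1/32 : R) <= 1/32 by lra.
  have [/andP[a1 a2] /andP[a3 a4] /andP[a5 a6] a7 a8] := bounds yr hr.
  rewrite /Psi /=; set s := 1/32 + tau.
  have s1 : s <= 1 by rewrite /s; lra.
  have s2 : 1/32 <= s by rewrite /s; lra.
  set q := B * (_ - _) ^+ 2 in a8.
  rewrite (mulrAC B) -/q.
  have h1 : q * s <= kap / 2 * s by rewrite ler_wpM2r //; lra.
  have h2 : s * (V y - u y) <= s * (3/2 * kap) by rewrite ler_wpM2l //; lra.
  have h3 : N * 1 * s <= N * m y * s by rewrite ler_wpM2r ?ler_wpM2l //; lra.
  have h4 : 64 * 45 * kap * s <= N * s by rewrite ler_wpM2r //; lra.
  have h5 : kap * (1/32) <= kap * s by rewrite ler_wpM2l //; lra.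
  by lra.
move=> {z r} z r d zr /andP[r0 r1] _ d0 zmax rmax.
have hr : 0 <= r <= 1/32 by apply/andP; split; lra.
have [/andP[a1 a2] /andP[a3 a4] /andP[a5 a6] a7 a8] := bounds zr hr.
have [g [X [sX jU FX]]] := Ujet (ray zr hr).
set s := r + tau; have s0 : 0 < s by rewrite /s; lra.
have s1 : s <= 1 by rewrite /s; lra.
set a := U (z + r *: e) in a1 a2 a8; set v := V z in a5 a6 a8.
have Bav1 : B * (a - v) <= 1/8 * (3/2) by rewrite -Bk -mulrA ler_pM2l //; lra.
have Bav2 : - (1/8 * (3/2)) <= B * (a - v) by rewrite -Bk -mulrA -mulrN ler_pM2l //; lra.
(* Expanding the square about its value at the maximum adds its linear part to the increments of [U]
   and [V] and leaves a perfect square. The sum [c1 + c2 = 1 + s] is the coefficient of [u]. *)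
pose c1 := 1 + 2 * B * s * (a - v); pose c2 := s - 2 * B * s * (a - v).
have c1l : 1/2 <= c1 by rewrite /c1; nra.
have c1u : c1 <= 3/2 by rewrite /c1; nra.
have c20 : 0 <= c2 by rewrite /c2; nra.
have [p [d1 d10 hp]] : exists p, exists2 d : R, 0 < d & forall xi, enorm xi < d ->
    m (z + xi) <= m z + dot p xi + 22 * m z ^+ 2 * enorm xi ^+ 2.
  by apply: barrier_expand => //; lra.
have T : lam * (B * s) * enorm (g - t *: z) ^+ 2 <= Lam * (N * s * (22 * m z ^+ 2)).
  apply: (@touch _ _ _ _ _ lam0 lamLam Fell Fqc u z (fun y => U (y + r *: e)) V g (t *: z) X t%:M
     c1 c2 (B * s) (N * s * (22 * m z ^+ 2)) (Num.min d d1) ((N * s) *: p) hu) => //.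
  - exact: in1.
  - exact: jet2_shift.
  - exact: symmx_scalar.
  - lra.
  - by rewrite /c1 /c2; lra.
  - by rewrite mulr_ge0 // ltW.
  - by apply: mulr_ge0; [exact: mulr_ge0 (ltW N0) (ltW s0) | rewrite mulr_ge0 ?sqr_ge0].
  - by rewrite lt_min d0.
  move=> xi; rewrite lt_min => /andP[/zmax hz /hp hm].
  move: hz; rewrite /Psi /= -/s -/a -/v.
  have Ns : 0 <= N * s by rewrite mulr_ge0 // ltW.
  have := ler_wpM2l Ns hm; rewrite dotZl /c1 /c2.
  set a' := U (z + xi + r *: e); set v' := V (z + xi).
  set um := u (z + xi); set m' := m (z + xi) => h1 h2.
  have E : (1 + 2 * B * s * (a - v)) * (a' - a) + (s - 2 * B * s * (a - v)) * (v' - v) +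
    B * s * (a' - v' - (a - v)) ^+ 2 = (a' - a) + s * (v' - v) + B * s * (a' - v') ^+ 2 - B * s * (a - v) ^+ 2 by ring.
  rewrite E; lra.
(* Optimality in [r]. The penalty is linear in [r + tau], so its derivative [N * m z] does not
   degenerate for small [r]. *)
have D : 0 <= c1 * dot g e + (v - u z) + B * (a - v) ^+ 2 - N * m z.
  apply: (@is_derive_left_max R (fun r => Psi (z, r)) r _ d d0) rmax.
  have dU : is_derive r (1:R) (fun r => U (z + r *: e)) (dot g e).
    apply: is_derive_dir => q q0; have [d2 d20 h2] := jet2_dir e jU q0.
    exists d2 => // x /h2; rewrite -[x *: 1]/(x * 1) mulr1 scalerDl addrA; exact.
  have dS : is_derive r (1:R) (fun r => r + tau) 1.
    by apply: is_derive_eqval (is_derive_add (is_derive_idR r) (is_derive_const tau r)) _; rewrite addr0.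
  have dUV := is_derive_add dU (is_derive_const (- v) r).
  have dU1 := is_derive_add dU (is_derive_const (- u z) r).
  have dS1 := is_derive_mul dS (is_derive_const (v - u z) r).
  have dS2 := is_derive_mul (is_derive_mul (is_derive_const B r) dS) (is_derive_mul dUV dUV).
  have dS3 := is_derive_mul (is_derive_const (- (N * m z)) r) dS.
  have dP := is_derive_add (is_derive_add (is_derive_add dU1 dS1) dS2) dS3.
  have -> : (fun r => Psi (z, r)) = (fun r => U (z + r *: e) - u z + (r + tau) * (v - u z) +
     B * (r + tau) * ((U (z + r *: e) - v) * (U (z + r *: e) - v)) + - (N * m z) * (r + tau)).
    by apply/funext => x; rewrite /Psi /= mulNr.
  apply: is_derive_eqval dP _.
  by rewrite -/a -/s /c1; ring.
have De : N * m z / 4 <= dot (g - t *: z) e.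
  have tk := tkap; have h1 := norm_dot_le z e.
  have h2 : t * dot z e <= kap.
    move: h1; rewrite e1 mulr1 ler_norml => /andP[_ h1].
    have : t * dot z e <= t * 1 by rewrite ler_wpM2l // (le_trans h1) //; lra.
    by lra.
  have Nm : N <= N * m z by rewrite ler_peMr // ltW.
  rewrite dotBl dotZl.
  have : c1 * dot g e <= 3/2 * dot g e.
    rewrite ler_wpM2r // -(pmulr_rge0 _ (_ : 0 < c1)); lra.
  by lra.
have dn : N * m z / 4 <= enorm (g - t *: z).
  by rewrite (le_trans De) // (le_trans (dot_le _ _)) // e1 mulr1.
have dn2 : (N * m z / 4) ^+ 2 <= enorm (g - t *: z) ^+ 2.
  by rewrite ler_pXn2r ?nnegrE ?enorm_ge0 // divr_ge0 // mulr_ge0 ?(ltW N0) //; lra.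
have : lam * (B * s) * (N * m z / 4) ^+ 2 <= Lam * (N * s * (22 * m z ^+ 2)).
  by rewrite (le_trans _ T) // ler_wpM2l // !mulr_ge0 // ltW.
set P := N * s * m z ^+ 2.
have P0 : 0 < P by apply: mulr_gt0; [exact: mulr_gt0 | rewrite exprn_gt0 //; lra].
have -> : lam * (B * s) * (N * m z / 4) ^+ 2 = P * (B * (N * lam) / 16) by rewrite /P; field.
have -> : Lam * (N * s * (22 * m z ^+ 2)) = P * (22 * Lam) by rewrite /P; ring.
rewrite ler_pM2l // NE.
(* The 16 is the square of the 4 lost in [De]. With [B * kap = 1/8] the value is [45 / 2 * Lam],
   just above the [22 * Lam] of the barrier. *)
have -> : B * (64 * 45 * kap * Lam) / 16 = (B * kap) * (4 * 45 * Lam) by field.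
have L0 : 0 < Lam by exact: lt_le_trans lamLam.
by rewrite Bk; lra.
Qed.

Lemma lipschitz_bound z r : enorm z < 15/16 -> 0 <= r <= 1/32 ->
  U (z + r *: e) - u z <= (r + tau) * (kap + N * barrier (15/16) z).
Proof.
move=> zr hr; have := lipschitz_psi zr hr; rewrite /Psi /= -/(m z).
have [_ /andP[_ a4] /andP[a5 _] _ _] := bounds zr hr; have ta0 := tau0.
have s0 : 0 <= r + tau by move: hr => /andP[h1 h2]; lra.
have h1 : (r + tau) * - kap <= (r + tau) * (V z - u z) by rewrite ler_wpM2l //; lra.
have h2 : 0 <= B * (r + tau) * (U (z + r *: e) - V z) ^+ 2.
  by rewrite mulr_ge0 ?sqr_ge0 // mulr_ge0 // ltW.
by lra.
Qed.

End LipschitzStep.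

(** * Upper bound on second differences *)

Section SemiconcavityStep.
Context {R : realType} {n : nat}.
Variables (lam Lam : R) (F : 'M[R]_n -> R).
Hypotheses (lam0 : 0 < lam) (lamLam : lam <= Lam) (Fell : uniformly_elliptic lam Lam F).
Hypothesis (Fqc : quasiconcave F).
Variables (u : 'rV[R]_n -> R) (G : R).
Hypotheses (hu : viscosity_supersolution F (eball 0 1) u).
Hypotheses (uK : forall x, eball 0 1 x -> `|u x| <= G) (G0 : 0 < G).
Variables (U : 'rV[R]_n -> R) (e : 'rV[R]_n) (tau : R).
Hypotheses (tau0 : 0 < tau) (tau1 : tau <= 1/2) (e1 : enorm e = 1).
Hypothesis Uu : forall x, enorm x <= 31/32 -> `|U x - u x| <= tau ^+ 2 * G.
Hypothesis UK : forall x, enorm x <= 31/32 -> `|U x| <= G.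
Hypothesis Ujet : forall x, enorm x <= 31/32 -> exists g X, [/\ symmx X, jet2 U x g X & 0 <= F X].
Hypothesis UL : forall x (r : R), enorm x <= 27/32 -> 0 <= r <= 1/32 -> `|U (x + r *: e) - U x| <= G * r.
Implicit Types (z : 'rV[R]_n) (r : R).

(** By [UL] the two translates differ by at most [2 * G * r]. With [B * G = 8] and [r <= 1/64] this
    keeps [2 * B * (a - v)] within 1/2, hence the weights positive; [N >= 32 * 32 * 32 * G] makes
    the penalty at [r = 1/64] at least [8 * G]. *)
Variables B N : R.
Hypotheses (Bk : B * G = 8) (NE : N * lam = 32 * 32 * 32 * G * Lam).
Let m z := barrier (13/16) z.
(* Optimality in r forces |DU(z + r e) - DU(z - r e)| to be at least of size N m (r + tau). *)
Let Psi (w : 'rV[R]_n * R) := U (w.1 + w.2 *: e) + U (w.1 + w.2 *: (- e)) - 2 * u w.1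
  + B * (U (w.1 + w.2 *: e) - U (w.1 + w.2 *: (- e))) ^+ 2 - N * m w.1 * (w.2 + tau) ^+ 2.

Let B0 : 0 < B. Proof. by rewrite -(pmulr_lgt0 _ G0) Bk. Qed.

Let NG : 32 * 32 * 32 * G <= N.
Proof.
by rewrite -(ler_pM2r lam0) NE ler_wpM2l // mulr_ge0 ?(ltW G0) // mulr_ge0 // mulr_ge0.
Qed.

Let in1 z : enorm z < 13/16 -> eball 0 1 z.
Proof. by rewrite /eball /= subr0 => h; lra. Qed.

Let ray z r : enorm z < 13/16 -> 0 <= r <= 1/64 -> enorm (z + r *: e) <= 27/32.
Proof.
move=> h /andP[r0 r1]; rewrite (le_trans (enormD _ _)) // enormZ e1 mulr1 ger0_norm //; lra.
Qed.

Let rayN z r : enorm z < 13/16 -> 0 <= r <= 1/64 -> enorm (z + r *: (- e)) <= 27/32.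
Proof.
move=> h /andP[r0 r1]; rewrite (le_trans (enormD _ _)) // enormZ enormN e1 mulr1 ger0_norm //; lra.
Qed.

Let in31 z : enorm z <= 27/32 -> enorm z <= 31/32.
Proof. by move=> h; lra. Qed.

Let gradU z g X : enorm z <= 27/32 -> jet2 U z g X -> - G <= dot g e <= G.
Proof.
move=> hz jU; rewrite -ler_norml; apply/ler_addgt0Pr => q q0.
have [d d0 D] := jet2_dir e jU q0.
pose t := Num.min (d / 2) (1/32).
have t0 : 0 < t by rewrite lt_min !divr_gt0.
have td : `|t| < d.
  rewrite gtr0_norm // (@le_lt_trans _ _ (d / 2)) ?ge_min ?lexx //; lra.
have tr : 0 <= t <= 1/32 by rewrite (ltW t0) ge_min lexx orbT.
have h1 := UL hz tr; have := D _ td; rewrite (gtr0_norm t0) => h2.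
rewrite -(ler_pM2l t0) -{1}(gtr0_norm t0) -normrM.
have -> : t * dot g e = (U (z + t *: e) - U z) - (U (z + t *: e) - U z - t * dot g e) by ring.
rewrite (le_trans (ler_normB _ _)) // mulrDr lerD //; first by rewrite [leRHS]mulrC.
by rewrite [leRHS]mulrC.
Qed.

Let bounds z r : enorm z < 13/16 -> 0 <= r <= 1/64 ->
  [/\ [/\ - G <= U (z + r *: e) <= G, - G <= U (z + r *: (- e)) <= G & - G <= u z <= G],
    - (2 * G * r) <= U (z + r *: e) - U (z + r *: (- e)) <= 2 * G * r, 1 <= m z &
    B * (U (z + r *: e) - U (z + r *: (- e))) ^+ 2 <= 32 * G * r ^+ 2].
Proof.
have g0 := G0; move=> h hr; move: (hr) => /andP[r0 r1].
have a4 : - (2 * G * r) <= U (z + r *: e) - U (z + r *: (- e)) <= 2 * G * r.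
  have r2 : 0 <= 2 * r <= 1/32 by apply/andP; split; lra.
  have E : z + r *: - e + (2 * r) *: e = z + r *: e.
    by rewrite -addrA; congr (_ + _); apply/rowP => i; rewrite !mxE; ring.
  have := UL (rayN h hr) r2; rewrite -ler_norml E mulrA (mulrC G); exact.
split=> //.
- split; rewrite -ler_norml; [apply: UK; exact/in31/ray | apply: UK; exact/in31/rayN |].
  by apply: uK; exact: in1.
- by apply: barrier_ge1 => //; lra.
set a := U _ - U _ in a4 *; move: a4 => /andP[p1 p2].
have : 0 <= (2 * G * r - a) * (2 * G * r + a) by rewrite mulr_ge0 //; lra.
move=> /(mulr_ge0 (ltW B0)).
have -> : B * ((2 * G * r - a) * (2 * G * r + a)) = 4 * (B * G) * G * r ^+ 2 - B * a ^+ 2 by ring.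
by rewrite Bk; lra.
Qed.

Lemma semiconcave_psi z r : enorm z < 13/16 -> 0 <= r <= 1/64 -> Psi (z, r) <= 0.
Proof.
have g0 := G0. have Ng := NG. have ta0 := tau0. have ta1 := tau1.
have N0 : 0 < N by lra.
apply: (@barrier_max R n Psi (13/16) (1/64) (5 * G) (N * tau ^+ 2)) => //; try lra.
- by rewrite mulr_gt0 // exprn_gt0.
- move=> w w1 w2.
  have [g [X [_ /jet2_continuous cU _]]] := Ujet (in31 (ray w1 w2)).
  have [g' [X' [_ /jet2_continuous cU' _]]] := Ujet (in31 (rayN w1 w2)).
  have cu : {for w.1, continuous u}.
    by case: hu => cu _; apply: visc_continuous cu _; [exact: eball_open | exact: in1].
  have cs : {for w, continuous (fun w : 'rV[R]_n * R => w.2 + tau)}.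
    by apply: continuousD; [exact: cvg_snd | exact: cst_continuous].
  have cUV : {for w, continuous (fun w : 'rV[R]_n * R => U (w.1 + w.2 *: e) - U (w.1 + w.2 *: (- e)))}.
    by apply: continuousB; exact: continuous_ray.
  have cm : {for w.1, continuous m} by exact: barrier_continuous.
  apply: continuousB; last first.
    apply: continuousM; last exact: continuousM.
    by apply: continuousM; [exact: cst_continuous | exact: continuous_fst].
  apply: continuousD.
    apply: continuousB.
      by apply: continuousD; exact: continuous_ray.
    by apply: continuousM; [exact: cst_continuous | exact: continuous_fst].
  by apply: continuousM; [exact: cst_continuous | exact: continuousM].
- move=> y s yr sr; have [[/andP[a1 a2] /andP[a3 a4] /andP[a5 a6]] _ a7 a8] := bounds yr sr.
  move: (sr) => /andP[s0 s1]; rewrite /Psi /= -/(m y).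
  have : N * m y * tau ^+ 2 <= N * m y * (s + tau) ^+ 2.
    have Nm0 : 0 <= N * m y by apply: mulr_ge0; lra.
    by rewrite ler_wpM2l // ler_pXn2r ?nnegrE //; lra.
  have h1 : G * s ^+ 2 <= G * (1/32) by rewrite ler_wpM2l ?(ltW g0) //; nra.
  by lra.
(* At [r = 0] the translates coincide and [2 * (U - u) <= 2 * tau ^+ 2 * G] remains; this quadratic
   penalty is why the approximation must be accurate to order [tau ^+ 2]. *)
- move=> y yr; have hr : 0 <= (0:R) <= 1/64 by lra.
  have [_ _ a7 _] := bounds yr hr.
  have yr' : enorm y <= 31/32 by lra.
  have := Uu yr'; rewrite ler_norml => /andP[_ h].
  rewrite /Psi /= !scale0r addr0 add0r subrr expr0n /= mulr0.
  have h3 : N * 1 * tau ^+ 2 <= N * m y * tau ^+ 2 by rewrite ler_wpM2r ?sqr_ge0 // ler_wpM2l // ltW.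
  have h4 : 32 * 32 * 32 * G * tau ^+ 2 <= N * tau ^+ 2 by rewrite ler_wpM2r // sqr_ge0.
  have h5 : 0 <= G * tau ^+ 2 by rewrite mulr_ge0 ?sqr_ge0 // ltW.
  by lra.
- move=> y yr; have hr : 0 <= (1/64 : R) <= 1/64 by lra.
  have [[/andP[a1 a2] /andP[a3 a4] /andP[a5 a6]] _ a7 a8] := bounds yr hr.
  rewrite /Psi /=; set s := 1/64 + tau.
  have s2 : (1/64) ^+ 2 <= s ^+ 2 by rewrite ler_pXn2r ?nnegrE /s //; lra.
  have h3 : N * 1 * s ^+ 2 <= N * m y * s ^+ 2 by rewrite ler_wpM2r ?sqr_ge0 // ler_wpM2l // ltW.
  have h4 : N * (1/64) ^+ 2 <= N * s ^+ 2 by rewrite ler_wpM2l // ltW.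
  by lra.
move=> {z r} z r d zr /andP[r0 r1] _ d0 zmax rmax.
have hr : 0 <= r <= 1/64 by apply/andP; split; lra.
have [[/andP[a1 a2] /andP[a3 a4] /andP[a5 a6]] /andP[dl du] a7 a8] := bounds zr hr.
have [g [X [sX jU FX]]] := Ujet (in31 (ray zr hr)).
have [g' [X' [sX' jU' FX']]] := Ujet (in31 (rayN zr hr)).
set s := r + tau; have s0 : 0 < s by rewrite /s; lra.
have sr : r <= s by rewrite /s; lra.
set a := U (z + r *: e) in a1 a2 a8 dl du; set v := U (z + r *: (- e)) in a3 a4 a8 dl du.
have Bl : B * (a - v) <= 1/4.
  have := ler_wpM2l (ltW B0) du; have -> : B * (2 * G * r) = 2 * (B * G) * r by ring.
  by rewrite Bk; lra.
have Bu : - (1/4) <= B * (a - v).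
  have := ler_wpM2l (ltW B0) dl; have -> : B * - (2 * G * r) = - (2 * (B * G) * r) by ring.
  by rewrite Bk; lra.
pose c1 := 1 + 2 * B * (a - v); pose c2 := 1 - 2 * B * (a - v).
have [p [d1 d10 hp]] : exists p, exists2 d : R, 0 < d & forall xi, enorm xi < d ->
    m (z + xi) <= m z + dot p xi + 22 * m z ^+ 2 * enorm xi ^+ 2.
  by apply: barrier_expand => //; lra.
have T : lam * B * enorm (g - g') ^+ 2 <= Lam * (N * s ^+ 2 * (22 * m z ^+ 2)).
  apply: (@touch _ _ _ _ _ lam0 lamLam Fell Fqc u z (fun y => U (y + r *: e)) (fun y => U (y + r *: (- e)))
     g g' X X' c1 c2 B (N * s ^+ 2 * (22 * m z ^+ 2)) (Num.min d d1) ((N * s ^+ 2) *: p) hu) => //.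
  - exact: in1.
  - exact: jet2_shift.
  - exact: jet2_shift.
  - by rewrite /c1; lra.
  - by rewrite /c2; lra.
  - by rewrite /c1 /c2; lra.
  - exact: ltW.
  - by apply: mulr_ge0; [exact: mulr_ge0 (ltW N0) (sqr_ge0 _) | rewrite mulr_ge0 ?sqr_ge0].
  - by rewrite lt_min d0.
  move=> xi; rewrite lt_min => /andP[/zmax hz /hp hm].
  move: hz; rewrite /Psi /= -/s -/a -/v.
  have Ns : 0 <= N * s ^+ 2 by rewrite mulr_ge0 ?sqr_ge0 // ltW.
  have := ler_wpM2l Ns hm; rewrite dotZl /c1 /c2.
  set a' := U (z + xi + r *: e); set v' := U (z + xi + _).
  set um := u (z + xi); set m' := m (z + xi) => h1 h2.
  have E : (1 + 2 * B * (a - v)) * (a' - a) + (1 - 2 * B * (a - v)) * (v' - v) +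
    B * (a' - v' - (a - v)) ^+ 2 = (a' - a) + (v' - v) + B * (a' - v') ^+ 2 - B * (a - v) ^+ 2 by ring.
  by rewrite E; lra.
have D : 0 <= c1 * dot g e - c2 * dot g' e - 2 * (N * m z * s).
  apply: (@is_derive_left_max R (fun r => Psi (z, r)) r _ d d0) rmax.
  have dU : is_derive r (1:R) (fun r => U (z + r *: e)) (dot g e).
    apply: is_derive_dir => q q0; have [d2 d20 h2] := jet2_dir e jU q0.
    by exists d2 => // x /h2; rewrite -[x *: 1]/(x * 1) mulr1 scalerDl addrA; exact.
  have dU' : is_derive r (1:R) (fun r => U (z + r *: (- e))) (dot g' (- e)).
    apply: is_derive_dir => q q0; have [d2 d20 h2] := jet2_dir (- e) jU' q0.
    by exists d2 => // x /h2; rewrite -[x *: 1]/(x * 1) mulr1 scalerDl addrA; exact.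
  have dS : is_derive r (1:R) (fun r => r + tau) 1.
    by apply: is_derive_eqval (is_derive_add (is_derive_idR r) (is_derive_const tau r)) _; rewrite addr0.
  have dm := is_derive_add dU (is_derive_mul (is_derive_const (-1) r) dU').
  have dP := is_derive_add (is_derive_add (is_derive_add (is_derive_add dU dU')
    (is_derive_const (- (2 * u z)) r)) (is_derive_mul (is_derive_const B r) (is_derive_mul dm dm)))
    (is_derive_mul (is_derive_const (- (N * m z)) r) (is_derive_mul dS dS)).
  have -> : (fun r => Psi (z, r)) = (fun r => U (z + r *: e) + U (z + r *: (- e)) + - (2 * u z) +
     B * ((U (z + r *: e) + -1 * U (z + r *: (- e))) * (U (z + r *: e) + -1 * U (z + r *: (- e))))
     + - (N * m z) * ((r + tau) * (r + tau))).
    by apply/funext => x; rewrite /Psi /=; ring.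
  apply: is_derive_eqval dP _.
  by rewrite dotNr -/a -/v -/s /c1 /c2; ring.
have De : N * m z * s <= dot (g - g') e.
  have /andP[g1 g2] := gradU (ray zr hr) jU; have /andP[g3 g4] := gradU (rayN zr hr) jU'.
  (* The weights differ from 1 by a multiple of [r] and the slopes are at most [G], so unequal
     weights cost a multiple of [G * r], absorbed by half of [2 * (N * m z * s)]. *)
  have h1 : `|2 * (B * (a - v)) * (dot g e + dot g' e)| <= 2 * (2 * 8 * r) * (2 * G).
    rewrite normrM; apply: ler_pM => //; last by rewrite ler_norml; lra.
    rewrite normrM (ger0_norm (_ : 0 <= 2)) // ler_wpM2l // normrM gtr0_norm //.
    rewrite -Bk (_ : 2 * (B * G) * r = B * (2 * G * r)); last by ring.
    by rewrite ler_wpM2l ?(ltW B0) // ler_norml dl du.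
  have Nm : N * s <= N * m z * s by rewrite ler_wpM2r ?(ltW s0) // ler_peMr // ltW.
  have h2 : 32 * 32 * 32 * G * s <= N * s by rewrite ler_wpM2r // ltW.
  have h3 : G * r <= G * s by rewrite ler_wpM2l // ltW.
  move: h1; rewrite ler_norml => /andP[_ h1].
  have h4 : 0 <= G * s by rewrite mulr_ge0 // ltW.
  have E : c1 * dot g e - c2 * dot g' e = dot g e - dot g' e + 2 * (B * (a - v)) * (dot g e + dot g' e).
    by rewrite /c1 /c2; ring.
  by rewrite dotBl; move: D; rewrite E; lra.
have dn : N * m z * s <= enorm (g - g').
  by rewrite (le_trans De) // (le_trans (dot_le _ _)) // e1 mulr1.
have Nms0 : 0 <= N * m z * s by apply: mulr_ge0; [apply: mulr_ge0; lra | lra].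
have dn2 : (N * m z * s) ^+ 2 <= enorm (g - g') ^+ 2.
  by rewrite ler_pXn2r ?nnegrE ?enorm_ge0.
have : lam * B * (N * m z * s) ^+ 2 <= Lam * (N * s ^+ 2 * (22 * m z ^+ 2)).
  by rewrite (le_trans _ T) // ler_wpM2l // !mulr_ge0 // ltW.
set P := N * s ^+ 2 * m z ^+ 2.
have P0 : 0 < P by apply: mulr_gt0; [apply: mulr_gt0 => //; rewrite exprn_gt0 | rewrite exprn_gt0 //; lra].
have -> : lam * B * (N * m z * s) ^+ 2 = P * (B * (N * lam)) by rewrite /P; ring.
have -> : Lam * (N * s ^+ 2 * (22 * m z ^+ 2)) = P * (22 * Lam) by rewrite /P; ring.
rewrite ler_pM2l // NE.
have -> : B * (32 * 32 * 32 * G * Lam) = (B * G) * (32 * 32 * 32 * Lam) by ring.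
have L0 : 0 < Lam by exact: lt_le_trans lamLam.
by rewrite Bk; lra.
Qed.

Lemma semiconcave_bound z r : enorm z < 13/16 -> 0 <= r <= 1/64 ->
  U (z + r *: e) + U (z + r *: (- e)) - 2 * u z <= N * barrier (13/16) z * (r + tau) ^+ 2.
Proof.
move=> zr hr; have := semiconcave_psi zr hr; rewrite /Psi /= -/(m z).
have h2 : 0 <= B * (U (z + r *: e) - U (z + r *: (- e))) ^+ 2.
  by rewrite mulr_ge0 ?sqr_ge0 // ltW.
by lra.
Qed.

End SemiconcavityStep.

(** * Averages over the unit interval and Taylor's formula on the line *)

Section UnitAverage.
Context {R : realType}.
Implicit Types (phi psi : R -> R).
Local Notation mu := (@lebesgue_measure R).

Definition unit_avg phi : R := \int[mu]_(t in `[0, 1]) phi t.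

Lemma continuous_integrable_segment phi (a b : R) : continuous phi ->
  mu.-integrable `[a, b] (EFin \o phi).
Proof.
move=> c; apply: continuous_compact_integrable; first exact: segment_compact.
exact: continuous_subspaceT.
Qed.

Lemma unit_avg_linear phi psi (a b : R) : continuous phi -> continuous psi ->
  unit_avg (fun t => a * phi t + b * psi t) = a * unit_avg phi + b * unit_avg psi.
Proof.
move=> c1 c2.
have ca : continuous (fun t => a * phi t) by move=> t; apply: continuousM; [exact: cst_continuous|exact: c1].
have cb : continuous (fun t => b * psi t) by move=> t; apply: continuousM; [exact: cst_continuous|exact: c2].
rewrite /unit_avg RintegralD //; [|exact: continuous_integrable_segment..].
by rewrite !RintegralZl //; exact: continuous_integrable_segment.
Qed.

Lemma unit_avg_cst (c : R) : unit_avg (fun=> c) = c.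
Proof.
rewrite /unit_avg Rintegral_cst //=.
by rewrite lebesgue_measure_itv /= lte_fin ltr01 oppr0 addr0 mulr1.
Qed.

Lemma unit_avg_le phi psi : continuous phi -> continuous psi ->
  (forall t, 0 <= t <= 1 -> phi t <= psi t) -> unit_avg phi <= unit_avg psi.
Proof.
by move=> c1 c2 h; apply: le_Rintegral => //; exact: continuous_integrable_segment.
Qed.

Lemma is_derive_translate (G : R -> R) (r t a : R) : is_derive (r + t) (1:R) G a ->
  is_derive t (1:R) (fun t => G (r + t)) a.
Proof.
move=> h.
have d : is_derive t (1:R) (fun t => r + t) 1.
  by apply: is_derive_eqval (is_derive_add (is_derive_const r t) (is_derive_idR t)) _; rewrite add0r.
by have := @is_derive1_comp R G (fun t => r + t) t a 1 h d; rewrite mulr1.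
Qed.

Lemma is_derive_continuous (G : R -> R) (t a : R) : is_derive t (1:R) G a -> {for t, continuous G}.
Proof. by case=> d _; apply/differentiable_continuous/derivable1_diffP. Qed.

(** Averaging a continuous function gains one derivative, which is again a difference of its values.
    Repeating this along a direction produces all derivatives needed below. *)
Lemma unit_avg_derive phi (r : R) : continuous phi ->
  is_derive r (1:R) (fun r => unit_avg (fun t => phi (r + t))) (phi (r + 1) - phi r).
Proof.
move=> c.
(* Starting at [r - 2] makes [G] a primitive around both [r] and [r + 1], so the formula [E] holds
   on a whole neighbourhood of [r]. *)
pose G y : R := \int[mu]_(t in `[r - 2, y]) phi t.
have dG y : r - 2 < y -> is_derive y (1:R) G (phi y).
  move=> ry.
  have y1 : y < y + 1 by rewrite ltrDl.
  have [|dy Gy] := @continuous_FTC1_closed R phi (r - 2) y (y + 1) y1 _ ry (c y).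
    exact: continuous_integrable_segment.
  have e : 'D_1 G y = phi y by rewrite -derive1E; exact: Gy.
  exact: (DeriveDef dy e).
have dF s t : r - 2 < s + t -> is_derive t (1:R) (fun t => G (s + t)) (phi (s + t)).
  by move=> h; apply: is_derive_translate; exact: dG.
have E s : r - 1 < s -> unit_avg (fun t => phi (s + t)) = G (s + 1) - G s.
  move=> rs.
  have cf : continuous (fun t => phi (s + t)).
    by move=> t; apply: continuous_comp; [apply: continuousD; [exact: cst_continuous|] | exact: c].
  rewrite /unit_avg /Rintegral (@continuous_FTC2 R _ (fun t => G (s + t)) 0 1) //=.
  - by rewrite addr0.
  - exact: continuous_subspaceT.
  - split.
    + move=> x; rewrite in_itv /= => /andP[x0 _]; have [|] := dF s x; [lra | by []].
    + by apply: cvg_at_right_filter; apply: is_derive_continuous (dF s 0 _); lra.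
    + by apply: cvg_at_left_filter; apply: is_derive_continuous (dF s 1 _); lra.
  - move=> x; rewrite in_itv /= => /andP[x0 _]; rewrite derive1E.
    by have [|_ ->] := dF s x; [lra|].
have d1 : is_derive r (1:R) (fun s => G (1 + s)) (phi (r + 1)).
  by rewrite addrC; apply: dF; lra.
have d2 : is_derive r (1:R) G (phi r) by apply: dG; lra.
have d3 := is_derive_add d1 (is_derive_mul (is_derive_const (-1) r) d2).
apply: is_derive_eqval (near_eq_is_derive _ d3) _; last by ring.
near=> s; rewrite E; first by rewrite (addrC s) mulN1r.
by near: s; apply: lt_nbhsr; lra.
Unshelve. all: by end_near.
Qed.

Lemma mvt_bound (k dk : R -> R) (r C : R) : (forall s, is_derive s (1:R) k (dk s)) ->
  (forall s, `|s| <= `|r| -> `|dk s| <= C) -> `|k r - k 0| <= C * `|r|.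
Proof.
move=> dk' hC.
have ck : continuous k by move=> s; exact: is_derive_continuous (dk' s).
have [r0|r0|<-] := ltgtP 0 r; last by rewrite subrr !normr0 mulr0.
  have [|s /itvP sr ->] := @MVT_segment R k dk 0 r (ltW r0).
    exact: continuous_subspaceT.
  rewrite subr0 normrM ler_wpM2r // hC // !ger0_norm ?sr // ltW //.
have [|s /itvP sr E] := @MVT_segment R k dk r 0 (ltW r0).
  exact: continuous_subspaceT.
rewrite distrC E sub0r normrM normrN ler_wpM2r // hC // !ler0_norm ?sr ?(ltW r0) //.
by rewrite lerN2 sr.
Qed.

Lemma taylor3_bound (h0 h1 h2 h3 : R -> R) (M r : R) :
  (forall s, is_derive s (1:R) h0 (h1 s)) -> (forall s, is_derive s (1:R) h1 (h2 s)) ->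
  (forall s, is_derive s (1:R) h2 (h3 s)) -> (forall s, `|h3 s| <= M) ->
  `|h0 r - h0 0 - r * h1 0 - 1/2 * r ^+ 2 * h2 0| <= M * `|r| ^+ 3.
Proof.
move=> d0 d1 d2 b3.
have M0 : 0 <= M by exact: le_trans (b3 0).
have b2 s : `|h2 s - h2 0| <= M * `|s| by apply: mvt_bound d2 _ => x _; exact: b3.
have b1 s : `|(h1 s + s * - h2 0) - (h1 0 + 0 * - h2 0)| <= (M * `|s|) * `|s|.
  apply: (@mvt_bound (fun s => h1 s + s * - h2 0) (fun s => h2 s - h2 0)) => [x|x xs].
    apply: is_derive_eqval (is_derive_add (d1 x) (is_derive_mul (is_derive_idR x) (is_derive_const (- h2 0) x))) _ => //.
    by ring.
  by rewrite (le_trans (b2 _)) // ler_wpM2l.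
pose k s := h0 s - s * h1 0 - 1/2 * s ^+ 2 * h2 0.
have dk s : is_derive s (1:R) k (h1 s - h1 0 - s * h2 0).
  have := is_derive_add (is_derive_add (d0 s) (is_derive_mul (is_derive_idR s) (is_derive_const (- h1 0) s)))
    (is_derive_mul (is_derive_mul (is_derive_idR s) (is_derive_idR s)) (is_derive_const (- (1/2 * h2 0)) s)).
  have -> : (fun t => h0 t + t * - h1 0 + t * t * - (1 / 2 * h2 0)) = k.
    by apply/funext => x; rewrite /k; ring.
  by move=> h; apply: is_derive_eqval h _; field.
have := @mvt_bound k _ r (M * `|r| * `|r|) dk.
rewrite (_ : k r - k 0 = h0 r - h0 0 - r * h1 0 - 1 / 2 * r ^+ 2 * h2 0); last by rewrite /k; ring.
have -> : M * `|r| * `|r| * `|r| = M * `|r| ^+ 3 by ring.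
apply=> s sr; have := b1 s; rewrite (_ : h1 s + s * - h2 0 - (h1 0 + 0 * - h2 0) = h1 s - h1 0 - s * h2 0); last by ring.
move=> h; rewrite (le_trans h) // -!mulrA ler_wpM2l // ler_pM //.
Qed.

End UnitAverage.

(** * Averaging along a direction *)

Section Smoothing.
Context {R : realType} {n : nat}.
Implicit Types (f g : 'rV[R]_n -> R) (x y v h xi : 'rV[R]_n) (M c r q : R).

(** Uniform over all of R^n: functions are extended to the whole space before they are smoothed, so
    averages and translates never leave the domain. *)
Definition ucont f : Prop := forall q, 0 < q ->
  exists2 d : R, 0 < d & forall x y, enorm (x - y) < d -> `|f x - f y| <= q.

Definition bounded_by M f : Prop := forall x, `|f x| <= M.

Lemma ucont_lin a b f g : ucont f -> ucont g -> ucont (fun x => a * f x + b * g x).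
Proof.
move=> uf ug q q0.
have pa : 0 < q / (2 * (`|a| + 1)) by rewrite divr_gt0 // mulr_gt0 // ltr_wpDl.
have pb : 0 < q / (2 * (`|b| + 1)) by rewrite divr_gt0 // mulr_gt0 // ltr_wpDl.
have [d1 d10 D1] := uf _ pa; have [d2 d20 D2] := ug _ pb.
exists (Num.min d1 d2) => [|x y]; first by rewrite lt_min d10.
rewrite lt_min => /andP[/D1 l1 /D2 l2].
have -> : a * f x + b * g x - (a * f y + b * g y) = a * (f x - f y) + b * (g x - g y) by ring.
rewrite (le_trans (ler_normD _ _)) // !normrM (splitr q).
have hA (c d e : R) : 0 <= c -> 0 <= d -> e <= d / (2 * (c + 1)) -> c * e <= d / 2.
  move=> c0 d0; rewrite ler_pdivlMr ?mulr_gt0 ?ltr_wpDl // => h.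
  have c1 : 0 < 2 * (c + 1) by rewrite mulr_gt0 // ltr_wpDl.
  rewrite -(ler_pM2r c1) -mulrA.
  have : c * (e * (2 * (c + 1))) <= c * d by rewrite ler_wpM2l.
  by nra.
by rewrite lerD // hA // ltW.
Qed.

Lemma ucont_shift f h : ucont f -> ucont (fun x => f (x + h)).
Proof.
move=> uf q /uf [d d0 D]; exists d => // x y xy; apply: D.
by rewrite opprD addrACA subrr addr0.
Qed.

Lemma ucont_continuous f : ucont f -> continuous f.
Proof.
move=> uf x; apply/continuous_atP => q q0.
have q2 : 0 < q / 2 by rewrite divr_gt0.
have [d d0 D] := uf _ q2; exists d => // xi xid.
rewrite (le_lt_trans (D _ _ _)) //; first by rewrite addrC addKr.
by rewrite ltr_pdivrMr // ltr_pMr // ltr1n.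
Qed.

Lemma ucont_line f x v : ucont f -> continuous (fun t : R => f (x + t *: v)).
Proof.
move=> /ucont_continuous cf t.
refine (@cvg_comp _ _ _ (fun t : R => x + t *: v) f (nbhs t) _ _ _ (cf _)).
by apply: cvgD; [exact: cvg_cst | apply: cvgZr_tmp; exact: cvg_id].
Qed.

Definition savg v f x : R := unit_avg (fun t => f (x + t *: v)).

Lemma savg_lin v a b f g : ucont f -> ucont g ->
  savg v (fun x => a * f x + b * g x) = fun x => a * savg v f x + b * savg v g x.
Proof. by move=> uf ug; apply/funext => x; apply: unit_avg_linear; exact: ucont_line. Qed.

Lemma savg_shift v f h : savg v (fun x => f (x + h)) = fun x => savg v f (x + h).
Proof. by apply/funext => x; congr unit_avg; apply/funext => t; rewrite addrAC. Qed.

Lemma savg_ge v f x c : ucont f -> (forall t, 0 <= t <= 1 -> c <= f (x + t *: v)) -> c <= savg v f x.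
Proof.
move=> uf h; rewrite -[leLHS](unit_avg_cst c); apply: unit_avg_le => //; last exact: ucont_line.
by move=> t; exact: cst_continuous.
Qed.

Lemma savg_le v f x c : ucont f -> (forall t, 0 <= t <= 1 -> f (x + t *: v) <= c) -> savg v f x <= c.
Proof.
move=> uf h; rewrite -[leRHS](unit_avg_cst c); apply: unit_avg_le => //; first exact: ucont_line.
by move=> t; exact: cst_continuous.
Qed.

Lemma savg_norm v f x c : ucont f -> (forall t, 0 <= t <= 1 -> `|f (x + t *: v)| <= c) -> `|savg v f x| <= c.
Proof.
move=> uf h; rewrite ler_norml savg_ge ?savg_le // => t /h; rewrite ler_norml => /andP[] //.
Qed.

Lemma savg_bounded v M f : ucont f -> bounded_by M f -> bounded_by M (savg v f).
Proof. by move=> uf bf x; apply: savg_norm. Qed.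

Lemma savg_ucont v f : ucont f -> ucont (savg v f).
Proof.
move=> uf q q0; have [d d0 D] := uf q q0; exists d => // x y xy.
have -> : savg v f x - savg v f y = savg v (fun z => 1 * f z + (-1) * f (z + (y - x))) x.
  rewrite savg_lin // ?savg_shift; last exact: ucont_shift.
  by rewrite mul1r mulN1r addrCA subrr addr0.
apply: savg_norm; first by apply: ucont_lin => //; exact: ucont_shift.
move=> t _; rewrite mul1r mulN1r; apply: D.
by rewrite opprD addrA subrr sub0r opprB.
Qed.

Lemma savg_derive v f x r : ucont f ->
  is_derive r (1:R) (fun r => savg v f (x + r *: v)) (f (x + r *: v + v) - f (x + r *: v)).
Proof.
move=> uf; have := unit_avg_derive r (@ucont_line f x v uf).
have -> : x + (r + 1) *: v = x + r *: v + v by rewrite scalerDl scale1r addrA.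
congr (is_derive _ _ _ _); apply/funext => s; congr unit_avg; apply/funext => t.
by rewrite scalerDl addrA.
Qed.

Definition fdiff v f x : R := f (x + v) - f x.

Lemma fdiff_ucont v f : ucont f -> ucont (fdiff v f).
Proof.
move=> uf; have := ucont_lin 1 (-1) (ucont_shift v uf) uf; congr ucont.
by apply/funext => x; rewrite mul1r mulN1r.
Qed.

Lemma fdiff_bounded v M f : bounded_by M f -> bounded_by (2 * M) (fdiff v f).
Proof. by move=> bf x; rewrite (le_trans (ler_normB _ _)) // mulr_natl mulr2n lerD. Qed.

Lemma fdiff_derive v f (df : 'rV[R]_n -> R) x r :
  (forall x r, is_derive r (1:R) (fun r => f (x + r *: v)) (df (x + r *: v))) ->
  is_derive r (1:R) (fun r => fdiff v f (x + r *: v)) (fdiff v df (x + r *: v)).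
Proof.
move=> d; have := is_derive_add (d (x + v) r) (is_derive_mul (is_derive_const (-1) r) (d x r)).
have -> : (fun t => f (x + v + t *: v) + -1 * f (x + t *: v)) = (fun t => fdiff v f (x + t *: v)).
  by apply/funext => t; rewrite /fdiff mulN1r addrAC.
by move=> h; apply: is_derive_eqval h _; rewrite /fdiff mulr0 addr0 mulN1r addrAC.
Qed.

(** After three averages the restriction to lines along [v] has three derivatives, all finite
    differences of fewer averages. [savg3_d1] and [savg3_d2] are the first two; the third is bounded
    by [8 * M] when [f] is bounded by [M]. *)
Definition savg3 v f := savg v (savg v (savg v f)).
Definition savg3_d1 v f := fdiff v (savg v (savg v f)).
Definition savg3_d2 v f := fdiff v (fdiff v (savg v f)).

Lemma savg3_expand v M f x r : ucont f -> bounded_by M f ->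
  `|savg3 v f (x + r *: v) - savg3 v f x - r * savg3_d1 v f x - 1/2 * r ^+ 2 * savg3_d2 v f x|
  <= 8 * M * `|r| ^+ 3.
Proof.
move=> uf bf.
have u1 := savg_ucont v uf; have u2 := savg_ucont v u1.
pose h0 r := savg3 v f (x + r *: v); pose h1 r := savg3_d1 v f (x + r *: v).
pose h2 r := savg3_d2 v f (x + r *: v); pose h3 r := fdiff v (fdiff v (fdiff v f)) (x + r *: v).
have d0 s : is_derive s (1:R) h0 (h1 s) by exact: savg_derive.
have d1 s : is_derive s (1:R) h1 (h2 s).
  by apply: fdiff_derive => y t; exact: savg_derive.
have d2 s : is_derive s (1:R) h2 (h3 s).
  by apply: fdiff_derive => y t; apply: fdiff_derive => z w; exact: savg_derive.
have b3 s : `|h3 s| <= 8 * M.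
  have := fdiff_bounded v (fdiff_bounded v (fdiff_bounded v bf)) (x + s *: v).
  by rewrite -/(h3 s) => h; rewrite (le_trans h) // !mulrA -!natrM.
have := taylor3_bound r d0 d1 d2 b3.
by rewrite /h0 /h1 /h2 scale0r addr0.
Qed.

End Smoothing.

(** * The smoothing operator and its second-order expansion *)

Section SmoothingOperator.
Context {R : realType} {n : nat}.
Implicit Types (f g : 'rV[R]_n -> R) (x y v h xi : 'rV[R]_n) (M c r q rho : R) (s : seq 'I_n).

Lemma savg3_ucont v f : ucont f -> ucont (savg3 v f).
Proof. by move=> uf; do 3!apply: savg_ucont. Qed.

Lemma savg3_bounded v M f : ucont f -> bounded_by M f -> bounded_by M (savg3 v f).
Proof.
move=> uf bf; have u1 := savg_ucont v uf; have u2 := savg_ucont v u1.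
by do 3!apply: savg_bounded => //.
Qed.

Lemma savg3_lin v a b f g : ucont f -> ucont g ->
  savg3 v (fun x => a * f x + b * g x) = fun x => a * savg3 v f x + b * savg3 v g x.
Proof.
move=> uf ug; have u1 := savg_ucont v uf; have u2 := savg_ucont v u1.
have w1 := savg_ucont v ug; have w2 := savg_ucont v w1.
by rewrite /savg3 !savg_lin.
Qed.

Lemma savg3_shift v f h : savg3 v (fun x => f (x + h)) = fun x => savg3 v f (x + h).
Proof.
exact: (etrans (congr1 (fun k => savg v (savg v k)) (savg_shift v f h))
  (etrans (congr1 (savg v) (savg_shift v (savg v f) h)) (savg_shift v _ h))).
Qed.

Lemma savg3_ge v f x c : ucont f ->
  (forall y, enorm (y - x) <= 3 * enorm v -> c <= f y) -> c <= savg3 v f x.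
Proof.
move=> uf h; have u1 := savg_ucont v uf; have u2 := savg_ucont v u1.
apply: savg_ge => // t ht; apply: savg_ge => // t' ht'; apply: savg_ge => // t'' ht''.
apply: h; have -> : x + t *: v + t' *: v + t'' *: v - x = (t + t' + t'') *: v.
  by apply/rowP => i; rewrite !mxE; ring.
rewrite enormZ ler_wpM2r ?enorm_ge0 //.
by move: ht ht' ht'' => /andP[? ?] /andP[? ?] /andP[? ?]; rewrite ger0_norm; lra.
Qed.

Fixpoint smooth rho s f : 'rV[R]_n -> R :=
  if s is i :: s' then smooth rho s' (savg3 (rho *: ebasis i) f) else f.

Lemma smooth_bounded rho s M f : ucont f -> bounded_by M f -> bounded_by M (smooth rho s f).
Proof.
elim: s f => //= i s ih f uf bf.
by apply: ih; [exact: savg3_ucont | exact: savg3_bounded].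
Qed.

Lemma smooth_lin rho s a b f g : ucont f -> ucont g ->
  smooth rho s (fun x => a * f x + b * g x) = fun x => a * smooth rho s f x + b * smooth rho s g x.
Proof.
elim: s f g => //= i s ih f g uf ug; rewrite savg3_lin // ih //; exact: savg3_ucont.
Qed.

Lemma smooth_shift rho s f h : smooth rho s (fun x => f (x + h)) = fun x => smooth rho s f (x + h).
Proof.
elim: s f => //= i s ih f.
exact: (etrans (congr1 (smooth rho s) (savg3_shift _ f h)) (ih _)).
Qed.

Lemma smooth_ge rho s f x c : 0 <= rho -> ucont f ->
  (forall y, enorm (y - x) <= 3 * rho * (size s)%:R -> c <= f y) -> c <= smooth rho s f x.
Proof.
move=> r0; elim: s f x => [|i s ih] f x uf hf /=; first by apply: hf; rewrite subrr enorm0 mulr0.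
apply: ih; first exact: savg3_ucont.
move=> y yx; apply: savg3_ge => // z; rewrite enormZ enorm_ebasis mulr1 ger0_norm // => zy.
apply: hf; rewrite -(subrKA y) (le_trans (enormD _ _)) //=.
by rewrite -(natr1 (size s)) mulrDr mulr1 addrC lerD.
Qed.

(** The part of [xi] in the coordinates listed in [s], those in which a partial smoothing can be
    expanded; for the full enumeration it is [xi] itself. *)
Fixpoint lsum s xi : 'rV[R]_n := if s is i :: s' then xi ord0 i *: ebasis i + lsum s' xi else 0.

Lemma enorm_le_bound (g0 : 'rV[R]_n) (b : R) : (forall k, `|g0 ord0 k| <= b) -> enorm g0 <= n%:R * b.
Proof.
move=> h; rewrite (le_trans (enorm_le_sum _)) // (le_trans (ler_sum _ (fun i _ => h i))) //.
by rewrite sumr_const card_ord mulr_natl.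
Qed.

Lemma sumnorm_le_bound (X : 'M[R]_n) (b : R) : (forall k l, `|X k l| <= b) -> sumnorm X <= (n * n)%:R * b.
Proof.
move=> h; rewrite (@le_trans _ _ (\sum_(i < n) \sum_(j < n) b)) //.
  by apply: ler_sum => i _; apply: ler_sum => j _.
by rewrite !sumr_const card_ord -mulrnA mulr_natl.
Qed.

Lemma coord_ebasis_le (i k : 'I_n) : `|(ebasis i : 'rV[R]_n) ord0 k| <= 1.
Proof. by rewrite (le_trans (coord_le_enorm _ _)) // enorm_ebasis. Qed.

Lemma outer_entry v h (k l : 'I_n) : (v^T *m h) k l = v ord0 k * h ord0 l.
Proof. by rewrite mxE big_ord1 mxE. Qed.

Lemma qf_outer2 v h xi : qf (v^T *m h) xi = dot xi v * dot h xi.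
Proof.
have -> : qf (v^T *m h) xi = dot (dot xi v *: h) xi; last by rewrite dotZl.
rewrite qfE mulmxA (_ : xi *m v^T = (dot xi v)%:M) ?mul_scalar_mx//.
by apply/rowP => i; rewrite !mxE !ord1 eqxx mulr1n; apply: eq_bigr => j _; rewrite mxE.
Qed.

Lemma ucont_remainder (f0 f1 f2 : 'rV[R]_n -> R) (a b : R) h : ucont f0 -> ucont f1 -> ucont f2 ->
  ucont (fun z => f0 (z + h) - f0 z - a * f1 z - b * f2 z).
Proof.
move=> u0 u1 u2.
have := ucont_lin 1 1 (ucont_lin 1 (-1) (ucont_shift h u0) u0) (ucont_lin (- a) (- b) u1 u2).
by congr ucont; apply/funext => z; ring.
Qed.

(** Linearity and commutation with shifts carry an expansion of [f0] over to its smoothing, with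
    smoothed coefficients and smoothed remainder. *)
Lemma smooth_taylor rho s (f0 f1 f2 : 'rV[R]_n -> R) (a b : R) h y : ucont f0 -> ucont f1 -> ucont f2 ->
  smooth rho s f0 (y + h) = smooth rho s f0 y + a * smooth rho s f1 y + b * smooth rho s f2 y
    + smooth rho s (fun z => f0 (z + h) - f0 z - a * f1 z - b * f2 z) y.
Proof.
move=> u0 u1 u2; have := ucont_remainder a b h u0 u1 u2; set Rr := (X in ucont X) => uR.
have -> : smooth rho s f0 (y + h) = smooth rho s (fun z => f0 (z + h)) y.
  by rewrite (smooth_shift rho s f0 h).
have -> : (fun z => f0 (z + h)) = (fun z => 1 * (1 * f0 z + a * f1 z) + 1 * (b * f2 z + 1 * Rr z)).
  by apply/funext => z; rewrite /Rr; ring.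
rewrite (smooth_lin rho s 1 1 (ucont_lin 1 a u0 u1) (ucont_lin b 1 u2 uR)).
by rewrite (smooth_lin rho s 1 a u0 u1) (smooth_lin rho s b 1 u2 uR); ring.
Qed.

(** Induction on the list. Expanding in the first coordinate yields the coefficients [savg3],
    [savg3_d1] and [savg3_d2], again uniformly continuous and bounded by multiples of [M]; each is
    then expanded in the remaining coordinates. This requires a bound linear in [M] and uniform in
    [f]. *)
Lemma smooth_expand rho s : 0 < rho -> exists2 C : R, 0 <= C & forall f M, ucont f -> bounded_by M f ->
  forall x, exists (g0 : 'rV[R]_n) (X : 'M[R]_n), [/\ forall k, `|g0 ord0 k| <= C * M, forall k l, `|X k l| <= C * M &
    forall xi, enorm xi <= 1 ->
    `|smooth rho s f (x + lsum s xi) - smooth rho s f x - dot g0 xi - 1/2 * qf X xi|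
      <= C * M * enorm xi ^+ 3].
Proof.
move=> r0; elim: s => [|i s [C C0 ih]].
  exists 0 => // f M _ _ x; exists 0, 0; split=> [k|k l|xi _].
  - by rewrite mxE normr0 mul0r.
  - by rewrite mxE normr0 mul0r.
  - by rewrite /= addr0 subrr dot0l qfE mulmx0 dot0l !subr0 mulr0 subr0 normr0 !mul0r.
set a := rho^-1; have a0 : 0 < a by rewrite invr_gt0.
set N := n%:R : R; have N0 : 0 <= N by rewrite /N.
(* Each derivative in direction [i] brings one factor [a], the inverse of the step; the sum collects
   crude bounds for all products of the two expansions. *)
pose C' := C + a * (2 * C * N ^+ 2 + 2 * C) + a ^+ 2 * (4 * C * N + 4 * C * N ^+ 2 + 4 * C) + 8 * a ^+ 3
  + 2 * a + 4 * a * C + 4 * a ^+ 2.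
exists C'; first by rewrite /C' !addr_ge0 ?mulr_ge0 ?exprn_ge0 ?addr_ge0 ?mulr_ge0 ?exprn_ge0 // ?(ltW a0).
move=> f M uf bf x.
have M0 : 0 <= M by exact: le_trans (bf 0).
set v := rho *: ebasis i.
have u1 := savg_ucont v uf; have u2 := savg_ucont v u1.
have U0 : ucont (savg3 v f) by exact: savg3_ucont.
have U1 : ucont (savg3_d1 v f) by exact: fdiff_ucont.
have U2 : ucont (savg3_d2 v f) by do 2!apply: fdiff_ucont.
have B0 : bounded_by M (savg3 v f) by exact: savg3_bounded.
have b1 := savg_bounded v uf bf; have b2 := savg_bounded v u1 b1.
have B1 : bounded_by (2 * M) (savg3_d1 v f) by exact: fdiff_bounded.
have B2 : bounded_by (2 * (2 * M)) (savg3_d2 v f) by do 2!apply: fdiff_bounded.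
have [g0 [X0 [gb0 Xb0 E0]]] := ih _ _ U0 B0 x.
have [g1 [X1 [gb1 Xb1 E1]]] := ih _ _ U1 B1 x.
have [g2 [X2 [gb2 Xb2 E2]]] := ih _ _ U2 B2 x.
have s1 := smooth_bounded rho s U1 B1 x.
have s2 := smooth_bounded rho s U2 B2 x.
set t1 := smooth rho s _ x in s1 E1; set t2 := smooth rho s _ x in s2 E2.
have CM : 0 <= C * M by rewrite mulr_ge0.
have aCM : 0 <= a * (C * M) by rewrite mulr_ge0 // ltW.
have aM : 0 <= a * M by rewrite mulr_ge0 // ltW.
have a2M : 0 <= a ^+ 2 * M by rewrite mulr_ge0 ?sqr_ge0.
have a3M : 0 <= a ^+ 3 * M by rewrite mulr_ge0 ?exprn_ge0 // ltW.
have a2CM : 0 <= a ^+ 2 * (C * M) by rewrite mulr_ge0 ?sqr_ge0.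
have N2 : 0 <= N ^+ 2 by rewrite sqr_ge0.
(* The mixed term [a * xi ord0 i * dot g1 xi] is the quadratic form of [a *: ((ebasis i)^T *m g1)],
   in general not symmetric; [smoothing_jet] symmetrizes the result. *)
exists (g0 + (a * t1) *: ebasis i),
  (X0 + (2 * a) *: ((ebasis i)^T *m g1) + (a ^+ 2 * t2) *: ((ebasis i)^T *m ebasis i)).
have P1 := mulr_ge0 N0 a2CM; have P2 := mulr_ge0 N2 a2CM; have P3 := mulr_ge0 N2 aCM.
split=> [k|k l|xi xi1].
- have -> : (g0 + (a * t1) *: ebasis i) ord0 k = g0 ord0 k + a * t1 * ebasis i ord0 k by rewrite mxE [X in _ + X]mxE.
  rewrite (le_trans (ler_normD _ _)) //.
  have h1 : `|a * t1 * ebasis i ord0 k| <= a * (2 * M) * 1.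
    by rewrite !normrM (gtr0_norm a0); apply: ler_pM; rewrite ?mulr_ge0 ?(ltW a0) ?coord_ebasis_le // ler_wpM2l // ltW.
  rewrite (le_trans (lerD (gb0 k) h1)) // /C'; lra.
- have -> : (X0 + (2 * a) *: ((ebasis i)^T *m g1) + (a ^+ 2 * t2) *: ((ebasis i)^T *m ebasis i)) k l =
      X0 k l + 2 * a * (ebasis i ord0 k * g1 ord0 l) + a ^+ 2 * t2 * (ebasis i ord0 k * ebasis i ord0 l).
    rewrite mxE [X in X + _]mxE [X in _ + X + _]mxE [X in _ + X]mxE.
    by rewrite (outer_entry (ebasis i) g1) (outer_entry (ebasis i) (ebasis i)).
  have e1 := coord_ebasis_le i k; have e2 := coord_ebasis_le i l.
  have h1 : `|2 * a * (ebasis i ord0 k * g1 ord0 l)| <= 2 * a * (1 * (C * (2 * M))).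
    by rewrite normrM (normrM (ebasis i ord0 k)) gtr0_norm ?mulr_gt0 // ler_pM2l ?mulr_gt0 // ler_pM.
  have h2 : `|a ^+ 2 * t2 * (ebasis i ord0 k * ebasis i ord0 l)| <= a ^+ 2 * (2 * (2 * M)) * (1 * 1).
    rewrite normrM (normrM (ebasis i ord0 k)) (normrM (a ^+ 2)) ger0_norm ?sqr_ge0 //.
    apply: ler_pM; [by rewrite mulr_ge0 ?sqr_ge0 | by rewrite mulr_ge0 | by rewrite ler_wpM2l ?sqr_ge0 |].
    exact: ler_pM.
  rewrite (le_trans (ler_normD _ _)) // (le_trans (lerD (ler_normD _ _) (lexx _))) //.
  by rewrite (le_trans (lerD (lerD (Xb0 k l) h1) h2)) // /C'; lra.
have w0 := enorm_ge0 xi; set w := enorm xi in xi1 w0 *.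
set r := xi ord0 i * a.
have rv : xi ord0 i *: ebasis i = r *: v by rewrite /r /v scalerA -mulrA mulVf ?mulr1 // gt_eqF.
have rw : `|r| <= a * w.
  by rewrite /r normrM mulrC (gtr0_norm a0) ler_pM2l // coord_le_enorm.
set y := x + lsum s xi.
pose Rr z := savg3 v f (z + r *: v) - savg3 v f z - r * savg3_d1 v f z - 1/2 * r ^+ 2 * savg3_d2 v f z.
have UR : ucont Rr by exact: ucont_remainder.
have BR : bounded_by (8 * M * `|r| ^+ 3) Rr by move=> z; exact: savg3_expand.
have E : smooth rho (i :: s) f (x + lsum (i :: s) xi) =
   smooth rho s (savg3 v f) y + r * smooth rho s (savg3_d1 v f) y
   + 1/2 * r ^+ 2 * smooth rho s (savg3_d2 v f) y + smooth rho s Rr y.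
  rewrite [lsum _ _]/= rv (addrC (r *: v)) addrA -/y.
  exact: (@smooth_taylor rho s (savg3 v f) (savg3_d1 v f) (savg3_d2 v f) r (1/2 * r ^+ 2) (r *: v) y U0 U1 U2).
rewrite E; clear E.
have {}E0 := E0 xi xi1; have {}E1 := E1 xi xi1; have {}E2 := E2 xi xi1.
have E3 := smooth_bounded rho s UR BR y.
rewrite -/y -/w in E0 E1 E2.
set A0 := smooth rho s _ y in E0 *; set A1 := smooth rho s _ y in E1 *.
set A2 := smooth rho s _ y in E2 *; set A3 := smooth rho s _ y in E3 *.
set t0 := smooth rho s _ x in E0.
rewrite [smooth rho (i :: s) f x]/= -/t0.
have w2 : w ^+ 2 <= w by rewrite expr2 ler_piMl.
have w3 : w ^+ 3 <= w ^+ 2 by rewrite exprS ler_piMl ?sqr_ge0.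
have w20 := sqr_ge0 w; have w30 : 0 <= w ^+ 3 by rewrite exprn_ge0.
have dot_bd (g3 : 'rV[R]_n) b : (forall k, `|g3 ord0 k| <= b) -> `|dot g3 xi| <= N * b * w.
  by move=> hb; rewrite (le_trans (norm_dot_le _ _)) // ler_wpM2r // enorm_le_bound.
have qf_bd (X3 : 'M[R]_n) b : (forall k l, `|X3 k l| <= b) -> `|qf X3 xi| <= N ^+ 2 * b * w ^+ 2.
  move=> hb; rewrite (le_trans (norm_qf_le _ _)) // ler_wpM2r // (le_trans (sumnorm_le_bound hb)) //.
  by rewrite natrM.
have q1 := qf_bd _ _ Xb1; have q2 := qf_bd _ _ Xb2; have p2 := dot_bd _ _ gb2.
have F1 : `|A1 - t1 - dot g1 xi| <= (N ^+ 2 * (C * M) + 2 * (C * M)) * w ^+ 2.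
  have -> : A1 - t1 - dot g1 xi = (A1 - t1 - dot g1 xi - 1/2 * qf X1 xi) + 1/2 * qf X1 xi by ring.
  rewrite (le_trans (ler_normD _ _)) // (le_trans (lerD E1 (lexx _))) // normrM ger0_norm //.
  have : C * M * w ^+ 3 <= C * M * w ^+ 2 by rewrite ler_wpM2l.
  by lra.
have F2 : `|A2 - t2| <= (4 * (N * (C * M)) + 2 * (N ^+ 2 * (C * M)) + 4 * (C * M)) * w.
  have -> : A2 - t2 = (A2 - t2 - dot g2 xi - 1/2 * qf X2 xi) + dot g2 xi + 1/2 * qf X2 xi by ring.
  rewrite (le_trans (ler_normD _ _)) // (le_trans (lerD (ler_normD _ _) (lexx _))) //.
  rewrite (le_trans (lerD (lerD E2 p2) (lexx _))) // normrM ger0_norm //.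
  have : C * M * w ^+ 3 <= C * M * w by rewrite ler_wpM2l // (le_trans w3).
  have : N ^+ 2 * (C * M) * w ^+ 2 <= N ^+ 2 * (C * M) * w by rewrite ler_wpM2l // mulr_ge0.
  by lra.
have r2 : r ^+ 2 <= (a * w) ^+ 2 by rewrite -(real_normK (num_real r)) ler_pXn2r ?nnegrE // mulr_ge0 // ltW.
have r3 : `|r| ^+ 3 <= (a * w) ^+ 3 by rewrite ler_pXn2r ?nnegrE // mulr_ge0 // ltW.
have F1' : `|r * (A1 - t1 - dot g1 xi)| <= (a * w) * ((N ^+ 2 * (C * M) + 2 * (C * M)) * w ^+ 2).
  by rewrite normrM ler_pM.
have F2' : `|r ^+ 2 * (A2 - t2)| <= (a * w) ^+ 2 * ((4 * (N * (C * M)) + 2 * (N ^+ 2 * (C * M)) + 4 * (C * M)) * w).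
  by rewrite normrM (ger0_norm (sqr_ge0 r)) ler_pM // sqr_ge0.
have E3' : `|A3| <= 8 * M * (a * w) ^+ 3.
  by rewrite (le_trans E3) // ler_wpM2l // mulr_ge0.
have -> : A0 + r * A1 + 1 / 2 * r ^+ 2 * A2 + A3 - t0 - dot (g0 + (a * t1) *: ebasis i) xi -
   1 / 2 * qf (X0 + (2 * a) *: ((ebasis i)^T *m g1) + (a ^+ 2 * t2) *: ((ebasis i)^T *m ebasis i)) xi =
   (A0 - t0 - dot g0 xi - 1/2 * qf X0 xi) + r * (A1 - t1 - dot g1 xi) + 1/2 * (r ^+ 2 * (A2 - t2)) + A3.
  rewrite dotDl dotZl !qfDl !qfZl !qf_outer2 (dotC (ebasis i)) dot_ebasis /r.
  by field.
rewrite (le_trans (ler_normD _ _)) // (le_trans (lerD (ler_normD _ _) (lexx _))) //.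
rewrite (le_trans (lerD (lerD (ler_normD _ _) (lexx _)) (lexx _))) //.
rewrite (normrM (1/2)) (ger0_norm (_ : 0 <= 1/2)) //.
rewrite (@le_trans _ _ (C * M * w ^+ 3 + (a * w) * ((N ^+ 2 * (C * M) + 2 * (C * M)) * w ^+ 2) +
  1/2 * ((a * w) ^+ 2 * ((4 * (N * (C * M)) + 2 * (N ^+ 2 * (C * M)) + 4 * (C * M)) * w)) + 8 * M * (a * w) ^+ 3)) //.
  by rewrite !lerD // ler_pM2l.
rewrite /C' -subr_ge0.
set L := (X in 0 <= X).
have -> : L = (a * (C * M) * N ^+ 2 + a ^+ 2 * (C * M) * (2 * N + 3 * N ^+ 2 + 2) + 2 * (a * M)
   + 4 * (a * (C * M)) + 4 * (a ^+ 2 * M)) * w ^+ 3 by rewrite /L; field.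
by rewrite mulr_ge0 // !addr_ge0 ?mulr_ge0 ?addr_ge0 ?mulr_ge0 ?sqr_ge0 // ?(ltW a0).
Qed.

Lemma lsum_enum xi : lsum (enum 'I_n) xi = xi.
Proof.
rewrite {2}(row_sum_delta xi) -big_enum /=.
by elim: (enum 'I_n) => [|i s ih]; rewrite ?big_nil ?big_cons //= ih.
Qed.

Definition smoothing rho := smooth rho (enum 'I_n).

Lemma smoothing_jet rho f M x : 0 < rho -> ucont f -> bounded_by M f ->
  exists (g0 : 'rV[R]_n) X, symmx X /\ jet2 (smoothing rho f) x g0 X.
Proof.
move=> r0 uf bf; have [C C0 h] := smooth_expand (enum 'I_n) r0.
have [g0 [X [_ _ E]]] := h f M uf bf x.
exists g0, (1/2 *: (X + X^T)); split.
  by rewrite /symmx /= linearZ /= linearD /= trmxK addrC.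
apply: (@jet2_cube _ _ _ _ _ _ (C * M) 1) => // xi xi1.
have -> : qf (1 / 2 *: (X + X^T)) xi = qf X xi.
  have -> : qf (1 / 2 *: (X + X^T)) xi = 1/2 * (qf X xi + qf X^T xi) by rewrite qfZl qfDl.
  have -> : qf X^T xi = qf X xi.
    have tr : xi *m X^T *m xi^T = (xi *m X *m xi^T)^T by rewrite !trmx_mul trmxK mulmxA.
    by rewrite /qf tr mxE.
  by field.
by have := E xi (ltW xi1); rewrite lsum_enum.
Qed.

End SmoothingOperator.

(** * Trigonometric polynomials and the resolvent of A : D^2 *)

Section Trigonometric.
Context {R : realType} {n : nat}.
Implicit Types (f : 'rV[R]_n -> R) (x xi k : 'rV[R]_n) (A N : 'M[R]_n) (a th tau : R).

(* Third order Taylor remainder, uniform over the whole space. *)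
Record tame f (g : 'rV[R]_n -> 'rV[R]_n) (X : 'rV[R]_n -> 'M[R]_n) : Prop := Tame {
  tame_f : ucont f /\ exists M, bounded_by M f;
  tame_g : forall i, ucont (fun x => g x ord0 i) /\ exists M, bounded_by M (fun x => g x ord0 i);
  tame_X : forall i j, ucont (fun x => X x i j) /\ exists M, bounded_by M (fun x => X x i j);
  tame_sym : forall x, symmx (X x);
  tame_rem : exists C : R, forall x xi,
    `|f (x + xi) - f x - dot (g x) xi - 1/2 * qf (X x) xi| <= C * enorm xi ^+ 3 }.

Lemma ucont_bounded_add f1 f2 :
  (ucont f1 /\ exists M, bounded_by M f1) -> (ucont f2 /\ exists M, bounded_by M f2) ->
  ucont (fun x => f1 x + f2 x) /\ exists M, bounded_by M (fun x => f1 x + f2 x).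
Proof.
move=> [u1 [M1 b1]] [u2 [M2 b2]]; split.
  by have := ucont_lin 1 1 u1 u2; congr ucont; apply/funext => x; rewrite !mul1r.
by exists (M1 + M2) => x; rewrite (le_trans (ler_normD _ _)) // lerD.
Qed.

Lemma tame_add f1 f2 g1 g2 X1 X2 : tame f1 g1 X1 -> tame f2 g2 X2 ->
  tame (fun x => f1 x + f2 x) (fun x => g1 x + g2 x) (fun x => X1 x + X2 x).
Proof.
move=> [a1 b1 c1 d1 [C1 e1]] [a2 b2 c2 d2 [C2 e2]]; split.
- exact: ucont_bounded_add.
- move=> i; have := ucont_bounded_add (b1 i) (b2 i).
  by have -> : (fun x => g1 x ord0 i + g2 x ord0 i) = (fun x => (g1 x + g2 x) ord0 i)
    by apply/funext => x; rewrite mxE.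
- move=> i j; have := ucont_bounded_add (c1 i j) (c2 i j).
  by have -> : (fun x => X1 x i j + X2 x i j) = (fun x => (X1 x + X2 x) i j)
    by apply/funext => x; rewrite mxE.
- by move=> x; exact: symmxD.
- exists (C1 + C2) => x xi; rewrite mulrDl dotDl qfDl (le_trans _ (lerD (e1 x xi) (e2 x xi))) //.
  rewrite (le_trans _ (ler_normD _ _)) // le_eqVlt; apply/orP; left; apply/eqP; congr (`|_|); ring.
Qed.

Lemma is_derive_cosD a th (s : R) : is_derive s (1:R) (fun t => a * cos (th + t)) (a * - sin (th + s)).
Proof.
have d : is_derive (th + s) (1:R) cos (- sin (th + s)) by exact: is_derive_cos.
have := is_derive_mul (is_derive_const a s) (is_derive_translate d).
by move=> h; apply: is_derive_eqval h _; ring.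
Qed.

Lemma is_derive_sinD a th (s : R) : is_derive s (1:R) (fun t => a * sin (th + t)) (a * cos (th + s)).
Proof.
have d : is_derive (th + s) (1:R) sin (cos (th + s)) by exact: is_derive_sin.
have := is_derive_mul (is_derive_const a s) (is_derive_translate d).
by move=> h; apply: is_derive_eqval h _; ring.
Qed.

Lemma norm_sin_le1 (s : R) : `|sin s| <= 1.
Proof. by rewrite ler_norml sin_geN1 sin_le1. Qed.

Lemma norm_cos_le1 (s : R) : `|cos s| <= 1.
Proof. by rewrite ler_norml cos_geN1 cos_le1. Qed.

Lemma norm_sinB (s t : R) : `|sin s - sin t| <= `|s - t|.
Proof.
have := @mvt_bound R (fun r => 1 * sin (t + r)) (fun r => 1 * cos (t + r)) (s - t) 1
  (is_derive_sinD 1 t).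
by rewrite !mul1r addr0 addrCA subrr addr0; apply=> r _; rewrite mul1r; exact: norm_cos_le1.
Qed.

Lemma norm_cosB (s t : R) : `|cos s - cos t| <= `|s - t|.
Proof. by rewrite -!sinDpihalf (le_trans (norm_sinB _ _)) // opprD addrACA subrr addr0. Qed.

Lemma cos_expand (t d : R) : `|cos (t + d) - cos t + d * sin t + 1/2 * d ^+ 2 * cos t| <= `|d| ^+ 3.
Proof.
have -> : cos (t + d) - cos t + d * sin t + 1 / 2 * d ^+ 2 * cos t =
  1 * cos (t + d) - 1 * cos (t + 0) - d * (1 * - sin (t + 0)) - 1/2 * d ^+ 2 * (-1 * cos (t + 0)).
  by rewrite addr0; ring.
rewrite -[leRHS]mul1r.
apply: (@taylor3_bound R (fun s => 1 * cos (t + s)) (fun s => 1 * - sin (t + s))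
  (fun s => -1 * cos (t + s)) (fun s => -1 * - sin (t + s)) 1 d) => s.
- exact: is_derive_cosD.
- have := is_derive_sinD (-1) t s.
  have -> : (fun t0 => -1 * sin (t + t0)) = (fun t0 => 1 * - sin (t + t0)) by apply/funext => r; ring.
  by [].
- exact: is_derive_cosD.
- by rewrite mulN1r opprK; exact: norm_sin_le1.
Qed.

Lemma ucont_wave (phi : R -> R) k th b : (forall s t, `|phi s - phi t| <= `|s - t|) ->
  (forall s, `|phi s| <= 1) ->
  ucont (fun x => b * phi (dot k x + th)) /\ exists M, bounded_by M (fun x => b * phi (dot k x + th)).
Proof.
move=> lip bd; split; last by exists `|b| => x; rewrite normrM ler_piMr.
move=> q q0; set c := `|b| * enorm k + 1.
have c0 : 0 < c by rewrite /c ltr_wpDl // mulr_ge0 ?enorm_ge0.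
exists (q / c) => [|x y]; first by rewrite divr_gt0.
rewrite ltr_pdivlMr // => xy; rewrite -mulrBr normrM.
rewrite (le_trans (ler_wpM2l (normr_ge0 b) (lip _ _))) //.
rewrite opprD addrACA subrr addr0 -dotBr.
rewrite (le_trans (ler_wpM2l (normr_ge0 b) (norm_dot_le _ _))) // (le_trans _ (ltW xy)) //.
by rewrite mulrA mulrC ler_wpM2l ?enorm_ge0 // /c lerDl.
Qed.

Lemma tame_cos a k th : tame (fun x => a * cos (dot k x + th))
  (fun x => (- a * sin (dot k x + th)) *: k) (fun x => (- a * cos (dot k x + th)) *: (k^T *m k)).
Proof.
split.
- exact: ucont_wave norm_cosB norm_cos_le1.
- move=> i; have := ucont_wave k th (- a * k ord0 i) norm_sinB norm_sin_le1.
  have -> // : (fun x => - a * k ord0 i * sin (dot k x + th)) =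
     (fun x => ((- a * sin (dot k x + th)) *: k) ord0 i).
  by apply/funext => x; rewrite mxE; ring.
- move=> i j; have := ucont_wave k th (- a * (k^T *m k) i j) norm_cosB norm_cos_le1.
  have -> // : (fun x => - a * (k^T *m k) i j * cos (dot k x + th)) =
     (fun x => ((- a * cos (dot k x + th)) *: (k^T *m k)) i j).
  by apply/funext => x; rewrite [RHS]mxE; ring.
- by move=> x; apply: symmxZ; exact: trmx_outer.
exists (`|a| * enorm k ^+ 3) => x xi.
have -> : a * cos (dot k (x + xi) + th) - a * cos (dot k x + th) -
    dot ((- a * sin (dot k x + th)) *: k) xi - 1 / 2 * qf ((- a * cos (dot k x + th)) *: (k^T *m k)) xi
  = a * (cos (dot k x + th + dot k xi) - cos (dot k x + th) + dot k xi * sin (dot k x + th)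
     + 1/2 * dot k xi ^+ 2 * cos (dot k x + th)).
  by rewrite dotDr (addrAC (dot k x)) dotZl qfZl qf_outer (dotC xi); ring.
rewrite normrM -[leRHS]mulrA ler_wpM2l // (le_trans (cos_expand _ _)) // -exprMn.
by rewrite ler_pXn2r ?nnegrE ?mulr_ge0 ?enorm_ge0 // norm_dot_le.
Qed.

Inductive trig : ('rV[R]_n -> R) -> Prop :=
| trig_cos a k th : trig (fun x => a * cos (dot k x + th))
| trig_add f1 f2 : trig f1 -> trig f2 -> trig (fun x => f1 x + f2 x).

(** A cosine of frequency [k] is an eigenfunction of A : D^2 with eigenvalue [- qf A k <= 0], so the
    resolvent divides its amplitude by [1 + tau * qf A k >= 1]. *)
Lemma trig_resolvent A tau f : 0 < tau -> (forall N, symmx N -> psd N -> 0 <= mdot A N) -> trig f ->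
  exists H g X, tame H g X /\ forall x, H x - tau * mdot A (X x) = f x.
Proof.
move=> t0 hA; elim=> [a k th|f1 f2 _ [H1 [g1 [X1 [h1 e1]]]] _ [H2 [g2 [X2 [h2 e2]]]]].
  have qA : 0 <= qf A k by rewrite -mdot_outer; apply: hA; [exact: trmx_outer | exact: psd_outer].
  have p : 0 < 1 + tau * qf A k by rewrite ltr_wpDr // mulr_ge0 // ltW.
  eexists; eexists; eexists; split; first exact: (tame_cos (a / (1 + tau * qf A k)) k th).
  by move=> x; rewrite mdotZr mdot_outer; field; rewrite gt_eqF.
eexists; eexists; eexists; split; first exact: tame_add h1 h2.
by move=> x; rewrite mdotDr -e1 -e2; ring.
Qed.

(** For [A = 0] the resolvent is the identity, which exhibits [f] itself as tame. *)
Lemma trig_tame f : trig f -> exists g X, tame f g X.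
Proof.
move=> hf; have [|H [g [X [h e]]]] := @trig_resolvent 0 1 f ltr01 _ hf.
  by move=> N _ _; rewrite mdotC mdot0r.
exists g, X; have -> // : f = H by apply/funext => x; rewrite -e mdotC mdot0r mulr0 subr0.
Qed.

Lemma trig_scale c f : trig f -> trig (fun x => c * f x).
Proof.
elim=> [a k th|f1 f2 _ h1 _ h2].
  by have := trig_cos (c * a) k th; congr trig; apply/funext => x; rewrite mulrA.
by have := trig_add h1 h2; congr trig; apply/funext => x; rewrite mulrDr.
Qed.

Lemma trig_const (c : R) : trig (fun=> c).
Proof. by have := trig_cos c 0 0; congr trig; apply/funext => x; rewrite dot0l addr0 cos0 mulr1. Qed.

(** The product-to-sum formula, with sines written as cosines of phase [- pi / 2]. *)
Lemma trig_sin_mul i f : trig f -> trig (fun x => sin (x ord0 i) * f x).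
Proof.
elim=> [a k th|f1 f2 _ h1 _ h2]; last first.
  by have := trig_add h1 h2; congr trig; apply/funext => x; rewrite mulrDr.
have := trig_add (trig_cos (a / 2) (k + ebasis i) (th - pi / 2)) (trig_cos (- a / 2) (k - ebasis i) (th - pi / 2)).
congr trig; apply/funext => x; rewrite dotDl dotBl (dotC (ebasis i)) dot_ebasis.
set s := dot k x + th; set t := x ord0 i.
have -> : dot k x + t + (th - pi / 2) = s + t - pi / 2 by rewrite /s; ring.
have -> : dot k x - t + (th - pi / 2) = s - t - pi / 2 by rewrite /s; ring.
by rewrite !cosBpihalf sinD sinB; field.
Qed.

End Trigonometric.

(** * Bernstein approximation by trigonometric polynomials *)

Section BernsteinWalk.
Context {R : realType} {n : nat}.
Implicit Types (y c w : 'rV[R]_n) (phi psi : 'rV[R]_n -> R) (L : seq 'I_n) (s : R).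

(* Expectation of phi at the end of a walk from 0 which, for each i in L, independently
   moves by s e_i with probability y_i; for s = 1/m and m copies of each i this is the
   Bernstein polynomial of phi. *)
Fixpoint walk s y L phi : R :=
  if L is i :: L' then
    walk s y L' (fun w => y ord0 i * phi (w + s *: ebasis i) + (1 - y ord0 i) * phi w)
  else phi 0.

Lemma walk_lin s y L a b phi psi :
  walk s y L (fun w => a * phi w + b * psi w) = a * walk s y L phi + b * walk s y L psi.
Proof.
elim: L phi psi => //= i L ih phi psi; rewrite -ih; congr walk.
by apply/funext => w; ring.
Qed.

Lemma walk_cst s y L (a : R) : walk s y L (fun=> a) = a.
Proof.
elim: L => //= i L ih; rewrite -[RHS]ih; congr walk; apply/funext => w; ring.
Qed.

Lemma walk_le s y L phi psi : (forall i, 0 <= y ord0 i <= 1) -> (forall w, phi w <= psi w) ->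
  walk s y L phi <= walk s y L psi.
Proof.
move=> hy; elim: L phi psi => [|i L ih] phi psi h //=; apply: ih => w.
have /andP[y0 y1] := hy i.
by rewrite lerD // ler_wpM2l // subr_ge0.
Qed.

(** Squared bias plus variance. Averaging over one step moves the centre back by the mean of that
    step and adds its variance [b], which is why the centre [c] is general. *)
Lemma walk_sqr s y L c : walk s y L (fun w => enorm (w - c) ^+ 2) =
  enorm (s *: lsum L y - c) ^+ 2 + s ^+ 2 * \sum_(i <- L) y ord0 i * (1 - y ord0 i).
Proof.
elim: L c => [|i L ih] c /=; first by rewrite big_nil mulr0 addr0 scaler0.
pose b := s ^+ 2 * (y ord0 i * (1 - y ord0 i)).
have -> : (fun w => y ord0 i * enorm (w + s *: ebasis i - c) ^+ 2 + (1 - y ord0 i) * enorm (w - c) ^+ 2) =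
   (fun w => 1 * enorm (w - (c - (s * y ord0 i) *: ebasis i)) ^+ 2 + 1 * b).
  apply/funext => w.
  have -> : w + s *: ebasis i - c = (w - c) + s *: ebasis i by rewrite addrAC.
  have -> : w - (c - (s * y ord0 i) *: ebasis i) = (w - c) + (s * y ord0 i) *: ebasis i by rewrite opprB addrA addrAC.
  move: (w - c) => z; rewrite !enorm_sqr !dotDl !dotDr !dotZl !dotZr (dotC (ebasis i) z) dot_ebasis.
  have -> : dot (ebasis i) (ebasis i) = 1 :> R by rewrite -enorm_sqr enorm_ebasis expr1n.
  by rewrite /b; ring.
rewrite (walk_lin s y L 1 1 _ (fun=> b)) walk_cst ih big_cons.
have -> : s *: lsum L y - (c - (s * y ord0 i) *: ebasis i) = s *: (y ord0 i *: ebasis i + lsum L y) - c.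
  by apply/rowP => j; rewrite !mxE; ring.
by rewrite /b; ring.
Qed.

Lemma lsum_cat L1 L2 y : lsum (L1 ++ L2) y = lsum L1 y + lsum L2 y.
Proof. by elim: L1 => [|i L ih] /=; rewrite ?add0r // ih addrA. Qed.

Lemma lsum_copies m y : lsum (flatten (nseq m (enum 'I_n))) y = m%:R *: y.
Proof.
elim: m => [|m ih] /=; first by rewrite scale0r.
by rewrite lsum_cat ih lsum_enum -natr1 scalerDl scale1r addrC.
Qed.

Lemma size_copies m : size (flatten (nseq m (enum 'I_n))) = (m * n)%N.
Proof. by elim: m => //= m ih; rewrite size_cat ih size_enum_ord mulSn. Qed.

(** Bernstein's argument: the modulus of continuity is used within distance [d], the bound
    [2 * M <= K * enorm (w - y) ^+ 2] beyond it, and the resulting inequality [P] is averaged over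
    the walk as in Chebyshev's inequality. *)
Lemma walk_approx phi M q : ucont phi -> bounded_by M phi -> 0 < q ->
  exists s L, forall y, (forall i, 0 <= y ord0 i <= 1) -> `|walk s y L phi - phi y| <= q.
Proof.
move=> uphi bphi q0.
have M0 : 0 <= M by exact: le_trans (bphi 0).
have q2 : 0 < q / 2 by rewrite divr_gt0.
have [d d0 D] := uphi _ q2.
pose K := 2 * M / d ^+ 2.
have K0 : 0 <= K by apply: divr_ge0; [exact: mulr_ge0 | exact: sqr_ge0].
(* Each coordinate has variance at most 1/(4 m), so the second moment is at most n/(4 m), and
   [m > K * n / q] makes [K] times it at most [q / 4]. *)
pose m := (Num.truncn (K * n%:R / q)).+1.
have hm : K * n%:R / q < m%:R by rewrite /m truncnS_gt.
have m0 : 0 < m%:R :> R by [].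
exists (m%:R^-1), (flatten (nseq m (enum 'I_n))) => y hy.
set L := flatten _; set s := m%:R^-1.
have V : walk s y L (fun w => enorm (w - y) ^+ 2) <= n%:R / (4 * m%:R).
  rewrite walk_sqr lsum_copies scalerA mulVf ?gt_eqF // scale1r subrr enorm0 expr0n add0r.
  rewrite (@le_trans _ _ (s ^+ 2 * ((m * n)%:R * (1/4)))) //.
    rewrite ler_wpM2l ?sqr_ge0 // -(size_copies m) -/L.
    elim: L => [|i L ih]; first by rewrite big_nil mul0r.
    have h : y ord0 i * (1 - y ord0 i) <= 1/4 by have := sqr_ge0 (y ord0 i - 1/2); lra.
    by rewrite big_cons /= -natr1; lra.
  by rewrite natrM /s le_eqVlt; apply/orP; left; apply/eqP; field; rewrite gt_eqF.
have P w : `|phi w - phi y| <= q / 2 + K * enorm (w - y) ^+ 2.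
  have [wy|wy] := ltP (enorm (w - y)) d.
    by rewrite (le_trans (D _ _ wy)) // lerDl mulr_ge0 ?sqr_ge0.
  have h1 : `|phi w - phi y| <= 2 * M.
    by rewrite (le_trans (ler_normB _ _)) // mulr_natl mulr2n lerD.
  rewrite (le_trans h1) // (@le_trans _ _ (K * enorm (w - y) ^+ 2)) ?lerDr ?(ltW q2) //.
  rewrite /K mulrAC ler_pdivlMr ?exprn_gt0 // ler_wpM2l ?mulr_ge0 //.
  by rewrite ler_pXn2r ?nnegrE ?(ltW d0) ?enorm_ge0.
have T : q / 2 + K * (n%:R / (4 * m%:R)) <= q.
  have h : K * n%:R <= q * m%:R by move: hm; rewrite ltr_pdivrMr // => /ltW; rewrite (mulrC m%:R).
  have -> : K * (n%:R / (4 * m%:R)) = (K * n%:R) / m%:R / 4 by field; rewrite gt_eqF.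
  have : K * n%:R / m%:R <= q by rewrite ler_pdivrMr.
  by lra.
have B : walk s y L (fun w => (q / 2) * 1 + K * enorm (w - y) ^+ 2) <= q.
  rewrite (walk_lin s y L (q / 2) K (fun=> 1) (fun w => enorm (w - y) ^+ 2)) walk_cst mulr1.
  by rewrite (le_trans _ T) // lerD2l ler_wpM2l.
have E : walk s y L phi - phi y = walk s y L (fun w => 1 * phi w + (-1) * phi y).
  by rewrite (walk_lin s y L 1 (-1) phi (fun=> phi y)) walk_cst mul1r mulN1r.
rewrite E ler_norml; apply/andP; split.
  rewrite lerNl (le_trans _ B) //.
  have -> : - walk s y L (fun w => 1 * phi w + -1 * phi y) =
      walk s y L (fun w => (-1) * phi w + 1 * phi y).
    rewrite (walk_lin s y L 1 (-1) phi (fun=> phi y)) (walk_lin s y L (-1) 1 phi (fun=> phi y)).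
    by ring.
  apply: walk_le => // w; rewrite mulr1.
  by have := P w; rewrite ler_norml => /andP[h1 h2]; lra.
rewrite (le_trans _ B) //; apply: walk_le => // w; rewrite mulr1.
by have := P w; rewrite ler_norml => /andP[h1 h2]; lra.
Qed.

(* The substitution y_i = (1 + sin x_i) / 2 turns polynomials on the unit cube into
   trigonometric polynomials, whose approximation of phi o sincube is uniform on R^n. *)
Definition sincube (x : 'rV[R]_n) : 'rV[R]_n := \row_i ((1 + sin (x ord0 i)) / 2).

Lemma sincube_01 x i : 0 <= sincube x ord0 i <= 1.
Proof.
rewrite mxE; have := sin_geN1 (x ord0 i); have := sin_le1 (x ord0 i) => h1 h2.
by apply/andP; split; lra.
Qed.

(** [Phi] depends on [x] too, because after one step the function carried by the walk contains the
    probabilities [sincube x]; these are affine in sines, and multiplication by a sine preserves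
    [trig]. *)
Lemma walk_trig s L (Phi : 'rV[R]_n -> 'rV[R]_n -> R) : (forall w, trig (Phi w)) ->
  trig (fun x => walk s (sincube x) L (fun w => Phi w x)).
Proof.
elim: L Phi => [|i L ih] Phi h /=; first exact: h.
apply: (ih (fun w x => sincube x ord0 i * Phi (w + s *: ebasis i) x + (1 - sincube x ord0 i) * Phi w x)).
move=> w; set f1 := Phi (w + _); have t1 : trig f1 by exact: h.
have t2 := h w; set f2 := Phi w in t2 *.
have := trig_add (trig_add (trig_scale (1/2) t1) (trig_scale (1/2) (trig_sin_mul i t1)))
  (trig_add (trig_scale (1/2) t2) (trig_scale (- (1/2)) (trig_sin_mul i t2))).
by congr trig; apply/funext => x; rewrite !mxE; field.
Qed.

Lemma trig_approx phi M q : ucont phi -> bounded_by M phi -> 0 < q ->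
  exists2 p, trig p & forall x, `|p x - phi (sincube x)| <= q.
Proof.
move=> uphi bphi q0; have [s [L h]] := walk_approx uphi bphi q0.
exists (fun x => walk s (sincube x) L phi).
  by apply: (walk_trig s L (Phi := fun w _ => phi w)) => w; exact: trig_const.
by move=> x; apply: h => i; exact: sincube_01.
Qed.

End BernsteinWalk.

(** * Extension of u to a periodic function on the whole space *)

Section Extension.
Context {R : realType} {n : nat}.
Implicit Types (x y : 'rV[R]_n).

(** The pairs in the ball at which [h] differs by at least [q] form a compact set off the diagonal;
    [d] is the smallest distance in such a pair. *)
Lemma continuous_ucont_on (h : 'rV[R]_n -> R) (r q : R) : continuous h -> 0 < q ->
  exists2 d : R, 0 < d & forall x y, enorm x <= r -> enorm y <= r -> enorm (x - y) < d -> `|h x - h y| < q.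
Proof.
move=> ch q0.
pose B : set ('rV[R]_n * 'rV[R]_n) := cball 0 r `*` cball 0 r.
pose phi (w : 'rV[R]_n * 'rV[R]_n) : R := `|h w.1 - h w.2|.
have cphi : continuous phi.
  move=> w; apply: (@continuous_comp _ _ _ (fun w : 'rV[R]_n * 'rV[R]_n => h w.1 - h w.2) (fun t : R => `|t|)).
    apply: cvgB.
      by refine (@cvg_comp _ _ _ fst h (nbhs w) (nbhs w.1) _ _ (ch _)); exact: cvg_fst.
    by refine (@cvg_comp _ _ _ snd h (nbhs w) (nbhs w.2) _ _ (ch _)); exact: cvg_snd.
  exact: norm_continuous.
have cB : compact B by apply: compact_setX; exact: cball_compact.
pose Z := B `&` phi @^-1` [set t | q <= t].
have cZ : compact Z.
  by apply: compact_closedI => //; apply: preimage_closed; [move=> w _; exact: cphi | exact: closed_ge].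
have inB x : enorm x <= r -> cball 0 r x by rewrite /cball /= subr0.
have [Z0|Z0] := pselect (Z !=set0); last first.
  exists 1 => // x y xr yr _; rewrite ltNge; apply/negP => h1; apply: Z0; exists (x, y).
  by split => //; split; exact: inB.
pose D (w : 'rV[R]_n * 'rV[R]_n) : R := enorm (w.1 - w.2).
have cD : continuous D.
  move=> w; refine (@cvg_comp _ _ _ (fun w : 'rV[R]_n * 'rV[R]_n => w.1 - w.2) (@enorm R n) (nbhs w) _ _ _ (@enorm_continuous _ _ _)).
  by apply: cvgB; [exact: cvg_fst | exact: cvg_snd].
have [w /[!inE] -[_ /= wq] wm] := compact_EVT_min Z0 cZ (continuous_subspaceT cD).
exists (D w).
  rewrite /D enorm_gt0 subr_eq0; apply/eqP => E; move: wq.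
  by rewrite /phi E subrr normr0 leNgt q0.
move=> x y xr yr xy; rewrite ltNge; apply/negP => h1.
have := wm (x, y); rewrite inE => /(_ _); rewrite leNgt xy => H; apply/notF/H.
by split => //; split; exact: inB.
Qed.

Definition bproj (r : R) x : 'rV[R]_n := (r / Num.max r (enorm x)) *: x.

Lemma bproj_continuous r : 0 < r -> continuous (bproj r).
Proof.
move=> r0 x.
have m0 : 0 < Num.max r (enorm x) by rewrite lt_max r0.
have c1 : {for x, continuous (fun y => Num.max r (enorm y))}.
  apply: (@continuous_max _ _ (fun=> r) (@enorm R n)); first exact: cst_continuous.
  exact: enorm_continuous.
have c2 : {for x, continuous (fun y => (Num.max r (enorm y))^-1)}.
  by rewrite /prop_for /continuous_at; apply: (cvgV _ c1); rewrite gt_eqF.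
have c3 : {for x, continuous (fun y => r / Num.max r (enorm y))}.
  by apply: continuousM => //; exact: cst_continuous.
exact: (@continuousZ R 'rV[R]_n 'rV[R]_n _ (fun y => y) x c3 (@cvg_id _ _)).
Qed.

Lemma bproj_le r x : 0 < r -> enorm (bproj r x) <= r.
Proof.
move=> r0; have m0 : 0 < Num.max r (enorm x) by rewrite lt_max r0.
rewrite enormZ ger0_norm ?divr_ge0 ?(ltW r0) ?(ltW m0) // mulrAC ler_pdivrMr // ler_pM2l //.
by rewrite le_max lexx orbT.
Qed.

Lemma bproj_id r x : 0 < r -> enorm x <= r -> bproj r x = x.
Proof. by move=> r0 xr; rewrite /bproj max_l // divff ?gt_eqF // scale1r. Qed.

Lemma asin_lipschitz (s a b : R) : 0 <= s < 1 -> - s <= a <= s -> - s <= b <= s ->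
  `|asin a - asin b| <= (Num.sqrt (1 - s ^+ 2))^-1 * `|a - b|.
Proof.
move=> /andP[s0 s1].
wlog ab : a b / b <= a => [hw|/andP[a1 a2] /andP[b1 b2]].
  move=> ha hb; have [h|/ltW h] := leP b a; first exact: hw.
  by rewrite distrC (distrC a b); exact: hw.
have [||c /itvP cI ->] := @MVT_segment R (@asin R) (fun t : R => (Num.sqrt (1 - t ^+ 2))^-1) b a ab.
- by move=> x /itvP xI; apply: is_derive1_asin; apply/andP; split;
   [rewrite (@lt_le_trans _ _ b) ?xI // | rewrite (@le_lt_trans _ _ a) ?xI //]; lra.
- apply: continuous_in_subspaceT => x /[!inE] /= /itvP xI; apply: continuous_asin.
  by apply/andP; split; [rewrite (@lt_le_trans _ _ b) ?xI // | rewrite (@le_lt_trans _ _ a) ?xI //]; lra.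
have c1 : b <= c by rewrite cI.
have c2 : c <= a by rewrite cI.
have p : 0 < 1 - s ^+ 2 by nra.
have cs : 1 - s ^+ 2 <= 1 - c ^+ 2 by nra.
rewrite normrM ler_wpM2r // ger0_norm ?invr_ge0 ?sqrtr_ge0 //.
rewrite lef_pV2 ?posrE ?sqrtr_gt0 ?ler_wsqrtr //; lra.
Qed.

(** [phi] is [u] read through the inverse of [sincube]. Since [r < 1 <= pi / 2], [asin] recovers the
    coordinates on the ball; clipping its argument to [[- s, s]] with [s = sin r] keeps it
    Lipschitz, and [bproj] keeps the argument of [u] in the ball. *)
Lemma extension_exists (u : 'rV[R]_n -> R) (r K : R) : 0 < r -> r < 1 ->
  (forall x, enorm x < 1 -> {for x, continuous u}) -> (forall x, enorm x < 1 -> `|u x| <= K) ->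
  exists phi, [/\ ucont phi, bounded_by K phi & forall x, enorm x <= r -> phi (sincube x) = u x].
Proof.
move=> r0 r1 cu bu.
pose h x := u (bproj r x).
have ch : continuous h.
  move=> x; refine (@cvg_comp _ _ _ (bproj r) u (nbhs x) _ _ _ (cu _ _)); first exact: bproj_continuous.
  exact: le_lt_trans (bproj_le _ _) _.
have p2 := @pihalf_ge1 R; have p3 := @pihalf_lt2 R.
pose s := sin r.
have inpi (t : R) : - r <= t <= r -> t \in `[(- (pi / 2)), pi / 2].
  by move=> /andP[t1 t2]; rewrite in_itv /=; apply/andP; split; lra.
have s01 : 0 <= s < 1.
  apply/andP; split; first by rewrite /s ltW // sin_gt0_pihalf //; apply/andP; split; lra.
  by rewrite -(@sin_pihalf R) ltr_sin ?in_itv /=; lra.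
have sins t : - r <= t <= r -> - s <= sin t <= s.
  move=> tr; have h1 : sin t <= s.
    rewrite leNgt /s ltr_sin; [rewrite -leNgt; by case/andP: tr | apply: inpi; lra | exact: inpi].
  have h2 : - s <= sin t; last by rewrite h1 h2.
    rewrite leNgt /s -sinN ltr_sin; [rewrite -leNgt; by case/andP: tr | exact: inpi | apply: inpi; lra].
pose clip (t : R) := Num.max (- s) (Num.min s t).
have clip_in t : - s <= clip t <= s.
  rewrite /clip le_max lexx /= ge_max ge_min lexx /= andbT; lra.
have clip_id t : - s <= t <= s -> clip t = t.
  by move=> /andP[t1 t2]; rewrite /clip min_r // max_r.
have clip_lip a b : `|clip a - clip b| <= `|a - b|.
  have mx (k p q : R) : `|Num.max k p - Num.max k q| <= `|p - q|.
    have := ler_norm (p - q); have := ler_norm (q - p); rewrite (distrC q p) => q1 q2.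
    by case: (leP k p) => h1; case: (leP k q) => h2; rewrite ler_norml; apply/andP; split; lra.
  have mn (k p q : R) : `|Num.min k p - Num.min k q| <= `|p - q|.
    have := ler_norm (p - q); have := ler_norm (q - p); rewrite (distrC q p) => q1 q2.
    by case: (leP k p) => h1; case: (leP k q) => h2; rewrite ler_norml; apply/andP; split; lra.
  by rewrite (le_trans (mx _ _ _)).
pose al (t : R) := asin (clip t).
have al2 t : `|al t| <= 2.
  have hc : -1 <= clip t <= 1 by have := clip_in t; move: s01; lra.
  rewrite ler_norml; have := asin_geNpi2 hc; have := asin_lepi2 hc => q1 q2.
  by apply/andP; split; rewrite /al; lra.
set c := (Num.sqrt (1 - s ^+ 2))^-1.
have c0 : 0 <= c by rewrite invr_ge0 sqrtr_ge0.
have al_lip a b : `|al a - al b| <= c * `|a - b|.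
  by rewrite (le_trans (asin_lipschitz s01 (clip_in a) (clip_in b))) // ler_wpM2l.
pose A y : 'rV[R]_n := \row_i al (2 * y ord0 i - 1).
have A2 y : enorm (A y) <= n%:R * 2 by apply: enorm_le_bound => i; rewrite mxE.
have A_lip x y : enorm (A x - A y) <= n%:R * (c * (2 * enorm (x - y))).
  apply: enorm_le_bound => i; rewrite !mxE (le_trans (al_lip _ _)) // ler_wpM2l //.
  have -> : 2 * x ord0 i - 1 - (2 * y ord0 i - 1) = 2 * ((x - y) ord0 i) by rewrite !mxE; ring.
  by rewrite normrM ger0_norm // ler_wpM2l // coord_le_enorm.
exists (h \o A); split.
- move=> q q0; have [d d0 D] := continuous_ucont_on (n%:R * 2) ch q0.
  set k := n%:R * (c * 2) + 1.
  have k0 : 0 < k by rewrite /k ltr_wpDl // !mulr_ge0.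
  exists (d / k) => [|x y]; first by rewrite divr_gt0.
  rewrite ltr_pdivlMr // => xy; apply/ltW/D => //.
  rewrite (le_lt_trans (A_lip _ _)) // (le_lt_trans _ xy) // /k.
  by have := enorm_ge0 (x - y); lra.
- by move=> y; apply: bu; exact: le_lt_trans (bproj_le _ _) _.
move=> x xr; rewrite /h /=.
have -> : A (sincube x) = x.
  apply/rowP => i; rewrite !mxE /al.
  have xi : - r <= x ord0 i <= r by rewrite -ler_norml (le_trans (coord_le_enorm _ _)).
  have -> : 2 * ((1 + sin (x ord0 i)) / 2) - 1 = sin (x ord0 i) by field.
  by rewrite clip_id ?sinK //; [exact: inpi | exact: sins].
by rewrite bproj_id.
Qed.

Lemma ucont_sincube (phi : 'rV[R]_n -> R) : ucont phi -> ucont (fun x => phi (sincube x)).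
Proof.
move=> uphi q q0; have [d d0 D] := uphi q q0.
exists (d / (n%:R + 1)) => [|x y]; first by rewrite divr_gt0 // ltr_wpDl.
rewrite ltr_pdivlMr ?ltr_wpDl // => xy; apply: D.
have h : enorm (sincube x - sincube y) <= n%:R * enorm (x - y).
  apply: enorm_le_bound => i; rewrite !mxE.
  have -> : (1 + sin (x ord0 i)) / 2 - (1 + sin (y ord0 i)) / 2 = (sin (x ord0 i) - sin (y ord0 i)) / 2 by field.
  have h1 := norm_sinB (x ord0 i) (y ord0 i).
  have h2 := coord_le_enorm (x - y) i; rewrite !mxE in h2.
  rewrite normrM (ger0_norm (_ : 0 <= 2^-1)) ?invr_ge0 //.
  by have := normr_ge0 (sin (x ord0 i) - sin (y ord0 i)); lra.
by rewrite (le_lt_trans h) //; have := enorm_ge0 (x - y); lra.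
Qed.

End Extension.

(** * Smooth approximation of subsolutions of a linear inequality *)

Section LinearApproximation.
Context {R : realType} {n : nat}.
Implicit Types (x y xi : 'rV[R]_n) (f : 'rV[R]_n -> R).

Lemma tame_scale (a : R) f g X : tame f g X ->
  tame (fun x => a * f x) (fun x => a *: g x) (fun x => a *: X x).
Proof.
have sc h : (ucont h /\ exists M, bounded_by M h) ->
    ucont (fun x : 'rV[R]_n => a * h x) /\ exists M, bounded_by M (fun x => a * h x).
  move=> [uh [M bh]]; split; last by exists (`|a| * M) => x; rewrite normrM ler_wpM2l.
  by have := ucont_lin a 0 uh uh; congr ucont; apply/funext => x; rewrite mul0r addr0.
move=> [h1 h2 h3 h4 [C h5]]; split.
- exact: sc.
- move=> i; have := sc _ (h2 i).
  by have -> : (fun x => a * g x ord0 i) = (fun x => (a *: g x) ord0 i) by apply/funext => x; rewrite mxE.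
- move=> i j; have := sc _ (h3 i j).
  by have -> : (fun x => a * X x i j) = (fun x => (a *: X x) i j) by apply/funext => x; rewrite mxE.
- by move=> x; exact: symmxZ.
exists (`|a| * C) => x xi; rewrite dotZl qfZl.
have -> : a * f (x + xi) - a * f x - a * dot (g x) xi - 1 / 2 * (a * qf (X x) xi) =
  a * (f (x + xi) - f x - dot (g x) xi - 1 / 2 * qf (X x) xi) by ring.
by rewrite normrM -[leRHS]mulrA ler_wpM2l.
Qed.

Lemma tame_addc (a : R) f g X : tame f g X -> tame (fun x => f x + a) g X.
Proof.
move=> [[uf [M bf]] h2 h3 h4 [C h5]]; split => //.
- split; last by exists (M + `|a|) => x; rewrite (le_trans (ler_normD _ _)) // lerD.
  by move=> q /uf [d d0 D]; exists d => // x y /D; rewrite opprD addrACA subrr addr0.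
by exists C => x xi; have := h5 x xi; rewrite opprD [in X in _ -> X]addrACA subrr addr0.
Qed.

Lemma tame_jet f g X x : tame f g X -> jet2 f x (g x) (X x).
Proof. by case=> _ _ _ _ [C h]; apply: (@jet2_cube _ _ _ _ _ _ C 1) => // xi _; exact: h. Qed.

(** With [k * rad ^+ 2] above the oscillation [2 * w], the penalty forces the maximum over the ball
    into its interior, at a point where [f] is no smaller than at [x1]. The price is [2 * k] in the
    Hessian. *)
Lemma penalized_max f (x1 : 'rV[R]_n) (rad k w : R) : 0 < rad ->
  (forall x, enorm (x - x1) <= rad -> {for x, continuous f}) ->
  (forall x, enorm (x - x1) <= rad -> `|f x| <= w) -> 2 * w < k * rad ^+ 2 -> 0 <= k ->
  exists x2, [/\ enorm (x2 - x1) < rad, f x1 <= f x2 & exists2 d : R, 0 < d &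
    forall xi, enorm xi < d ->
      f (x2 + xi) - k * enorm (x2 + xi - x1) ^+ 2 <= f x2 - k * enorm (x2 - x1) ^+ 2].
Proof.
move=> rad0 cf bf hk k0.
pose F x := f x - k * enorm (x - x1) ^+ 2.
have [|x2 x2c x2m] := @cball_max R n x1 rad F (ltW rad0).
  move=> x xc; apply: continuousB; first exact: cf.
  exact: jet2_continuous (jet2_sqnorm k x1 x).
have x1c : cball x1 rad x1 by rewrite /cball /= subrr enorm0 ltW.
have F1 := x2m _ x1c.
have E1 : F x1 = f x1 by rewrite /F subrr enorm0 expr0n mulr0 subr0.
have lt : enorm (x2 - x1) < rad.
  rewrite lt_neqAle; move: (x2c); rewrite /cball /= => ->; rewrite andbT; apply/eqP => E.
  have := bf _ x2c; have := bf _ x1c; rewrite !ler_norml => /andP[a1 a2] /andP[b1 b2].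
  by move: F1; rewrite E1 /F E; lra.
exists x2; split => //.
  by rewrite -E1 (le_trans F1) // /F lerBlDr lerDl mulr_ge0 // sqr_ge0.
exists (rad - enorm (x2 - x1)) => [|xi hxi]; first by rewrite subr_gt0.
apply: x2m; rewrite /cball /= addrAC (le_trans (enormD _ _)) //; lra.
Qed.

Variables (A : 'M[R]_n) (c : R).
Hypothesis hA : forall N, symmx N -> psd N -> 0 <= mdot A N.

Let trA := mdot A 1%:M.

Lemma mdot_scalar (a : R) : mdot A a%:M = a * trA.
Proof. by rewrite -scalemx1 mdotZr. Qed.

Lemma trA_ge0 : 0 <= trA.
Proof. by apply: hA; [exact: symmx_scalar | exact: psd_scalar]. Qed.

Lemma mdot_le_scalar X (a : R) : symmx X -> (forall xi, qf X xi <= a * enorm xi ^+ 2) -> mdot A X <= a * trA.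
Proof.
move=> sX h; rewrite -mdot_scalar -subr_ge0 -mdotBr; apply: hA.
  by apply: symmxB => //; exact: symmx_scalar.
by move=> xi; rewrite -/(qf _ _) qfBl qf_scalar subr_ge0.
Qed.

(** On the whole space the supremum need not be attained; penalization supplies a point where [f] is
    at least [f x1] and its Hessian is at most [2 * eta]. *)
Lemma resolvent_le (tau M : R) f g X : 0 < tau -> tame f g X ->
  (forall x, f x - tau * mdot A (X x) <= M) -> forall x, f x <= M.
Proof.
move=> tau0 tf hM x1; have [[uf [B bf]] _ _ sX _] := tf.
rewrite leNgt; apply/negP => lt.
set dl := f x1 - M; have dl0 : 0 < dl by rewrite subr_gt0.
have t0 := trA_ge0.
pose eta := dl / (2 * tau * trA + 1).
have p0 : 0 < 2 * tau * trA + 1 by rewrite ltr_wpDl // !mulr_ge0 // ltW.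
have eta0 : 0 < eta by rewrite divr_gt0.
have B0 : 0 <= B by exact: le_trans (bf 0).
pose rad := Num.sqrt ((2 * B + 1) / eta).
have q0 : 0 < (2 * B + 1) / eta by rewrite divr_gt0 // ltr_wpDl // mulr_ge0.
have rad0 : 0 < rad by rewrite sqrtr_gt0.
have [||x2 [_ f12 [d d0 hd]]] := @penalized_max f x1 rad eta B rad0 _ (fun x _ => bf x) _ (ltW eta0).
- by move=> x _; exact: ucont_continuous.
- by rewrite sqr_sqrtr ?(ltW q0) // [eta * _]mulrC divfK ?gt_eqF // ltrDl.
have := @jet2_max _ _ _ _ _ _ d d0 (jet2B (tame_jet x2 tf) (jet2_sqnorm eta x1 x2)) hd.
move=> hq.
have mA : mdot A (X x2) <= 2 * eta * trA.
  apply: mdot_le_scalar => // xi.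
  by have := hq xi; rewrite qfBl qf_scalar subr_le0.
have h2 := hM x2.
have h3 : tau * mdot A (X x2) <= tau * (2 * eta * trA) by rewrite ler_pM2l.
have h4 : eta * (2 * tau * trA + 1) = dl by rewrite divfK // gt_eqF.
by move: h4; rewrite /dl; lra.
Qed.

Variables (phi : 'rV[R]_n -> R) (K r r' : R).
Hypotheses (uphi : ucont phi) (bphi : bounded_by K phi) (rr : r' < r).
Let ut x := phi (sincube x).
Hypothesis sub : forall x g X, enorm x < r -> symmx X ->
  (forall e, 0 < e -> exists2 d : R, 0 < d & forall xi, enorm xi < d ->
    ut (x + xi) <= ut x + dot g xi + 1/2 * qf X xi + e * enorm xi ^+ 2) -> c <= mdot A X.

(* H solves H - tau (A : D^2 H - c) = p with p close to u; comparison gives u <= H + o(tau),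
   and the equation turns this into A : D^2 H >= c - o(1). *)
Lemma linear_approx (eps : R) : 0 < eps -> exists H g X, tame H g X /\
  forall x, enorm x <= r' -> `|H x - ut x| <= eps /\ c - eps <= mdot A (X x).
Proof.
move=> eps0; have t0 := trA_ge0.
set gap := r - r'; have gap0 : 0 < gap by rewrite subr_gt0.
have g20 : 0 < gap ^+ 2 by rewrite exprn_gt0.
pose e0 := Num.min (eps / 5) (eps * gap ^+ 2 / (64 * (trA + 1))).
have tr1 : 0 < trA + 1 by rewrite ltr_wpDl.
have e00 : 0 < e0 by rewrite lt_min !divr_gt0 ?mulr_gt0.
have e01 : 5 * e0 <= eps.
  have : e0 <= eps / 5 by rewrite ge_min lexx.
  by lra.
have e02 : e0 * (64 * (trA + 1)) <= eps * gap ^+ 2.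
  by rewrite -ler_pdivlMr ?mulr_gt0 // ge_min lexx orbT.
(* The coarse approximation [p1] is fixed before [tau]: the bound [b] of its linear operator
   determines [tau], and only then is the fine approximation [p] chosen, with an error
   [tau * eps / 4] that survives division by [tau]. *)
have [p1 tp1 hp1] := trig_approx uphi bphi e00.
have [g1 [X1 tame1]] := trig_tame tp1.
have [b b0 hb] : exists2 b : R, 0 <= b & forall x, `|mdot A (X1 x)| <= b.
  have [_ _ h3 _ _] := tame1.
  pose M i j := projT1 (cid (proj2 (h3 i j))).
  have hM i j x : `|X1 x i j| <= M i j by exact: (projT2 (cid (proj2 (h3 i j)))).
  exists (sumnorm A * \sum_i \sum_j `|M i j|).
    by rewrite mulr_ge0 ?sumnorm_ge0 // sumr_ge0 // => i _; rewrite sumr_ge0.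
  move=> x; apply: norm_mdot_le => i j; rewrite (le_trans (hM i j x)) // (le_trans (ler_norm _)) //.
  rewrite (bigD1 i) //= (bigD1 j) //= -addrA lerDl addr_ge0 // ?sumr_ge0 // => k _.
  by rewrite sumr_ge0.
pose tau := e0 / (b + `|c| + 1).
have bc0 : 0 < b + `|c| + 1 by rewrite ltr_wpDl // addr_ge0.
have tau0 : 0 < tau by rewrite divr_gt0.
have tauE : tau * (b + `|c| + 1) = e0 by rewrite divfK // gt_eqF.
pose e1 := Num.min e0 (tau * eps / 4).
have e10 : 0 < e1 by rewrite lt_min e00 divr_gt0 // mulr_gt0.
have e11 : e1 <= e0 by rewrite ge_min lexx.
have e12 : e1 <= tau * eps / 4 by rewrite ge_min lexx orbT.
have [p tp hp] := trig_approx uphi bphi e10.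
have [H0 [g [X [tame0 HE]]]] := trig_resolvent tau0 hA tp.
pose H x := H0 x + - (tau * c).
have tameH : tame H g X by exact: tame_addc.
have HE' x : H x - p x = tau * (mdot A (X x) - c) by rewrite /H -HE; ring.
have tb : tau * b + tau * `|c| <= e0 by have := ltW tau0; move: tauE; lra.
have tb1 : 0 <= tau * b by rewrite mulr_ge0 // ltW.
have tc : 0 <= tau * `|c| by rewrite mulr_ge0 // ltW.
have tc1 : `|tau * c| = tau * `|c| by rewrite normrM gtr0_norm.
have pp x : - (2 * e0) <= p x - p1 x <= 2 * e0.
  have := hp x; have := hp1 x; rewrite !ler_norml => /andP[a1 a2] /andP[a3 a4].
  by apply/andP; split; lra.
have mb x : - (tau * b) <= tau * mdot A (X1 x) <= tau * b.
  by rewrite -ler_norml normrM gtr0_norm // ler_pM2l.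
(* [p1] solves the resolvent equation for [H0] up to [2 * e0 + tau * b <= 3 * e0], so comparison in
   both directions bounds the difference. *)
have D1 x : H0 x + -1 * p1 x <= 3 * e0.
  apply: (resolvent_le tau0 (tame_add tame0 (tame_scale (-1) tame1))) => y.
  rewrite mdotDr mdotZr; have := HE y; have /andP[a1 a2] := pp y; have /andP[a3 a4] := mb y; lra.
have D2 x : -1 * H0 x + p1 x <= 3 * e0.
  apply: (resolvent_le tau0 (tame_add (tame_scale (-1) tame0) tame1)) => y.
  rewrite mdotDr mdotZr; have := HE y; have /andP[a1 a2] := pp y; have /andP[a3 a4] := mb y; lra.
set w := 5 * e0.
have Hut x : `|ut x - H x| <= w.
  have := D1 x; have := D2 x; have := hp1 x; rewrite -/(ut x) !ler_norml => /andP[a1 a2] a3 a4.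
  have : `|tau * c| <= e0 by rewrite tc1; lra.
  by rewrite ler_norml => /andP[a5 a6]; rewrite /H /w; apply/andP; split; lra.
exists H, g, X; split => // x xr; split; first by rewrite distrC (le_trans (Hut x)).
pose k := 3 * w / gap ^+ 2.
have k0 : 0 <= k by rewrite divr_ge0 ?sqr_ge0 // mulr_ge0 // mulr_ge0 // ltW.
have kg : k * gap ^+ 2 = 3 * w by rewrite divfK // gt_eqF.
have [||x2 [x2r f12 [d d0 hd]]] := @penalized_max (fun y => ut y - H y) x gap k w gap0 _ (fun y _ => Hut y) _ k0.
- move=> y _; apply: continuousB; first by apply: ucont_continuous; exact: ucont_sincube.
  by apply: jet2_continuous (tame_jet y tameH).
- by rewrite kg /w; lra.
have jF := jet2D (tame_jet x2 tameH) (jet2_sqnorm k x x2).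
have x2in : enorm x2 < r.
  rewrite -(subrK x x2) (le_lt_trans (enormD _ _)) //; move: x2r; rewrite /gap; lra.
have := sub x2in (symmxD (tame_sym tameH x2) (symmx_scalar (2 * k))).
move=> /(_ (g x2 + (2 * k) *: (x2 - x))) hs.
have {hs} : c <= mdot A (X x2 + (2 * k)%:M).
  apply: hs => e e_0; have [d' d'0 hd'] := jF _ e_0.
  exists (Num.min d d') => [|xi]; first by rewrite lt_min d0.
  rewrite lt_min => /andP[/hd h1 /hd']; rewrite ler_norml => /andP[h2 h3].
  by lra.
rewrite mdotDr mdot_scalar => hc.
have h1 := HE' x2; have h2 := HE' x.
have := hp x; have := hp x2; rewrite -/(ut x) -/(ut x2) !ler_norml => /andP[a1 a2] /andP[a3 a4].
have h3 : tau * (- (2 * k * trA)) <= tau * (mdot A (X x2) - c) by rewrite ler_pM2l //; lra.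
(* The subsolution inequality was obtained at [x2]. Since [ut - H] is no smaller there than at [x],
   and [p] is within [e1] of [ut], the equation [HE'] carries it over to [x]. *)
have h4 : tau * (- (eps / 2) - 2 * k * trA) <= tau * (mdot A (X x) - c).
  by rewrite -h2; move: h1 h3 f12 e12; lra.
move: h4; rewrite ler_pM2l // => h4.
have h5 : 2 * k * trA <= eps / 2.
  rewrite -(ler_pM2r g20).
  have -> : 2 * k * trA * gap ^+ 2 = 2 * trA * (k * gap ^+ 2) by ring.
  rewrite kg /w; have := mulr_ge0 (ltW e00) t0; lra.
by lra.
Qed.

End LinearApproximation.

(** * Smoothing preserves the subsolution property *)

Section SmoothSubsolution.
Context {R : realType} {n : nat}.
Implicit Types (x y xi : 'rV[R]_n) (f : 'rV[R]_n -> R) (rho : R).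

Lemma ucont_sum (I : Type) (s : seq I) (a : I -> R) (f : I -> 'rV[R]_n -> R) :
  (forall i, ucont (f i)) -> ucont (fun x => \sum_(i <- s) a i * f i x).
Proof.
move=> uf; elim: s => [|i s ih].
  have -> : (fun x => \sum_(i <- [::]) a i * f i x) = (fun=> 0).
    by apply/funext => x; rewrite big_nil.
  by move=> q q0; exists 1 => // x y _; rewrite subrr normr0 ltW.
have := ucont_lin (a i) 1 (uf i) ih; congr ucont; apply/funext => x.
by rewrite big_cons mul1r.
Qed.

Lemma smooth_sum rho L (I : Type) (s : seq I) (a : I -> R) (f : I -> 'rV[R]_n -> R) :
  (forall i, ucont (f i)) ->
  smooth rho L (fun x => \sum_(i <- s) a i * f i x) = fun x => \sum_(i <- s) a i * smooth rho L (f i) x.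
Proof.
move=> uf; elim: s => [|i s ih].
  have u0 : ucont (fun _ : 'rV[R]_n => 0 : R) by move=> q q0; exists 1 => // x y _; rewrite subrr normr0 ltW.
  have -> : (fun x => \sum_(i <- [::]) a i * f i x) = (fun x => 0 * (fun _ : 'rV[R]_n => 0 : R) x + 0 * (fun _ : 'rV[R]_n => 0 : R) x).
    by apply/funext => x; rewrite big_nil !mul0r addr0.
  by rewrite (smooth_lin rho L 0 0 u0 u0); apply/funext => x; rewrite big_nil !mul0r addr0.
have -> : (fun x => \sum_(j <- i :: s) a j * f j x) = (fun x => a i * f i x + 1 * (\sum_(j <- s) a j * f j x)).
  by apply/funext => x; rewrite big_cons mul1r.
rewrite (smooth_lin rho L (a i) 1 (uf i) (ucont_sum s a uf)) ih.
by apply/funext => x; rewrite big_cons mul1r.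
Qed.

Lemma qf_sum (X : 'M[R]_n) xi : qf X xi = \sum_(p : 'I_n * 'I_n) (xi ord0 p.1 * xi ord0 p.2) * X p.1 p.2.
Proof.
rewrite qfE /dot -(pair_big xpredT xpredT (fun i j => xi ord0 i * xi ord0 j * X i j)) /= exchange_big.
apply: eq_bigr => j _; rewrite mxE mulr_suml; apply: eq_bigr => i _; ring.
Qed.

Lemma mdot_sum (A X : 'M[R]_n) : mdot A X = \sum_(p : 'I_n * 'I_n) A p.1 p.2 * X p.1 p.2.
Proof. by rewrite /mdot (pair_big xpredT xpredT (fun i j => A i j * X i j)). Qed.

Lemma smooth_le rho L f x (c : R) : 0 <= rho -> ucont f ->
  (forall y, enorm (y - x) <= 3 * rho * (size L)%:R -> f y <= c) -> smooth rho L f x <= c.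
Proof.
move=> r0 uf h; have := ucont_lin (-1) 0 uf uf => uN.
have := @smooth_ge R n rho L _ x (- c) r0 uN.
rewrite (smooth_lin rho L (-1) 0 uf uf) mul0r addr0 mulN1r lerN2; apply=> y /h.
by rewrite mul0r addr0 mulN1r lerN2.
Qed.

Variable rho : R.
Hypothesis rho0 : 0 < rho.
Let T := @smoothing R n rho.

(** The third-order remainder of [H] is uniform, so smoothing the expansions gives the expansion of
    the smoothed function. Its Hessian is the smoothed Hessian and inherits linear inequalities. *)
Lemma tame_smoothing_jet H g X x : tame H g X ->
  jet2 (T H) x (\row_i T (fun y => g y ord0 i) x) (\matrix_(i, j) T (fun y => X y i j) x).
Proof.
move=> [[uH _] ug uX _ [C hC]].
apply: (@jet2_cube _ _ _ _ _ _ C 1) => // xi _.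
pose D y := \sum_i xi ord0 i * g y ord0 i.
pose Q y := \sum_(p : 'I_n * 'I_n) (xi ord0 p.1 * xi ord0 p.2) * X y p.1 p.2.
have uD : ucont D by apply: ucont_sum => i; exact: (ug i).1.
have uQ : ucont Q by apply: ucont_sum => p; exact: (uX p.1 p.2).1.
have TD : T D x = dot (\row_i T (fun y => g y ord0 i) x) xi.
  rewrite /T /smoothing /D smooth_sum; last by move=> i; exact: (ug i).1.
  by apply: eq_bigr => i _; rewrite mxE mulrC.
have TQ : T Q x = qf (\matrix_(i, j) T (fun y => X y i j) x) xi.
  rewrite /T /smoothing /Q smooth_sum; last by move=> p; exact: (uX p.1 p.2).1.
  by rewrite qf_sum; apply: eq_bigr => p _; rewrite mxE.
have := @smooth_taylor R n rho (enum 'I_n) H D Q 1 (1/2) xi x uH uD uQ.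
rewrite -/(smoothing rho H) -/(smoothing rho D) -/(smoothing rho Q) -/T TD TQ => ->.
set W := smooth _ _ _ _; set t1 := dot _ _; set t2 := qf _ _; set t3 := T H x.
have -> : t3 + 1 * t1 + 1 / 2 * t2 + W - t3 - t1 - 1 / 2 * t2 = W by ring.
apply: smooth_bounded; first exact: ucont_remainder.
move=> y; have := hC y xi; rewrite (mul1r (D y)) qf_sum -/(Q y).
by have -> : dot (g y) xi = D y by apply: eq_bigr => i _; rewrite mulrC.
Qed.

Variables (lam Lam : R) (F : 'M[R]_n -> R).
Hypotheses (lam0 : 0 < lam) (lamLam : lam <= Lam) (Fell : uniformly_elliptic lam Lam F).
Hypothesis (Fqc : quasiconcave F).
Variables (u : 'rV[R]_n -> R) (phi : 'rV[R]_n -> R) (K r r' : R).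
Hypothesis hu : viscosity_subsolution F (eball 0 1) u.
Hypotheses (uphi : ucont phi) (bphi : bounded_by K phi) (rr : r' < r) (r1 : r < 1).
Hypothesis phiE : forall x, enorm x <= r -> phi (sincube x) = u x.
Variable M0 : 'M[R]_n.
Hypotheses (sM0 : symmx M0) (FM0 : 0 <= F M0).

Let ut x := phi (sincube x).

(** [H] is close to [ut] only uniformly, so Hessians cannot be compared at [x0] itself. The
    second-order polynomial at [x0], opened by [io], touches the smoothing of [H] at a nearby point
    where the linear inequality still holds, and this contradicts the strict separation of [S]. *)
Lemma smoothing_subsolution x0 g S : enorm x0 + 3 * rho * n%:R < r' -> symmx S ->
  jet2 (T ut) x0 g S -> 0 <= F S.
Proof.
move=> x0r sS jS; rewrite leNgt; apply/negP => FS.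
have [A [c [Ac AS Apos]]] := superlevel_separation lam0 lamLam Fell Fqc sS FS sM0 FM0.
have uut : ucont ut by exact: ucont_sincube.
have sub x g' X : enorm x < r -> symmx X ->
  (forall e, 0 < e -> exists2 d : R, 0 < d & forall xi, enorm xi < d ->
    ut (x + xi) <= ut x + dot g' xi + 1/2 * qf X xi + e * enorm xi ^+ 2) -> c <= mdot A X.
  move=> xr sX h; apply: Ac => //; apply: (subsol_jet lam0 lamLam Fell (g := g') hu _ sX).
    by rewrite /eball /= subr0; exact: lt_trans xr r1.
  move=> e e0; have [d d0 D] := h e e0.
  exists (Num.min d (r - enorm x)) => [|xi]; first by rewrite lt_min d0 subr_gt0.
  rewrite lt_min => /andP[/D h1 h2]; move: h1; rewrite /ut !phiE //; first exact: ltW.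
  by rewrite (le_trans (enormD _ _)) //; lra.
have t0 := trA_ge0 Apos; set trA := mdot A 1%:M in t0.
set dl := c - mdot A S; have dl0 : 0 < dl by rewrite subr_gt0.
(* The order of choices matters: [io] from the separation gap [dl], so that [2 * io * trA] uses at
   most half of it; then [rad] from the jet at accuracy [io / 8]; then [eps], which may depend on
   both. *)
pose io := dl / (4 * (trA + 1)).
have tr1 : 0 < trA + 1 by rewrite ltr_wpDl.
have io0 : 0 < io by rewrite divr_gt0 // mulr_gt0.
have ioE : io * (4 * (trA + 1)) = dl by rewrite divfK // gt_eqF // mulr_gt0.
have io8 : 0 < io / 8 by rewrite divr_gt0.
have [d d0 D] := jS _ io8.
set gap := r' - (enorm x0 + 3 * rho * n%:R); have gap0 : 0 < gap by rewrite subr_gt0.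
pose rad := Num.min (d / 2) gap.
have rad0 : 0 < rad by rewrite lt_min gap0 divr_gt0.
have radd : rad < d.
  have : rad <= d / 2 by rewrite ge_min lexx.
  by lra.
have radg : rad <= gap by rewrite ge_min lexx orbT.
have rad20 : 0 < rad ^+ 2 by rewrite exprn_gt0.
pose eps := Num.min (dl / 8) (io * rad ^+ 2 / 8).
have eps0 : 0 < eps by rewrite lt_min !divr_gt0 // mulr_gt0.
have eps1 : eps <= dl / 8 by rewrite ge_min lexx.
have eps2 : eps <= io * rad ^+ 2 / 8 by rewrite ge_min lexx orbT.
have [H [gH [XH [tH hH]]]] := linear_approx Apos uphi bphi rr sub eps0.
have [[uH _] _ uX _ _] := tH.
have near_in x y : enorm (x - x0) <= rad -> enorm (y - x) <= 3 * rho * (size (enum 'I_n))%:R -> enorm y <= r'.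
  move=> h1; rewrite size_enum_ord => h2.
  have -> : y = (y - x) + (x - x0) + x0 by rewrite addrA !subrK.
  rewrite (le_trans (enormD _ _)) // (le_trans (lerD (enormD _ _) (lexx _))) //.
  by move: radg; rewrite /gap; lra.
have THU x : enorm (x - x0) <= rad -> `|T H x - T ut x| <= eps.
  move=> hx; have -> : T H x - T ut x = T (fun y => 1 * H y + (-1) * ut y) x.
    by rewrite /T /smoothing (smooth_lin rho _ 1 (-1) uH uut) mul1r mulN1r.
  have uD := ucont_lin 1 (-1) uH uut.
  rewrite ler_norml; apply/andP; split; [apply: smooth_ge | apply: smooth_le] => //;
    rewrite ?(ltW rho0) // => y /(near_in _ _ hx) /hH [+ _];
    by rewrite mul1r mulN1r ler_norml => /andP[].
have THL x : enorm (x - x0) <= rad -> c - eps <= mdot A (\matrix_(i, j) T (fun y => XH y i j) x).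
  move=> hx; have -> : mdot A (\matrix_(i, j) T (fun y => XH y i j) x) = T (fun y => mdot A (XH y)) x.
    have -> : (fun y => mdot A (XH y)) = (fun y => \sum_(p : 'I_n * 'I_n) A p.1 p.2 * XH y p.1 p.2).
      by apply/funext => y; rewrite mdot_sum.
    rewrite /T /smoothing smooth_sum; last by move=> p; exact: (uX p.1 p.2).1.
    by rewrite mdot_sum; apply: eq_bigr => p _; rewrite mxE.
  apply: smooth_ge; first exact: ltW.
    have -> : (fun y => mdot A (XH y)) = (fun y => \sum_(p : 'I_n * 'I_n) A p.1 p.2 * XH y p.1 p.2).
      by apply/funext => y; rewrite mdot_sum.
    by apply: ucont_sum => p; exact: (uX p.1 p.2).1.
  by move=> y /(near_in _ _ hx) /hH [].
pose k0 := T ut x0 - dot g x0.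
pose f y := T H y - (k0 + quadt x0 g S y).
have jq x : jet2 (fun y => k0 + quadt x0 g S y) x (g + (x - x0) *m S) S.
  have := jet2D (jet2_affine k0 0 x) (quadt_jet2 x0 g x sS); rewrite !add0r.
  by congr (jet2 _ _ _ _); apply/funext => y; rewrite dot0l addr0.
have jf x : jet2 f x _ _ := jet2B (tame_smoothing_jet x tH) (jq x).
have bf x : enorm (x - x0) <= rad -> `|f x| <= eps + io / 8 * rad ^+ 2.
  move=> hx; have := D (x - x0) (le_lt_trans hx radd); rewrite (addrC x0) subrK => h1.
  have h2 := THU x hx.
  have -> : f x = (T H x - T ut x) + (T ut x - T ut x0 - dot g (x - x0) - 1/2 * qf S (x - x0)).
    by rewrite /f /k0 /quadt dotBr; ring.
  rewrite (le_trans (ler_normD _ _)) // lerD // (le_trans h1) // ler_wpM2l ?(ltW io8) //.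
  by rewrite ler_pXn2r ?nnegrE ?enorm_ge0 ?(ltW rad0).
have [||x2 [x2r _ [d2 d20 hd2]]] := @penalized_max R n f x0 rad io _ rad0 _ bf _ (ltW io0).
- by move=> x _; exact: jet2_continuous (jf x).
- by have := mulr_gt0 io0 rad20; lra.
have hq := @jet2_max _ _ _ _ _ _ d2 d20 (jet2B (jf x2) (jet2_sqnorm io x0 x2)) hd2.
set XG := \matrix_(i, j) _ in hq; have {}THL := THL x2 (ltW x2r); rewrite -/XG in THL.
have sXG : symmx XG.
  apply/matrixP => i j; rewrite !mxE; congr (T _ x2); apply/funext => y.
  by rewrite -[in RHS](tame_sym tH y) mxE.
have : mdot A (XG - S) <= 2 * io * trA.
  apply: mdot_le_scalar => //; first exact: symmxB.
  by move=> xi; have := hq xi; rewrite qfBl qf_scalar subr_le0.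
rewrite mdotBr => h1.
by move: THL h1 ioE eps1; rewrite /dl; lra.
Qed.

End SmoothSubsolution.

(** * Twice differentiable approximate solutions *)

Section ApproximateSolutions.
Context {R : realType} {n : nat}.
Variables (lam Lam : R) (F : 'M[R]_n -> R).
Hypotheses (lam0 : 0 < lam) (lamLam : lam <= Lam) (Fell : uniformly_elliptic lam Lam F).
Hypothesis (Fqc : quasiconcave F).
Variables (u : 'rV[R]_n -> R) (K : R).
Hypothesis hu : viscosity_subsolution F (eball 0 1) u.
Hypothesis uK : forall x, eball 0 1 x -> `|u x| <= K.
Variable M0 : 'M[R]_n.
Hypotheses (sM0 : symmx M0) (FM0 : 0 <= F M0).

(** [approx_comb] encodes that [U] averages translates of [u]. Its free coefficients cover first
    differences of both signs and second differences, and bounds pass from [u] to [U] without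
    additive error. *)
Record approximant (eps : R) (U : 'rV[R]_n -> R) : Prop := Approximant {
  approx_close : forall x, enorm x <= 31/32 -> `|U x - u x| <= eps;
  approx_bound : forall x, `|U x| <= K;
  approx_jet : forall x, enorm x <= 31/32 -> exists g X, [/\ symmx X, jet2 U x g X & 0 <= F X];
  approx_comb : forall x h (a b c d : R), enorm x + enorm h <= 31/32 ->
    (forall y, enorm (y - x) <= eps -> a * u (y + h) + b * u (y - h) + c * u y <= d) ->
    a * U (x + h) + b * U (x - h) + c * U x <= d }.

Lemma approximant_exists (eps : R) : 0 < eps -> exists U, approximant eps U.
Proof.
move=> eps0.
have r01 : (64/65 : R) < 1 by lra.
have [|||phi [uphi bphi phiE]] := @extension_exists R n u (64/65) K _ r01.
- lra.
- move=> x x1; case: hu => cu _; apply: visc_continuous cu _; first exact: eball_open.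
  by rewrite /eball /= subr0.
- by move=> x x1; apply: uK; rewrite /eball /= subr0.
pose ut x := phi (sincube x).
have uut : ucont ut by exact: ucont_sincube.
have [d d0 D] := uut _ eps0.
(* The cap 1/99 keeps averages around points of radius 31/32 inside radius 63/64, where
   [smoothing_subsolution] is applied, and hence inside 64/65, where [ut = u]. *)
pose rad := Num.min (Num.min (d / 2) eps) (1/99).
have rad0 : 0 < rad by rewrite !lt_min eps0 !divr_gt0.
have rad1 : rad < d.
  have : rad <= d / 2 by rewrite !ge_min lexx.
  by lra.
have rad2 : rad <= eps by rewrite !ge_min lexx orbT.
have rad3 : rad <= 1/99 by rewrite !ge_min lexx orbT.
pose rho := rad / (3 * (n%:R + 1)).
have n1 : 0 < n%:R + 1 :> R by rewrite ltr_wpDl.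
have rho0 : 0 < rho by rewrite divr_gt0 // mulr_gt0.
have rhon : 3 * rho * n%:R <= rad.
  have E : 3 * rho * (n%:R + 1) = rad by rewrite /rho; field; rewrite gt_eqF.
  by rewrite -[leRHS]E; lra.
have loc x y : enorm (y - x) <= 3 * rho * (size (enum 'I_n))%:R -> enorm (y - x) <= rad.
  by rewrite size_enum_ord => /le_trans; exact.
have utE x y (c : R) : enorm x <= c -> c <= 31/32 -> enorm (y - x) <= rad -> ut y = u y.
  move=> h1 h2 h3; apply: phiE; rewrite -(subrK x y) (le_trans (enormD _ _)) //; lra.
exists (smoothing rho ut); split.
- move=> x xr; have Ex : ut x = u x by apply: (utE x x (31/32)) => //; rewrite subrr enorm0 ltW.
  have h y : enorm (y - x) <= 3 * rho * (size (enum 'I_n))%:R -> - eps <= ut y - ut x <= eps.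
    by move=> /loc hy; rewrite -ler_norml; apply: D; exact: le_lt_trans rad1.
  rewrite -Ex ler_norml; apply/andP; split.
    rewrite lerBrDr; apply: smooth_ge => //; first exact: ltW.
    by move=> y /h /andP[h1 _]; lra.
  rewrite lerBlDr; apply: smooth_le => //; first exact: ltW.
  by move=> y /h /andP[_ h1]; lra.
- by apply: smooth_bounded => // x; exact: bphi.
- move=> x xr; have but : bounded_by K ut by move=> y; exact: bphi.
  have [g [X [sX jX]]] := smoothing_jet x rho0 uut but.
  exists g, X; split => //.
  have rr : (63/64 : R) < 64/65 by lra.
  apply: (smoothing_subsolution rho0 lam0 lamLam Fell Fqc hu uphi bphi rr r01 phiE sM0 FM0 _ sX jX).
  lra.
move=> x h a b c e xh hc.
have u1 := ucont_shift h uut; have u2 := ucont_shift (- h) uut.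
have u12 := ucont_lin a b u1 u2.
have -> : a * smoothing rho ut (x + h) + b * smoothing rho ut (x - h) + c * smoothing rho ut x =
   smoothing rho (fun y => 1 * (a * ut (y + h) + b * ut (y + - h)) + c * ut y) x.
  rewrite /smoothing (smooth_lin rho _ 1 c u12 uut) (smooth_lin rho _ a b u1 u2).
  by rewrite (smooth_shift rho _ ut h) (smooth_shift rho _ ut (- h)) mul1r.
apply: smooth_le; [exact: ltW | exact: ucont_lin |].
move=> y /loc hy; rewrite mul1r; have h0 := enorm_ge0 h.
have Ey : ut y = u y by apply: (utE x y (31/32)) => //; lra.
have E1 : ut (y + h) = u (y + h).
  apply: (utE (x + h) (y + h) (31/32)) => //; first exact: le_trans (enormD _ _) xh.
  by rewrite opprD addrACA subrr addr0.
have E2 : ut (y - h) = u (y - h).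
  apply: (utE (x - h) (y - h) (31/32)) => //; first exact: le_trans (enormB _ _) xh.
  by rewrite opprD addrACA subrr addr0.
by rewrite Ey E1 E2; apply: hc; exact: le_trans rad2.
Qed.

End ApproximateSolutions.

(** * Taylor's inequality along a segment *)

Section SegmentTaylor.
Context {R : realType} {n : nat}.
Implicit Types (x y g h : 'rV[R]_n) (X : 'M[R]_n) (f : 'rV[R]_n -> R).

Lemma midpoint_concave_ge0 (w : R -> R) : {in `[0, 1], continuous w} -> w 0 = 0 -> w 1 = 0 ->
  (forall t, 0 < t < 1 -> exists2 d, 0 < d & forall s, 0 < s < d -> w (t + s) + w (t - s) < 2 * w t) ->
  forall t, 0 <= t <= 1 -> 0 <= w t.
Proof.
move=> cw w0 w1 hw t t01.
have cw' : {within `[0, 1], continuous w}.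
  by apply: continuous_in_subspaceT => s; rewrite inE => hs; exact: cw.
have [c c01 hc] := EVT_min ler01 cw'.
have tin : t \in `[0, 1] by rewrite in_itv.
rewrite (le_trans _ (hc t tin)) // leNgt; apply/negP => wc.
move: c01; rewrite in_itv /= => /andP[c0 c1].
have c0' : 0 < c by rewrite lt_neqAle c0 andbT; apply: contraTneq wc => <-; rewrite w0 ltxx.
have c1' : c < 1 by rewrite lt_neqAle c1 andbT; apply: contraTneq wc => ->; rewrite w1 ltxx.
have [|d d0 D] := hw c; first by rewrite c0'.
pose m := Num.min d (Num.min c (1 - c)); pose s := m / 2.
have m0 : 0 < m by rewrite !lt_min d0 c0' subr_gt0.
have [m1 m2 m3] : [/\ m <= d, m <= c & m <= 1 - c] by rewrite /m !ge_min !lexx !orbT.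
have h1 : w c <= w (c + s) by apply: hc; rewrite in_itv /= /s; apply/andP; split; lra.
have h2 : w c <= w (c - s) by apply: hc; rewrite in_itv /= /s; apply/andP; split; lra.
have : 0 < s < d by rewrite /s; apply/andP; split; lra.
by move=> /D; lra.
Qed.

(** The Hessians along the segment are given pointwise only, so they are not integrated. Subtracting
    the chord and [q * (t ^+ 2 - t)] with [q > C / 2] leaves a function that vanishes at both ends
    and is strictly midpoint concave at each interior point, hence nonnegative; its slope at 0 gives
    the claim up to [eta]. *)
Lemma jet2_segment f x h g0 X0 (C : R) : jet2 f x g0 X0 ->
  (forall t : R, 0 <= t <= 1 -> exists g X, jet2 f (x + t *: h) g X /\ qf X h <= C) ->
  f (x + h) <= f x + dot g0 h + C / 2.
Proof.
move=> j0 hX; apply/ler_addgt0Pr => eta eta0.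
pose q := C / 2 + eta / 2; pose L := f (x + h) - f x.
pose w (t : R) := f (x + t *: h) - f x - t * L - q * (t ^+ 2 - t).
have cw : {in `[0, 1], continuous w}.
  move=> t; rewrite in_itv /= => /hX [g [X [jX _]]].
  have cf : {for t, continuous (fun t : R => f (x + t *: h))}.
    refine (@cvg_comp _ _ _ (fun t : R => x + t *: h) f (nbhs t) (nbhs (x + t *: h)) _ _ _).
      by apply: cvgD; [exact: cvg_cst | apply: cvgZr_tmp; exact: cvg_id].
    exact: jet2_continuous jX.
  apply: cvgB; first apply: cvgB; first by apply: cvgB => //; exact: cvg_cst.
    by apply: cvgM; [exact: cvg_id | exact: cvg_cst].
  apply: cvgM; [exact: cvg_cst | apply: cvgB; last exact: cvg_id].
  exact: exprn_continuous.
have wpos : forall t, 0 <= t <= 1 -> 0 <= w t.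
  apply: midpoint_concave_ge0 => //.
  - by rewrite /w scale0r addr0; ring.
  - by rewrite /w scale1r /L; ring.
  move=> t /andP[t0 t1]; have [|g [X [jX Xh]]] := hX t; first by rewrite !ltW.
  pose e := eta / (4 * (enorm h ^+ 2 + 1)).
  have e0 : 0 < e by rewrite divr_gt0 // mulr_gt0 // ltr_wpDl // sqr_ge0.
  have [d d0 D] := jX _ e0.
  exists (d / (enorm h + 1)) => [|s /andP[s0 sd]]; first by rewrite divr_gt0 // ltr_wpDl // enorm_ge0.
  move: sd; rewrite ltr_pdivlMr ?ltr_wpDl ?enorm_ge0 // => sd.
  have E1 : enorm (s *: h) = s * enorm h by rewrite enormZ gtr0_norm.
  have E2 : enorm (- (s *: h)) = s * enorm h by rewrite enormN.
  have lt_d : s * enorm h < d by rewrite (le_lt_trans _ sd) // ler_pM2l // lerDl.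
  have := D (s *: h); rewrite E1 => /(_ lt_d); rewrite ler_norml => /andP[_ l1].
  have := D (- (s *: h)); rewrite E2 => /(_ lt_d); rewrite ler_norml => /andP[_ l2].
  move: l1 l2; rewrite dotNr qfNr qfZr exprMn.
  have -> : x + t *: h + s *: h = x + (t + s) *: h by rewrite scalerDl addrA.
  have -> : x + t *: h - s *: h = x + (t - s) *: h by rewrite scalerBl addrA.
  move=> l1 l2.
  have ee : e * enorm h ^+ 2 <= eta / 4.
    rewrite /e mulrAC ler_pdivrMr ?mulr_gt0 ?ltr_wpDl ?sqr_ge0 //.
    by have := sqr_ge0 (enorm h); have := eta0; nra.
  have s2 : 0 < s ^+ 2 by rewrite exprn_gt0.
  have k1 : s ^+ 2 * qf X h <= s ^+ 2 * C by rewrite ler_pM2l.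
  have k2 : s ^+ 2 * (e * enorm h ^+ 2) <= s ^+ 2 * (eta / 4) by rewrite ler_pM2l.
  have k3 : 0 < s ^+ 2 * eta by rewrite mulr_gt0.
  move: l1 l2; rewrite (mulrCA e (s ^+ 2)) /w /q.
  move: (f (x + (t + s) *: h)) (f (x + (t - s) *: h)) (f (x + t *: h)) (f x) => a b c0 f0 l1 l2.
  have : q * ((t + s) ^+ 2 - (t + s)) + q * ((t - s) ^+ 2 - (t - s)) = 2 * (q * (t ^+ 2 - t)) + 2 * (s ^+ 2 * q) by ring.
  by rewrite /q; lra.
suff : L - q - dot g0 h <= 0 by rewrite /L /q; lra.
apply/ler_addgt0Pr => e e0; rewrite add0r.
have e20 : 0 < e / 2 by rewrite divr_gt0.
have [d d0 D] := jet2_dir h j0 e20.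
pose s := Num.min (Num.min (d / 2) 1) (e / (2 * (`|q| + 1))).
have q10 : 0 < `|q| + 1 by rewrite ltr_wpDl.
have s0 : 0 < s by rewrite !lt_min ltr01 !divr_gt0 // mulr_gt0.
have [s1 s2 s3] : [/\ s <= d / 2, s <= 1 & s <= e / (2 * (`|q| + 1))] by rewrite /s !ge_min !lexx !orbT.
have := wpos s; rewrite s2 (ltW s0) => /(_ isT); rewrite /w => ws.
have sd : `|s| < d by rewrite gtr0_norm //; lra.
have := D s sd; rewrite (gtr0_norm s0) ler_norml => /andP[_ l].
move: s3; rewrite ler_pdivlMr ?mulr_gt0 // => s3.
have h1 : s * (L - q - dot g0 h) <= s * (e / 2 + - q * s) by lra.
move: h1; rewrite ler_pM2l // => h1; rewrite (le_trans h1) //.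
have : - q * s <= `|q| * s by rewrite ler_pM2r // -normrN ler_norm.
by have := s0; lra.
Qed.

End SegmentTaylor.

(** * Limits of slopes and differentiability *)

Section FirstOrder.
Context {R : realType} {n : nat}.
Implicit Types (x y g h : 'rV[R]_n) (f u phi psi : 'rV[R]_n -> R).

Lemma dot_continuous g : continuous (dot g).
Proof.
move=> x; apply: (@jet2_continuous _ _ _ _ g 0).
have := jet2_affine 0 g x; congr (jet2 _ _ _ _).
by apply/funext => y; rewrite add0r.
Qed.

(** The bound [B] puts the slopes in a compact ball. For fixed [h] the inequality is continuous in
    the slope, so a single cluster point serves all [h]. *)
Lemma slope_limit phi psi (D : set 'rV[R]_n) (B : R) :
  (forall e : R, 0 < e -> exists g, enorm g <= B /\ forall h, D h -> `|phi h - dot g h| <= psi h + e) ->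
  exists g, forall h, D h -> `|phi h - dot g h| <= psi h.
Proof.
move=> H.
have H' (m : nat) : exists g, enorm g <= B /\ forall h, D h -> `|phi h - dot g h| <= psi h + m.+1%:R^-1.
  by apply: H; rewrite invr_gt0 ltr0Sn.
have [g hg] := choice H'.
have pf : ProperFilter (g @ \oo) by exact: fmap_proper_filter.
have inF : (g @ \oo) (cball 0 B).
  by exists 0%N => // m _ /=; rewrite /cball /= subr0; have [] := hg m.
have [p [_ pc]] := cball_compact pf inF.
exists p => h Dh; apply/ler_addgt0Pr => e e0.
pose q := e / (2 * (enorm h + 1)).
have h1 : 0 < enorm h + 1 by rewrite ltr_wpDl // enorm_ge0.
have q0 : 0 < q by rewrite divr_gt0 // mulr_gt0.
have [||g' [/= Hg1 Hg2]] := pc [set g' | `|phi h - dot g' h| <= psi h + e / 2] [set g' | enorm (g' - p) < q].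
- have [N _ HN] : \forall m \near \oo, (m.+1%:R^-1 : R) < e / 2.
    have e20 : 0 < e / 2 by rewrite divr_gt0.
    exact: (near_infty_natSinv_lt (PosNum e20)).
  exists N => // m Nm /=; have [_ /(_ _ Dh) k] := hg m; rewrite (le_trans k) // lerD2l ltW //.
  exact: HN.
- by apply/near_enorm; exists q => // xi; rewrite /= addrAC subrr add0r.
have : dot (g' - p) h <= q * enorm h.
  by rewrite (le_trans (dot_le _ _)) // ler_wpM2r ?enorm_ge0 // ltW.
have : dot (p - g') h <= q * enorm h.
  by rewrite (le_trans (dot_le _ _)) // ler_wpM2r ?enorm_ge0 // enormBC ltW.
have qh : q * enorm h <= e / 2.
  have -> : e / 2 = q * (enorm h + 1) by rewrite /q; field; rewrite gt_eqF.
  by rewrite ler_pM2l // lerDl.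
rewrite !dotBl => l1 l2; move: Hg1; rewrite !ler_norml => /andP[k1 k2].
by apply/andP; split; lra.
Qed.

Lemma dot_linear g : linear (dot g : 'rV[R]_n -> R^o).
Proof. by move=> a x y; rewrite dotDr dotZr. Qed.

HB.instance Definition _ g := GRing.isLinear.Build R 'rV[R]_n R^o *:%R (dot g) (dot_linear g).

Lemma quadratic_differentiable u x g (C d : R) : 0 < d ->
  (forall h, enorm h < d -> `|u (x + h) - u x - dot g h| <= C * enorm h ^+ 2) ->
  differentiable u x /\ gradient u x = g.
Proof.
move=> d0 H; have C10 : 0 < `|C| + 1 by rewrite ltr_wpDl.
have H1 (e : R) : 0 < e -> exists2 d' : R, 0 < d' & forall h, enorm h < d' -> `|u (x + h) - u x - dot g h| <= e * enorm h.
  move=> e0; exists (Num.min d (e / (`|C| + 1))) => [|h]; first by rewrite lt_min d0 divr_gt0.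
  rewrite lt_min => /andP[/H l]; rewrite ltr_pdivlMr // => l2; rewrite (le_trans l) //.
  rewrite expr2 mulrA ler_wpM2r ?enorm_ge0 // (le_trans _ (ltW l2)) // mulrC ler_wpM2l ?enorm_ge0 //.
  by rewrite (le_trans (ler_norm _)) // lerDl.
split.
  have E : u \o shift x = cst (u x) + (dot g : {linear 'rV[R]_n -> R^o}) +o_ (0 : 'rV[R]_n) id.
    apply/eqaddoP => e e0; have n1 : 0 < n%:R + 1 :> R by rewrite ltr_wpDl.
    (* The differential is defined with the maximum norm, so the accuracy in the Euclidean norm must
       be finer by a factor of order [n]. *)
    have e1 : 0 < e / (n%:R + 1) by rewrite divr_gt0.
    have [d' d'0 D'] := H1 _ e1.
    apply/near_enorm; exists d' => // h /D' l; rewrite add0r.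
    rewrite /= !fctE /= /shift (addrC h) opprD addrA (le_trans l) //.
    rewrite (le_trans (ler_wpM2l (ltW e1) (enorm_le_mxnorm h))) // mulrA ler_wpM2r //.
    by rewrite mulrAC ler_pdivrMr // ler_pM2l // lerDl.
  apply/diff_locallyP.
  have dE := diff_unique (@dot_continuous g) E.
  by rewrite dE; split => //; exact: dot_continuous.
apply/rowP => i; rewrite mxE /partial.
have dd : is_derive x (ebasis i) u (g ord0 i).
  apply: is_derive_dir => q q0; have [d' d'0 D'] := H1 _ q0.
  exists d' => // t td; have := D' (t *: ebasis i).
  by rewrite enormZ enorm_ebasis mulr1 dotZr dot_ebasis; exact.
exact: derive_val.
Qed.

End FirstOrder.

(** Removes a parameter that enters as a linear error; the restriction [tau <= 1/2] is that of the
    two maximum arguments. *)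
Lemma le_small_error (R : realType) (x a b : R) :
  (forall tau, 0 < tau -> tau <= 1/2 -> x <= a + tau * b) -> x <= a.
Proof.
move=> H; apply/ler_addgt0Pr => e e0.
have b0 : 0 < `|b| + 1 by rewrite ltr_wpDl.
pose tau := Num.min (1/2) (e / (`|b| + 1)).
have t0 : 0 < tau by rewrite lt_min !divr_gt0.
have [t1 t2] : tau <= 1/2 /\ tau <= e / (`|b| + 1) by rewrite /tau !ge_min !lexx orbT.
rewrite (le_trans (H _ t0 t1)) // lerD2l (@le_trans _ _ (tau * (`|b| + 1))) //.
  by rewrite ler_pM2l // (le_trans (ler_norm _)) // lerDl.
by move: t2; rewrite ler_pdivlMr.
Qed.

Lemma barrier_le (R : realType) (n : nat) (rho c : R) (z : 'rV[R]_n) :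
  0 < c -> 1 <= c * (rho ^+ 2 - enorm z ^+ 2) -> barrier rho z <= c * c.
Proof.
move=> c0 h; set w := rho ^+ 2 - enorm z ^+ 2 in h.
have w0 : 0 < w by move: (lt_le_trans ltr01 h); rewrite pmulr_rgt0.
rewrite /barrier -/w -div1r ler_pdivrMr ?exprn_gt0 //.
have -> : c * c * w ^+ 2 = (c * w) ^+ 2 by ring.
by rewrite exprn_ege1.
Qed.

(** * Estimates for the solution and its approximants *)

Section Regularity.
Context {R : realType} {n : nat}.
Variables (lam Lam : R) (F : 'M[R]_n -> R).
Hypotheses (lam0 : 0 < lam) (lamLam : lam <= Lam) (Fell : uniformly_elliptic lam Lam F).
Hypothesis (Fqc : quasiconcave F).
Variables (u : 'rV[R]_n -> R) (kap : R) (e0 : 'rV[R]_n).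
Hypotheses (e01 : enorm e0 = 1) (hu : viscosity_solution F (eball 0 1) u).
Hypothesis uK : forall x, eball 0 1 x -> `|u x| <= kap.
Hypotheses (kap0 : 0 < kap) (Fk : `|F 0| <= lam * kap).
Implicit Types (x y z h g xi e : 'rV[R]_n) (X : 'M[R]_n) (r eps : R).

Let L := Lam / lam.
(* 20 * 20 and 11 * 11 bound the barriers of radii 15/16 and 13/16 on the balls of radii
   29/32 and 3/4. *)
Definition lip_const := kap * (1 + 20 * 20 * (64 * 45 * L)).
Definition semiconcavity_const := 11 * 11 * (32 * 32 * 32 * lip_const * L).
Definition hessian_const := kap + L * semiconcavity_const.
Let G := lip_const.
Let M := semiconcavity_const.
Let M' := hessian_const.

Let LE : L * lam = Lam. Proof. by rewrite /L divfK // gt_eqF. Qed.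
Let L1 : 1 <= L. Proof. by rewrite /L ler_pdivlMr // mul1r. Qed.
Let L0 : 0 <= L. Proof. exact: le_trans L1. Qed.

Lemma lip_const_ge : kap <= G.
Proof. by rewrite /G /lip_const ler_pMr // lerDl (mulr_ge0 _ (mulr_ge0 _ L0)). Qed.

Let G0 : 0 < G. Proof. exact: lt_le_trans lip_const_ge. Qed.

Let M0 : 0 <= M.
Proof.
by rewrite /M /semiconcavity_const (mulr_ge0 _ (mulr_ge0 (mulr_ge0 _ (ltW G0)) L0)).
Qed.

Let MM' : M <= M'.
Proof.
rewrite /M' /hessian_const -/M (le_trans (_ : M <= L * M)) //; last by rewrite lerDr ltW.
by rewrite ler_peMl.
Qed.

Let M'0 : 0 <= M'. Proof. exact: le_trans MM'. Qed.

(** The superlevel set is nonempty because ellipticity lifts [F] at the scalar matrix [|F 0| / lam]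
    to at least [F 0 + |F 0|]. *)
Lemma approximation eps : 0 < eps -> exists U, approximant F u kap eps U.
Proof.
move=> eps0; have s0 : symmx (0 : 'M[R]_n) by rewrite /symmx /= trmx0.
have t0 : 0 <= `|F 0| / lam by rewrite divr_ge0 // ltW.
have st := symmx_scalar (n := n) (`|F 0| / lam).
apply: (approximant_exists lam0 lamLam Fell Fqc hu.1 uK st _ eps0).
have := ell_lower lam0 Fell s0 st (psd_scalar t0) e01.
rewrite add0r qf_scalar e01 expr1n mulr1 mulrC divfK ?gt_eqF // => h; rewrite (le_trans _ h) //.
by have := ler_norm (- F 0); rewrite normrN; lra.
Qed.

Lemma solution_lipschitz z e r : enorm e = 1 -> enorm z <= 29/32 -> 0 <= r <= 1/32 ->
  u (z + r *: e) - u z <= G * r.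
Proof.
move=> e1 z1 r01; apply: (@le_small_error _ _ _ (G + kap / 2)) => tau tau0 tau1.
have eps0 : 0 < tau * kap / 2 by rewrite !mulr_gt0.
have [U aU] := approximation eps0.
have tE : `|F 0| / lam * lam = `|F 0| by rewrite divfK // gt_eqF.
have tk : `|F 0| / lam <= kap by rewrite ler_pdivrMr // mulrC.
have Bk : (1/8) / kap * kap = 1/8 by rewrite divfK // gt_eqF.
have NE : 64 * 45 * kap * L * lam = 64 * 45 * kap * Lam by rewrite -[Lam]LE; ring.
have zl : enorm z < 15/16 by lra.
have := lipschitz_bound lam0 lamLam Fell Fqc hu.2 uK kap0 tau0 tau1 e1 (approx_close aU)
  (fun x _ => approx_bound aU x) (approx_jet aU) tE tk Bk NE zl r01.
have bz : barrier (15/16) z <= 20 * 20.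
  by apply: barrier_le => //; have := enorm_ge0 z; nra.
have /andP[r0 r1] := r01.
have zr : enorm (z + r *: e) <= 31/32.
  by rewrite (le_trans (enormD _ _)) // enormZ e1 mulr1 ger0_norm //; lra.
have := approx_close aU zr; rewrite ler_norml => /andP[c1 _].
have h : (r + tau) * (kap + 64 * 45 * kap * L * barrier (15 / 16) z) <= (r + tau) * G.
  have rt : 0 <= r + tau by rewrite addr_ge0 // ltW.
  rewrite ler_wpM2l // /G /lip_const.
  have k0 : 0 <= 64 * 45 * kap * L by rewrite (mulr_ge0 (mulr_ge0 _ (ltW kap0)) L0).
  by have := ler_wpM2l k0 bz; lra.
by move: h c1; lra.
Qed.

(** Drawn from the bound for [u] through [approx_comb], not from [lipschitz_bound]: the second
    difference argument needs a bound proportional to [r] down to [r = 0], free of the shift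
    [tau]. *)
Lemma approximant_lipschitz eps U x e r : approximant F u kap eps U -> eps <= 1/32 -> enorm e = 1 ->
  enorm x <= 27/32 -> 0 <= r <= 1/32 -> `|U (x + r *: e) - U x| <= G * r.
Proof.
move=> aU eps1 e1 x1 r01; have /andP[r0 r1] := r01.
have E : enorm (r *: e) = r by rewrite enormZ e1 mulr1 ger0_norm.
have xh : enorm x + enorm (r *: e) <= 31/32 by rewrite E; lra.
have yl y : enorm (y - x) <= eps -> enorm y <= 28/32.
  by move=> hy; rewrite -(subrK x y) (le_trans (enormD _ _)) //; lra.
rewrite ler_norml; apply/andP; split.
  have P y : enorm (y - x) <= eps ->
      -1 * u (y + r *: e) + 0 * u (y - r *: e) + 1 * u y <= G * r.
    move=> /yl hy; have e1' : enorm (- e) = 1 by rewrite enormN.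
    have w1 : enorm (y + r *: e) <= 29/32 by rewrite (le_trans (enormD _ _)) // E; lra.
    by have := solution_lipschitz e1' w1 r01; rewrite scalerN addrK; lra.
  by have := approx_comb aU xh P; lra.
have P y : enorm (y - x) <= eps ->
    1 * u (y + r *: e) + 0 * u (y - r *: e) + -1 * u y <= G * r.
  move=> /yl hy; have w1 : enorm y <= 29/32 by lra.
  by have := solution_lipschitz e1 w1 r01; lra.
by have := approx_comb aU xh P; lra.
Qed.

Lemma solution_semiconcave z e r : enorm e = 1 -> enorm z <= 3/4 -> 0 <= r <= 1/64 ->
  u (z + r *: e) + u (z - r *: e) - 2 * u z <= M * r ^+ 2.
Proof.
move=> e1 z1 r01; apply: (@le_small_error _ _ _ (2 * M * r + M / 2 + G)) => tau tau0 tau1.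
pose eps := Num.min (tau ^+ 2 * G) (1/32).
have eps0 : 0 < eps by rewrite lt_min mulr_gt0 ?exprn_gt0 //= divr_gt0.
have [eps1 eps2] : eps <= tau ^+ 2 * G /\ eps <= 1/32 by rewrite /eps !ge_min !lexx orbT.
have [U aU] := approximation eps0.
have kG := lip_const_ge.
have BG : 8 / G * G = 8 by rewrite divfK // gt_eqF.
have NE : 32 * 32 * 32 * G * L * lam = 32 * 32 * 32 * G * Lam by rewrite -[Lam]LE; ring.
have zl : enorm z < 13/16 by lra.
have Uu x : enorm x <= 31/32 -> `|U x - u x| <= tau ^+ 2 * G.
  by move=> /(approx_close aU) /le_trans; exact.
have UL x s : enorm x <= 27/32 -> 0 <= s <= 1/32 -> `|U (x + s *: e) - U x| <= G * s.
  exact: approximant_lipschitz aU eps2 e1.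
have := semiconcave_bound lam0 lamLam Fell Fqc hu.2 (fun x hx => le_trans (uK hx) kG) G0 tau0 tau1 e1
  Uu (fun x _ => le_trans (approx_bound aU x) kG) (approx_jet aU) UL BG NE zl r01.
have bz : barrier (13/16) z <= 11 * 11.
  by apply: barrier_le => //; have := enorm_ge0 z; nra.
have /andP[r0 r1] := r01.
have zr : enorm (z + r *: e) <= 31/32.
  by rewrite (le_trans (enormD _ _)) // enormZ e1 mulr1 ger0_norm //; lra.
have zr' : enorm (z - r *: e) <= 31/32.
  by rewrite (le_trans (enormB _ _)) // enormZ e1 mulr1 ger0_norm //; lra.
have := Uu _ zr; rewrite ler_norml => /andP[c1 _].
have := Uu _ zr'; rewrite ler_norml => /andP[c2 _].
rewrite scalerN.
have h : 32 * 32 * 32 * G * L * barrier (13 / 16) z * (r + tau) ^+ 2 <= M * (r + tau) ^+ 2.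
  rewrite ler_wpM2r ?sqr_ge0 // /M /semiconcavity_const -/G.
  have k0 : 0 <= 32 * 32 * 32 * G * L by rewrite (mulr_ge0 (mulr_ge0 _ (ltW G0)) L0).
  by have := ler_wpM2l k0 bz; lra.
have t2 : tau ^+ 2 <= tau / 2 by rewrite expr2 ler_pM2l //; lra.
have t3 : M * tau ^+ 2 <= M * (tau / 2) by rewrite ler_wpM2l.
have t4 : tau ^+ 2 * G <= tau / 2 * G by rewrite ler_pM2r.
have E : M * (r + tau) ^+ 2 = M * r ^+ 2 + tau * (2 * M * r) + M * tau ^+ 2 by ring.
by move: h c1 c2; rewrite E; lra.
Qed.

Lemma approximant_jet_upper eps U x g X e : approximant F u kap eps U -> eps <= 1/32 ->
  enorm x <= 23/32 -> jet2 U x g X -> enorm e = 1 -> qf X e <= M.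
Proof.
move=> aU eps1 x1 jX e1; apply: (@le_small_error _ _ _ 2) => q q0 _.
have [d d0 D] := jX _ q0.
pose r := Num.min (d / 2) (1/64).
have r0 : 0 < r by rewrite lt_min !divr_gt0.
have [r1 r2] : r <= d / 2 /\ r <= 1/64 by rewrite /r !ge_min !lexx orbT.
have E : enorm (r *: e) = r by rewrite enormZ e1 mulr1 gtr0_norm.
have E' : enorm (- (r *: e)) = r by rewrite enormN.
have rd : r < d by lra.
have := D (r *: e); rewrite E => /(_ rd); rewrite ler_norml => /andP[l1 _].
have := D (- (r *: e)); rewrite E' => /(_ rd); rewrite ler_norml => /andP[l2 _].
have xh : enorm x + enorm (r *: e) <= 31/32 by rewrite E; lra.
have P y : enorm (y - x) <= eps ->
    1 * u (y + r *: e) + 1 * u (y - r *: e) + -2 * u y <= M * r ^+ 2.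
  move=> hy; have y1 : enorm y <= 3/4 by rewrite -(subrK x y) (le_trans (enormD _ _)) //; lra.
  have r01 : 0 <= r <= 1/64 by rewrite ltW.
  by have := solution_semiconcave e1 y1 r01; lra.
have := approx_comb aU xh P; move: l1 l2; rewrite dotNr qfNr qfZr => l1 l2 l3.
have r20 : 0 < r ^+ 2 by rewrite exprn_gt0.
have : r ^+ 2 * qf X e <= r ^+ 2 * (M + q * 2) by lra.
by rewrite ler_pM2l.
Qed.

Lemma qf_unit_le X (c : R) : (forall e, enorm e = 1 -> qf X e <= c) ->
  forall xi, qf X xi <= c * enorm xi ^+ 2.
Proof.
move=> H xi; have [->|xi0] := eqVneq xi 0; first by rewrite qf0r enorm0 expr0n mulr0.
have v0 : 0 < enorm xi by rewrite enorm_gt0.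
have -> : xi = enorm xi *: ((enorm xi)^-1 *: xi) by rewrite scalerA divff ?scale1r // gt_eqF.
have E : enorm ((enorm xi)^-1 *: xi) = 1.
  by rewrite enormZ gtr0_norm ?invr_gt0 // mulVf // gt_eqF.
by rewrite qfZr enormZ E mulr1 (gtr0_norm v0) mulrC ler_wpM2r ?sqr_ge0 // H.
Qed.

(** For the lower bound, [X] lies below [M%:M], where [F] is at most [F 0 + Lam * M], while
    [F X >= 0]. Ellipticity in direction [e] then bounds [M - qf X e] by [kap + L * M]. *)
Lemma approximant_hessian eps U x g X : approximant F u kap eps U -> eps <= 1/32 ->
  enorm x <= 23/32 -> symmx X -> jet2 U x g X -> 0 <= F X ->
  forall xi, `|qf X xi| <= M' * enorm xi ^+ 2.
Proof.
move=> aU eps1 x1 sX jX FX xi; have h e := @approximant_jet_upper eps U x g X e aU eps1 x1 jX.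
rewrite ler_norml; apply/andP; split; last first.
  by rewrite (le_trans (qf_unit_le h xi)) // ler_wpM2r // sqr_ge0.
rewrite lerNl -qfNl; apply: qf_unit_le => e e1; rewrite qfNl.
have sN : symmx (M%:M - X) by apply: symmxB => //; exact: symmx_scalar.
have pN : psd (M%:M - X).
  by move=> y; rewrite -/(qf _ y) qfBl qf_scalar subr_ge0; exact: qf_unit_le.
have := ell_lower lam0 Fell sX sN pN e1.
have s0 : symmx (0 : 'M[R]_n) by rewrite /symmx /= trmx0.
have := ell_scalar lam0 lamLam Fell s0 M0.
rewrite add0r (addrC X) subrK qfBl qf_scalar e1 expr1n mulr1 => k1 k2.
have k3 := le_trans (ler_norm _) Fk.
have lM : 0 <= lam * M by rewrite mulr_ge0 // ltW.
rewrite -(ler_pM2l lam0) /M' /hessian_const -/M.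
have : lam * (kap + L * M) = lam * kap + Lam * M by rewrite -[Lam]LE; ring.
by lra.
Qed.

Lemma ball_segment x h (rho t : R) : enorm x <= rho -> enorm (x + h) <= rho -> 0 <= t <= 1 ->
  enorm (x + t *: h) <= rho.
Proof.
move=> h1 h2 /andP[t0 t1].
have -> : x + t *: h = (1 - t) *: x + t *: (x + h).
  by rewrite scalerBl scale1r scalerDr addrA subrK.
have t1' : 0 <= 1 - t by rewrite subr_ge0.
rewrite (le_trans (enormD _ _)) // !enormZ !ger0_norm //.
by have := ler_wpM2l t0 h2; have := ler_wpM2l t1' h1; lra.
Qed.

Lemma approximant_taylor eps U x g X h : approximant F u kap eps U -> eps <= 1/32 ->
  enorm x <= 23/32 -> enorm (x + h) <= 23/32 -> jet2 U x g X ->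
  `|U (x + h) - U x - dot g h| <= M' / 2 * enorm h ^+ 2.
Proof.
move=> aU eps1 x1 xh jX.
have seg (t : R) : 0 <= t <= 1 -> exists g' X', jet2 U (x + t *: h) g' X' /\ `|qf X' h| <= M' * enorm h ^+ 2.
  move=> t01; have tl := ball_segment x1 xh t01.
  have [|g' [X' [sX' jX' FX']]] := approx_jet aU (x := x + t *: h); first by lra.
  by exists g', X'; split => //; exact: approximant_hessian aU eps1 tl sX' jX' FX' _.
have k1 : U (x + h) <= U x + dot g h + M' * enorm h ^+ 2 / 2.
  apply: (jet2_segment jX) => t /seg [g' [X' [jX' ]]]; rewrite ler_norml => /andP[_ hX'].
  by exists g', X'.
have k2 : - U (x + h) <= - U x + dot (- g) h + M' * enorm h ^+ 2 / 2.
  apply: (jet2_segment (f := fun y => - U y) (jet2N jX)) => t /seg [g' [X' [jX' ]]].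
  rewrite ler_norml => /andP[hX' _].
  by exists (- g'), (- X'); split; [exact: jet2N | rewrite qfNl lerNl].
by rewrite ler_norml; apply/andP; split; move: k2; rewrite dotNl; lra.
Qed.

Lemma solution_slope x : enorm x <= 1/2 -> exists g, forall h, enorm (x + h) <= 23/32 ->
  `|u (x + h) - u x - dot g h| <= M' / 2 * enorm h ^+ 2.
Proof.
move=> x1.
apply: (@slope_limit _ _ (fun h => u (x + h) - u x) (fun h => M' / 2 * enorm h ^+ 2)
  [set h | enorm (x + h) <= 23/32] (32 * (2 * kap + M'))) => q q0.
pose eps := Num.min (q / 2) (1/32).
have eps0 : 0 < eps by rewrite lt_min !divr_gt0.
have [eps1 eps2] : eps <= q / 2 /\ eps <= 1/32 by rewrite /eps !ge_min !lexx orbT.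
have [U aU] := approximation eps0.
have x2 : enorm x <= 31/32 by lra.
have x3 : enorm x <= 23/32 by lra.
have [g [X [sX jX FX]]] := approx_jet aU x2.
have T h := @approximant_taylor eps U x g X h aU eps2 x3 ^~ jX.
exists g; split; last first.
  move=> h /= xh; have xh' : enorm (x + h) <= 31/32 by lra.
  have := approx_close aU x2; have := approx_close aU xh'; have := T _ xh.
  by rewrite !ler_norml => /andP[a1 a2] /andP[b1 b2] /andP[c1 c2]; apply/andP; split; lra.
have [->|g0] := eqVneq g 0; first by rewrite enorm0 mulr_ge0 // addr_ge0 // mulr_ge0 // ltW.
have v0 : 0 < enorm g by rewrite enorm_gt0.
(* A displacement of length 1/32 along [g] stays in the ball, so the bound of [U] and Taylor's
   inequality control [enorm g] independently of [q]. *)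
pose h := (1/32 / enorm g) *: g.
have Eh : enorm h = 1/32 by rewrite /h enormZ gtr0_norm ?divr_gt0 // divfK // gt_eqF.
have xh : enorm (x + h) <= 23/32 by rewrite (le_trans (enormD _ _)) // Eh; lra.
have := T _ xh; rewrite Eh /h dotZr -enorm_sqr -/h ler_norml => /andP[t1 _].
have E : 1 / 32 / enorm g * enorm g ^+ 2 = enorm g / 32 by field; rewrite gt_eqF.
have := approx_bound aU x; have := approx_bound aU (x + h).
rewrite !ler_norml => /andP[_ b1] /andP[b2 _].
have := M'0; move: t1; rewrite E => t1 m0.
have m1 : M' / 2 * (1 / 32) ^+ 2 <= M' by nra.
by lra.
Qed.

(** The expansion at [x] is used at [y] and at [y + k], the one at [y] at [y + k], with [k] along
    the difference of gradients and of length [d / 8]. The values of [u] cancel, leaving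
    [dot v k = enorm v * d / 8] against remainders of order [M' * d ^+ 2]. *)
Lemma gradient_lipschitz x y : enorm x < 1/2 -> enorm y < 1/2 ->
  differentiable u x /\ enorm (gradient u x - gradient u y) <= 16 * M' * enorm (x - y).
Proof.
move=> x1 y1.
have [gx hx] := solution_slope (ltW x1); have [gy hy] := solution_slope (ltW y1).
have loc z (z1 : enorm z < 1/2) (h : 'rV[R]_n) : enorm h < 1/8 -> enorm (z + h) <= 23/32.
  by move=> h1; rewrite (le_trans (enormD _ _)) //; lra.
have d8 : 0 < 1/8 :> R by lra.
have [dx Ex] := quadratic_differentiable d8 (fun h lt8 => hx h (loc _ x1 _ lt8)).
have [_ Ey] := quadratic_differentiable d8 (fun h lt8 => hy h (loc _ y1 _ lt8)).
split => //.
have [<-|xy] := eqVneq x y; first by rewrite !subrr enorm0 mulr0.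
rewrite Ex Ey; set v := gx - gy; set d := enorm (x - y).
have d0 : 0 < d by rewrite enorm_gt0 subr_eq0.
have d1 : d <= 1 by rewrite (le_trans (enormB _ _)) //; lra.
have [->|v0] := eqVneq v 0; first by rewrite enorm0 !mulr_ge0 // ltW.
have nv : 0 < enorm v by rewrite enorm_gt0.
pose k := (d / 8 / enorm v) *: v.
have Ek : enorm k = d / 8 by rewrite /k enormZ gtr0_norm ?divr_gt0 // divfK // gt_eqF.
have vk : dot v k = enorm v * d / 8.
  by rewrite /k dotZr -enorm_sqr; field; rewrite gt_eqF.
have yk : enorm (y + k) <= 23/32 by rewrite (le_trans (enormD _ _)) // Ek; lra.
have := hy k yk; rewrite Ek.
have y2 : enorm y <= 23/32 by lra.
have := hx (y - x); rewrite (addrC x) subrK => /(_ y2).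
have := hx (y - x + k); rewrite addrA (addrC x) subrK => /(_ yk).
rewrite dotDr (enormBC y) -/d.
have ek : enorm (y - x + k) <= d * 9 / 8.
  by rewrite (le_trans (enormD _ _)) // Ek (enormBC y) -/d; lra.
have ek2 : enorm (y - x + k) ^+ 2 <= (d * 9 / 8) ^+ 2 by rewrite lerXn2r ?nnegrE ?enorm_ge0 //; lra.
have ek3 := ler_wpM2l M'0 ek2.
have Ev : dot v k = dot gx k - dot gy k by rewrite /v dotBl.
rewrite !ler_norml => /andP[a1 a2] /andP[b1 b2] /andP[c1 c2].
have md : 0 <= M' * d ^+ 2 by rewrite mulr_ge0 ?M'0 ?sqr_ge0.
have : d * enorm v <= d * (16 * M' * d) by move: Ev; rewrite vk; lra.
by rewrite ler_pM2l.
Qed.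

End Regularity.

Theorem theorem4p3 (R : realType) (n : nat) (lam Lam : R) :
  0 < lam -> lam <= Lam ->
  exists C : R, 0 < C /\
  forall (F : 'M[R]_n -> R) (u : 'rV[R]_n -> R) (K : R),
    uniformly_elliptic lam Lam F ->
    {within symmx, continuous F} ->
    quasiconcave F ->
    viscosity_solution F (eball 0 1) u ->
    (forall x, eball 0 1 x -> `|u x| <= K) ->
    (forall x, eball 0 (1/2) x -> differentiable u x) /\
    (forall x y, eball 0 (1/2) x -> eball 0 (1/2) y ->
       enorm (gradient u x - gradient u y)
         <= C * (K + `|F 0|) * enorm (x - y)).
Proof.
move=> lam0 lamLam.
pose c := hessian_const lam Lam 1.
have L0 : 0 <= Lam / lam by rewrite divr_ge0 ?(le_trans (ltW lam0) lamLam) // ltW.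
(* Every constant is proportional to the bound of the solution, which makes the final estimate
   linear in [K] and [|F 0|]. *)
have cE (k : R) : hessian_const lam Lam k = c * k.
  by rewrite /c /hessian_const /semiconcavity_const /lip_const; ring.
have c0 : 0 < c.
  rewrite /c /hessian_const /semiconcavity_const /lip_const.
  have h1 : 0 <= 1 + 20 * 20 * (64 * 45 * (Lam / lam)).
    by rewrite addr_ge0 // (mulr_ge0 _ (mulr_ge0 _ L0)).
  rewrite ltr_pwDl // (mulr_ge0 L0) // (mulr_ge0 _ (mulr_ge0 (mulr_ge0 _ _) L0)) //.
  by rewrite mul1r.
have q0 : 0 < 1 + lam^-1 by rewrite addr_gt0 ?invr_gt0.
exists (16 * c * (1 + lam^-1)); split; first by rewrite !mulr_gt0.
move=> F u K Fell _ Fqc hu uK.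
(* In dimension zero there is no unit vector to work along; there [u] is constant. *)
case: n F u Fell Fqc hu uK => [|n] F u Fell Fqc hu uK.
  split=> [x _|x y _ _]; last by rewrite (thinmx0 (x - y)) (thinmx0 (_ - _)) enorm0 mulr0.
  have -> : u = cst (u 0) by apply/funext => y; rewrite (thinmx0 y).
  exact: differentiable_cst.
have K0 : 0 <= K.
  by rewrite (le_trans (normr_ge0 (u 0))) // uK // /eball /= subr0 enorm0.
(* [delta] keeps the bound positive when [K] and [F 0] both vanish; it tends to 0 at the end. *)
have H (delta : R) : 0 < delta -> forall x y, eball 0 (1/2) x -> eball 0 (1/2) y ->
    differentiable u x /\ enorm (gradient u x - gradient u y) <=
      16 * (c * (K + `|F 0| / lam + delta)) * enorm (x - y).
  move=> d0 x y; rewrite /eball /= !subr0 => x1 y1.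
  have f0 : 0 <= `|F 0| / lam by rewrite divr_ge0 // ltW.
  have k0 : 0 < K + `|F 0| / lam + delta by rewrite ltr_wpDl // addr_ge0.
  have uk z : eball 0 1 z -> `|u z| <= K + `|F 0| / lam + delta.
    by move=> /uK h; rewrite (le_trans h) // -addrA lerDl addr_ge0 // ltW.
  have Fk : `|F 0| <= lam * (K + `|F 0| / lam + delta).
    have -> : lam * (K + `|F 0| / lam + delta) = `|F 0| + lam * (K + delta).
      by field; rewrite gt_eqF.
    by rewrite lerDl mulr_ge0 ?addr_ge0 // ltW.
  rewrite -cE.
  exact: (gradient_lipschitz lam0 lamLam Fell Fqc (enorm_ebasis (ord0 : 'I_n.+1)) hu uk k0 Fk x1 y1).
split=> [x x1|x y x1 y1]; first by have [] := H 1 ltr01 x x x1 x1.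
apply: (@le_small_error _ _ _ (16 * c * enorm (x - y))) => delta d0 _.
have [_ /le_trans -> //] := H delta d0 x y x1 y1.
have h : K + `|F 0| / lam <= (1 + lam^-1) * (K + `|F 0|).
  have : 0 <= lam^-1 * K by rewrite mulr_ge0 // invr_ge0 ltW.
  by have := normr_ge0 (F 0); lra.
have p0 : 0 <= 16 * c * enorm (x - y) by rewrite !mulr_ge0 ?enorm_ge0 // ltW.
by have := ler_wpM2l p0 h; lra.
Qed.
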